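(* \textsc{Diameter} can be solved in $O(k\cdot n)$ time on graphs with $n$ vertices and feedback edge number $k$.
   Context: \textsc{Diameter}: given an undirected, connected, unweighted graph $G=(V,E)$ with $n=|V|$, compute the length of a longest shortest path in $G$. The feedback edge number of $G$ is the minimum number of edges whose deletion makes $G$ acyclic (a tree, for connected $G$). *)

(* Defs.v *)
From mathcomp Require Import all_boot.
Set Implicit Arguments. Unset Strict Implicit. Unset Printing Implicit Defensive.

Definition adjE n (E : {set {set 'I_n}}) : rel 'I_n :=
  fun x y => (x != y) && ([set x; y] \in E).

Definition edges_of n (es : seq ('I_n * 'I_n)) : {set {set 'I_n}} :=
  [set [set p.1; p.2] | p in es].

Definition is_cycle n (e : rel 'I_n) (c : seq 'I_n) : Prop :=
  [/\ uniq c, 3 <= size c & cycle e c].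

Definition acyclic n (e : rel 'I_n) : Prop :=
  forall c : seq 'I_n, ~ is_cycle e c.

Definition feedback_edge_number n (E : {set {set 'I_n}}) (k : nat) : Prop :=
  (exists F : {set {set 'I_n}},
      [/\ F \subset E, #|F| = k & acyclic (adjE (E :\: F))]) /\
  (forall F : {set {set 'I_n}},
      F \subset E -> acyclic (adjE (E :\: F)) -> k <= #|F|).

Definition walk n (e : rel 'I_n) (u v : 'I_n) (p : seq 'I_n) : bool :=
  path e u p && (last u p == v).

(* d is the diameter: the maximum over pairs (u,v) of the length of a
   shortest u-v path (= shortest u-v walk). *)
Definition is_diameter n (e : rel 'I_n) (d : nat) : Prop :=
  (forall u v : 'I_n, exists p, walk e u v p /\ size p <= d) /\
  (exists u v : 'I_n, forall p, walk e u v p -> d <= size p).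

Inductive instr : Type :=
  | IConst (r v : nat)
  | IAdd (r a b : nat)
  | ISub (r a b : nat)
  | ILoad (r a : nat)
  | IStore (a b : nat)
  | IJz (a tgt : nat)
  | IHalt.

Definition program := seq instr.

Record state := State { pc : nat; regs : nat -> nat }.

Definition upd (m : nat -> nat) (r v : nat) : nat -> nat :=
  fun i => if i == r then v else m i.

Definition fetch (P : program) (s : state) : instr := nth IHalt P (pc s).

Definition halted (P : program) (s : state) : bool :=
  if fetch P s is IHalt then true else false.

Definition step (P : program) (s : state) : state :=
  let m := regs s in
  let q := (pc s).+1 in
  match fetch P s with
  | IConst r v => State q (upd m r v)
  | IAdd r a b => State q (upd m r (m a + m b))
  | ISub r a b => State q (upd m r (m a - m b))
  | ILoad r a => State q (upd m r (m (m a)))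
  | IStore a b => State q (upd m (m a) (m b))
  | IJz a tgt => State (if m a == 0 then tgt else q) m
  | IHalt => s
  end.

Definition run (P : program) (t : nat) (s : state) : state := iter t (step P) s.

(* Input encoding of a graph given by an edge list es on 'I_n:
   M[0] = n, M[1] = m = size es, M[2+2i] = u_i, M[3+2i] = v_i for the
   i-th edge (u_i, v_i); all other registers 0; pc = 0.
   Output: M[0] when the machine halts. *)
Definition init_mem n (es : seq ('I_n * 'I_n)) : nat -> nat :=
  fun i =>
    if i == 0 then n
    else if i == 1 then size es
    else if (2 <= i) && (i - 2 < 2 * size es) then
      let p := nth (0, 0) (map (fun e => (val e.1, val e.2)) es) ((i - 2)./2) in
      if odd (i - 2) then p.2 else p.1
    else 0.

Definition init_state n (es : seq ('I_n * 'I_n)) : state := State 0 (init_mem es).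

(* Main.v *)
Require Import Defs.
From mathcomp Require Import all_boot.
From mathcomp Require Import zify.
Set Implicit Arguments. Unset Strict Implicit. Unset Printing Implicit Defensive.

(* Fix a BFS tree rooted at 0. The root, the endpoints of the at most k
   non-tree edges and the branching points of the tree paths between them are
   called anchors; there are O(k) of them, and at most n. Removing the anchors
   leaves tree pieces, which are grouped into classes, one per anchor s, so
   that every path leaving the class of s passes through s or through the next
   anchor anc s on the way to the root. Inside a class distances are tree
   distances, because of two branches at a vertex at least one is a hanging
   tree; the largest one is found by a bottom-up recursion on heights. For u in
   the class of s and w outside,
     d(u,w) = min (d(u,s) + d(s,w), d(u,a) + d(a,w)) with a = anc s,
   and the first term is the smaller one iff
     d(s,w) - d(a,w) <= d(u,a) - d(u,s).
   After a BFS from s and one from a, bucketing the vertices w by the left-hand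
   side and taking prefix maxima yields the maximum over all such pairs (u,w)
   in time O(n + k), hence O(k n) for all anchors.

   Commands are executed on variables and unbounded arrays, with a clock that
   counts basic commands; compilation costs a constant factor. *)

(** * A while-language and its execution *)

(** A search costs O(n + m) with m < k + n, and k may far exceed n. With S anchors the total
    contains S m <= S k + S n: the first summand needs S <= n, the second S <= 4 k + 2. The latter
    bound comes from at most two marks per non-tree edge and one for the root, doubled when the
    marks are closed under branching points. A spanning tree leaves at most m - n + 1 non-tree
    edges, and this is at most k because a forest has fewer than n edges. Branching points have to
    be anchors so that the core of a class is one ascending tree path with an exit at each end;
    otherwise two attachment vertices, and so two searches, would not suffice for a class. The
    result must be the diameter and not only an upper bound. Hence the running maximum is kept at
    most the true one, and every candidate, a sum of heights or a detour through an attachment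
    vertex, has to be bounded by an actual distance. *)

Inductive exp :=
  | Var of nat
  | Cst of nat
  | Add of exp & exp
  | Sub of exp & exp
  | Arr of nat & exp.

Inductive cmd :=
  | Asg of nat & exp
  | Rd of nat & exp
  | Put of nat & exp & exp
  | Seq of cmd & cmd
  | If of exp & cmd & cmd
  | While of exp & cmd.

Record store := Store {
  vr : nat -> nat;
  ar : nat -> nat -> nat;
  clock : nat }.

Definition tick s := Store (vr s) (ar s) (clock s).+1.

Definition setv s x v :=
  Store (fun y => if Nat.eqb y x then v else vr s y) (ar s) (clock s).+1.

Definition seta s a i v :=
  Store (vr s)
    (fun b => if Nat.eqb b a then fun j => if j == i then v else ar s a j
              else ar s b)
    (clock s).+1.

Fixpoint eval s e :=
  match e with
  | Var x => vr s x
  | Cst c => c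
  | Add e1 e2 => eval s e1 + eval s e2
  | Sub e1 e2 => eval s e1 - eval s e2
  | Arr a e => ar s a (eval s e)
  end.

(* Registers 0..19 hold the variables, register 20 the address of the array
   area, registers 21..31 are temporaries; the word a of array i is stored at
   address B + 16 * i + a, so that all arrays are unbounded. *)
Notation nvars := 20.
Notation rbase := 20.
Notation rtmp := 21.
Notation rmax := 31.

Section Semantics.
Variables (raw : nat -> nat) (B : nat).

(** [raw] is the input region, the addresses strictly between [rmax] and [B], which no command
    writes. A read outside it has no rule, so an execution certifies that its reads are in range.
    Each basic command and each test costs one tick. *)
Inductive exec : cmd -> store -> store -> Prop :=
  | xAsg x e s : exec (Asg x e) s (setv s x (eval s e))
  | xRd x e s : rmax < eval s e < B ->
      exec (Rd x e) s (setv s x (raw (eval s e)))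
  | xPut a e1 e2 s : exec (Put a e1 e2) s (seta s a (eval s e1) (eval s e2))
  | xSeq c1 c2 s s1 s2 : exec c1 s s1 -> exec c2 s1 s2 -> exec (Seq c1 c2) s s2
  | xIf1 e c1 c2 s s1 : eval s e != 0 -> exec c1 (tick s) s1 ->
      exec (If e c1 c2) s s1
  | xIf0 e c1 c2 s s1 : eval s e = 0 -> exec c2 (tick s) s1 ->
      exec (If e c1 c2) s s1
  | xWhile0 e c s : eval s e = 0 -> exec (While e c) s (tick s)
  | xWhile1 e c s s1 s2 : eval s e != 0 -> exec c (tick s) s1 ->
      exec (While e c) s1 s2 -> exec (While e c) s s2.

(** An execution must exist, so this is total correctness; running times are claims about [clock] in
    the postcondition. *)
Definition wp c (Q : store -> Prop) s := exists2 s', exec c s s' & Q s'.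

Lemma wp_asg x e Q s : Q (setv s x (eval s e)) -> wp (Asg x e) Q s.
Proof. by move=> H; eexists; [apply: xAsg|]. Qed.

Lemma wp_rd x e (Q : store -> Prop) s : rmax < eval s e < B ->
  Q (setv s x (raw (eval s e))) -> wp (Rd x e) Q s.
Proof. by move=> H1 H; eexists; [apply: xRd|]. Qed.

Lemma wp_put a e1 e2 Q s :
  Q (seta s a (eval s e1) (eval s e2)) -> wp (Put a e1 e2) Q s.
Proof. by move=> H; eexists; [apply: xPut|]. Qed.

Lemma wp_seq c1 c2 Q s : wp c1 (wp c2 Q) s -> wp (Seq c1 c2) Q s.
Proof.
by move=> [s1 H1 [s2 H2 HQ]]; exists s2 => //; apply: xSeq H1 H2.
Qed.

Lemma wp_if e c1 c2 Q s :
  (eval s e <> 0 -> wp c1 Q (tick s)) ->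
  (eval s e = 0 -> wp c2 Q (tick s)) ->
  wp (If e c1 c2) Q s.
Proof.
move=> H1 H2; case: (eqVneq (eval s e) 0) => [E|N].
- by have [s' ? ?] := H2 E; exists s' => //; apply: xIf0.
- by have [s' ? ?] := H1 (elimN eqP N); exists s' => //; apply: xIf1.
Qed.

Lemma wp_mono c (Q1 Q2 : store -> Prop) s :
  (forall s, Q1 s -> Q2 s) -> wp c Q1 s -> wp c Q2 s.
Proof. by move=> H [s' ? /H ?]; exists s'. Qed.

Fixpoint modv c x :=
  match c with
  | Asg y _ | Rd y _ => Nat.eqb x y
  | Put _ _ _ => false
  | Seq c1 c2 | If _ c1 c2 => modv c1 x || modv c2 x
  | While _ c1 => modv c1 x
  end.

Fixpoint moda c a :=
  match c with
  | Asg _ _ | Rd _ _ => false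
  | Put b _ _ => Nat.eqb a b
  | Seq c1 c2 | If _ c1 c2 => moda c1 a || moda c2 a
  | While _ c1 => moda c1 a
  end.

Lemma exec_frame c s s' : exec c s s' ->
  [/\ forall x, ~~ modv c x -> vr s' x = vr s x,
      forall a, ~~ moda c a -> ar s' a = ar s a & clock s <= clock s'].
Proof.
elim=> {c s s'}.
- by move=> x e s; split=> //= y /negPf ->.
- by move=> x e s H; split=> //= y /negPf ->.
- by move=> a e1 e2 s; split=> //= y /negPf ->.
- move=> c1 c2 s s1 s2 _ [v1 a1 t1] _ [v2 a2 t2]; split=> /= [x|a|].
  + by rewrite negb_or => /andP[? ?]; rewrite v2 ?v1.
  + by rewrite negb_or => /andP[? ?]; rewrite a2 ?a1.
  + exact: leq_trans t1 t2.
- move=> e c1 c2 s s1 _ _ [v1 a1 t1]; split=> /= [x|a|].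
  + by rewrite negb_or => /andP[? ?]; rewrite v1.
  + by rewrite negb_or => /andP[? ?]; rewrite a1.
  + exact: ltnW.
- move=> e c1 c2 s s1 _ _ [v1 a1 t1]; split=> /= [x|a|].
  + by rewrite negb_or => /andP[? ?]; rewrite v1.
  + by rewrite negb_or => /andP[? ?]; rewrite a1.
  + exact: ltnW.
- by move=> e c s _; split=> /=.
- move=> e c s s1 s2 _ _ [v1 a1 t1] _ [v2 a2 t2]; split=> /= [x H|a H|].
  + by rewrite v2 ?v1.
  + by rewrite a2 ?a1.
  + by move: t1 t2 => /=; lia.
Qed.

Definition same c s s' :=
  (forall x, ~~ modv c x -> vr s' x = vr s x) /\
  (forall a, ~~ moda c a -> ar s' a = ar s a).

Lemma same_trans c c' s s1 s2 : same c s s1 -> same c' s1 s2 ->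
  (forall x, modv c' x -> modv c x) -> (forall a, moda c' a -> moda c a) ->
  same c s s2.
Proof.
move=> [H1 H2] [H3 H4] Hv Ha; split=> x Hx.
  by rewrite H3 ?H1 //; apply: contra Hx; apply: Hv.
by rewrite H4 ?H2 //; apply: contra Hx; apply: Ha.
Qed.

(** Facts about untouched variables and arrays come from the syntax of [c], so invariants need to
    mention only what is written. *)
Lemma wp_frame c (Q : store -> Prop) s :
  wp c (fun s' => same c s s' -> Q s') s -> wp c Q s.
Proof.
by move=> [s' X HQ]; exists s' => //; apply: HQ; have [] := exec_frame X.
Qed.

(** The invariant carries a measure [k] that must drop, and every state reached is known to agree
    with the start on all that the loop does not write. *)
Lemma wp_while (I : nat -> store -> Prop) k e c Q s :
  I k s ->
  (forall k s', same (While e c) s s' -> I k s' -> eval s' e <> 0 ->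
     wp c (fun s'' => exists k', k' < k /\ I k' s'') (tick s')) ->
  (forall k s', same (While e c) s s' -> I k s' -> eval s' e = 0 ->
     Q (tick s')) ->
  wp (While e c) Q s.
Proof.
move=> Is Hb Hq.
suff H k0 k' s' : k' < k0 -> same (While e c) s s' -> I k' s' ->
    wp (While e c) Q s' by apply: (H k.+1 k).
elim: k0 k' s' {k Is} => // k0 IH k s'; rewrite ltnS => le_k S Is.
case: (eqVneq (eval s' e) 0) => [E|N].
  by exists (tick s'); [apply: xWhile0 | apply: Hq Is E].
have [s1 [X1 S1 [k1 [lt1 I1]]]] : exists s1, [/\ exec c (tick s') s1,
    same c (tick s') s1 & exists k', k' < k /\ I k' s1].
  have [s1 X1 I1] := Hb _ _ S Is (elimN eqP N).
  by exists s1; split=> //; have [] := exec_frame X1.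
have [|s2 X2 Q2] := IH _ s1 (leq_trans lt1 le_k) _ I1.
  by apply: same_trans S S1 _ _.
by exists s2 => //; apply: xWhile1 X1 X2.
Qed.

(** Truncated subtraction serves as the test v < b. *)
Definition for_up v b body :=
  Seq (Asg v (Cst 0))
    (While (Sub b (Var v)) (Seq body (Asg v (Add (Var v) (Cst 1))))).

Definition for_down v b body :=
  Seq (Asg v b)
    (While (Var v) (Seq (Asg v (Sub (Var v) (Cst 1))) body)).

Lemma wp_for_up v b body N (I : nat -> store -> Prop) Q s :
  ~~ modv body v ->
  (forall s', same (for_up v b body) s s' -> eval s' b = N) ->
  I 0 (setv s v 0) ->
  (forall i s', i < N -> same (for_up v b body) s s' -> vr s' v = i -> I i s' ->
     wp body (fun s'' => I i.+1 (setv s'' v i.+1)) (tick s')) ->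
  (forall s', same (for_up v b body) s s' -> I N s' -> Q (tick s')) ->
  wp (for_up v b body) Q s.
Proof.
move=> Hv Hb I0 Hs Hq; apply: wp_seq; apply: wp_frame; apply: wp_asg => S0.
pose J k s' := exists i, [/\ k + i = N, vr s' v = i & I i s'].
have Ev x : Nat.eqb x v = (x == v) by lia.
have SS s' : same (While (Sub b (Var v)) (Seq body (Asg v (Add (Var v) (Cst 1)))))
    (setv s v (eval s (Cst 0))) s' -> same (for_up v b body) s s'.
  move=> S; apply: (same_trans (c := for_up v b body)) S _ _ => //.
    by split=> // x /=; rewrite Ev; case: eqP.
  by move=> x /= ->; rewrite orbT.
apply: (wp_while (I := J) (k := N)).
- by exists 0; rewrite addn0 /= Ev eqxx.
- move=> k s' /SS S [i [Ek Vi Ii]] /= E.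
  have Hi : i < N by move: E; rewrite (Hb _ S) Vi; lia.
  apply: wp_seq; apply: wp_frame; apply: wp_mono (Hs _ _ Hi S Vi Ii).
  move=> s'' I2 [F1 _]; apply: wp_asg; exists k.-1; split; first by lia.
  have Vs : vr s'' v = i by rewrite F1.
  exists i.+1; rewrite /= Ev eqxx Vs addn1; split=> //; lia.
- move=> k s' /SS S [i [Ek Vi Ii]] /= E; apply: Hq => //.
  by have <- : i = N by move: E; rewrite (Hb _ S) Vi; lia.
Qed.

Lemma wp_for_down v b body N (I : nat -> store -> Prop) Q s :
  ~~ modv body v -> eval s b = N ->
  I N (setv s v N) ->
  (forall i s', i < N -> same (for_down v b body) s s' -> vr s' v = i.+1 ->
     I i.+1 s' -> wp body (fun s'' => I i s'') (setv (tick s') v i)) ->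
  (forall s', same (for_down v b body) s s' -> I 0 s' -> Q (tick s')) ->
  wp (for_down v b body) Q s.
Proof.
move=> Hv Hb I0 Hs Hq; apply: wp_seq; apply: wp_frame; apply: wp_asg => S0.
pose J i s' := [/\ i <= N, vr s' v = i & I i s'].
have Ev x : Nat.eqb x v = (x == v) by lia.
have SS s' : same (While (Var v) (Seq (Asg v (Sub (Var v) (Cst 1))) body))
    (setv s v (eval s b)) s' -> same (for_down v b body) s s'.
  move=> S; apply: (same_trans (c := for_down v b body)) S _ _ => //.
    by split=> // x /=; rewrite Ev; case: eqP.
  by move=> x /= ->; rewrite orbT.
apply: (wp_while (I := J) (k := N)).
- by rewrite Hb; split; rewrite //= Ev eqxx.
- move=> k s' /SS S [Hk Vi Ii] /= E.
  case: k Hk Vi Ii E => [|i] Hk Vi Ii; rewrite ?Vi // => _.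
  apply: wp_seq; apply: wp_asg; apply: wp_frame.
  rewrite [eval _ _]/= Vi subn1 /=.
  apply: wp_mono (Hs _ _ Hk S Vi Ii) => s'' I2 [F1 _]; exists i.
  split=> //; split=> //; first by lia.
  by rewrite F1 //= Ev eqxx.
- move=> k s' /SS S [Hk Vi Ii] /= E; apply: Hq => //.
  by rewrite -E Vi.
Qed.

End Semantics.

(** * Compilation to the RAM *)

(** Stack discipline: the value ends in register [d], and only registers from [d] on are
    overwritten. With no move and no multiplication available, a variable is added to 0, and the
    factor 16 in an array address is four doublings. *)
Fixpoint cexp e d : seq instr :=
  match e with
  | Var x => [:: IConst d 0; IAdd d d x]
  | Cst c => [:: IConst d c]
  | Add e1 e2 => cexp e1 d ++ cexp e2 d.+1 ++ [:: IAdd d d d.+1]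
  | Sub e1 e2 => cexp e1 d ++ cexp e2 d.+1 ++ [:: ISub d d d.+1]
  | Arr a e => cexp e d ++ nseq 4 (IAdd d d d) ++
      [:: IAdd d d rbase; IConst d.+1 a; IAdd d d d.+1; ILoad d d]
  end.

Definition crd x e : seq instr := cexp e rtmp ++ [:: ILoad x rtmp].

Definition casg x e : seq instr :=
  cexp e rtmp ++ [:: IConst rtmp.+1 0; IAdd x rtmp rtmp.+1].

Definition cput a e1 e2 : seq instr :=
  cexp e1 rtmp ++ nseq 4 (IAdd rtmp rtmp rtmp) ++
  [:: IAdd rtmp rtmp rbase; IConst rtmp.+1 a; IAdd rtmp rtmp rtmp.+1] ++
  cexp e2 rtmp.+1 ++ [:: IStore rtmp rtmp.+1].

Fixpoint csize c :=
  match c with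
  | Asg x e => size (casg x e)
  | Rd x e => size (crd x e)
  | Put a e1 e2 => size (cput a e1 e2)
  | Seq c1 c2 => csize c1 + csize c2
  | If e c1 c2 => size (cexp e rtmp) + 1 + (csize c1 + 2) + csize c2
  | While e c1 => size (cexp e rtmp) + 1 + (csize c1 + 2)
  end.

(** [o] is the absolute address of the code, since [IJz] has absolute targets. An unconditional jump
    tests [rtmp] just after setting it to 0. *)
Fixpoint comp c o : seq instr :=
  match c with
  | Asg x e => casg x e
  | Rd x e => crd x e
  | Put a e1 e2 => cput a e1 e2
  | Seq c1 c2 => comp c1 o ++ comp c2 (o + csize c1)
  | If e c1 c2 =>
      let o1 := o + size (cexp e rtmp) + 1 in
      let o2 := o1 + csize c1 + 2 in
      cexp e rtmp ++ [:: IJz rtmp o2] ++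
      comp c1 o1 ++ [:: IConst rtmp 0; IJz rtmp (o2 + csize c2)] ++ comp c2 o2
  | While e c1 =>
      let o1 := o + size (cexp e rtmp) + 1 in
      cexp e rtmp ++ [:: IJz rtmp (o1 + csize c1 + 2)] ++
      comp c1 o1 ++ [:: IConst rtmp 0; IJz rtmp o]
  end.

Lemma size_comp c o : size (comp c o) = csize c.
Proof.
elim: c o => //= [c1 IH1 c2 IH2|e c1 IH1 c2 IH2|e c1 IH1] o;
  rewrite !size_cat /= ?size_cat /= ?IH1 ?IH2 /= ; lia.
Qed.

Fixpoint ewf e d :=
  match e with
  | Var x => (x < nvars) && (d <= rmax)
  | Cst c => d <= rmax
  | Add e1 e2 | Sub e1 e2 => ewf e1 d && ewf e2 d.+1
  | Arr a e => [&& a < 16, ewf e d & d < rmax]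
  end.

Fixpoint cwf c :=
  match c with
  | Asg x e | Rd x e => (x < nvars) && ewf e rtmp
  | Put a e1 e2 => [&& a < 16, ewf e1 rtmp & ewf e2 rtmp.+1]
  | Seq c1 c2 => cwf c1 && cwf c2
  | If e c1 c2 => [&& ewf e rtmp, cwf c1 & cwf c2]
  | While e c1 => ewf e rtmp && cwf c1
  end.

(* Bounds the number of instructions executed per clock tick; the [+ 3] pays
   for the test and the jump back. *)
Fixpoint weight c :=
  match c with
  | Asg x e => size (casg x e)
  | Rd x e => size (crd x e)
  | Put a e1 e2 => size (cput a e1 e2)
  | Seq c1 c2 => maxn (weight c1) (weight c2)
  | If e c1 c2 => maxn (size (cexp e rtmp) + 3) (maxn (weight c1) (weight c2))
  | While e c1 => maxn (size (cexp e rtmp) + 3) (weight c1)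
  end.

Definition bstep (m : nat -> nat) (i : instr) : nat -> nat :=
  match i with
  | IConst r v => upd m r v
  | IAdd r a b => upd m r (m a + m b)
  | ISub r a b => upd m r (m a - m b)
  | ILoad r a => upd m r (m (m a))
  | IStore a b => upd m (m a) (m b)
  | _ => m
  end.

Definition straight (i : instr) : bool :=
  match i with IJz _ _ | IHalt => false | _ => true end.

Definition code_at (P : program) o cs :=
  forall i, i < size cs -> nth IHalt P (o + i) = nth IHalt cs i.

Lemma code_at_cat P o a b :
  code_at P o (a ++ b) <-> code_at P o a /\ code_at P (o + size a) b.
Proof.
split=> [H|[Ha Hb] i].
  split=> i Hi.
    by rewrite H ?size_cat ?nth_cat ?Hi // ltn_addr.
  rewrite -addnA H ?size_cat ?ltn_add2l // nth_cat.
  by rewrite -ltn_subRL subnn ltn0 addKn.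
rewrite size_cat nth_cat => Hi; case: ltnP => Hia; first exact: Ha.
by rewrite -Hb; [congr nth; lia | lia].
Qed.

Lemma run_add P t1 t2 s : run P (t1 + t2) s = run P t2 (run P t1 s).
Proof. by rewrite /run addnC iterD. Qed.

Lemma run_straight P o cs m : code_at P o cs -> all straight cs ->
  run P (size cs) (State o m) = State (o + size cs) (foldl bstep m cs).
Proof.
elim: cs o m => [|i cs IH] o m Hc; first by rewrite addn0.
move=> /andP[Hi Hcs]; rewrite [size _]/= [foldl _ _ _]/= -[(size cs).+1]add1n run_add.
have -> : run P 1 (State o m) = State o.+1 (bstep m i).
  rewrite /run /= /step /fetch /=.
  by have := Hc 0 isT; rewrite addn0 /= => ->; case: (i) Hi.
rewrite IH // ?addSnnS //.
by move=> j Hj; rewrite addSnnS (Hc j.+1).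
Qed.

Definition frame_from d (m m' : nat -> nat) :=
  forall i, ~~ (d <= i <= rmax) -> m' i = m i.

Section Simulation.
Variables (raw : nat -> nat) (B : nat).

(** Temporaries are unconstrained, so evaluating an expression preserves the relation. The condition
    [a < 16] keeps the interleaved arrays disjoint. *)
Definition rep (m : nat -> nat) s :=
  [/\ rmax < B,
      forall x, x < nvars -> m x = vr s x,
      m rbase = B,
      forall i, rmax < i < B -> m i = raw i &
      forall a i, a < 16 -> m (B + 16 * i + a) = ar s a i].

Lemma rep_frame d m m' s : rtmp <= d -> rep m s -> frame_from d m m' -> rep m' s.
Proof.
move=> Hd [HB Hv Hb Hr Ha] Hf; split=> //.
- by move=> x Hx; rewrite Hf ?Hv //; lia.
- by rewrite Hf ?Hb //; lia.
- by move=> i Hi; rewrite Hf ?Hr //; lia.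
- by move=> a i Hi; rewrite Hf ?Ha //; lia.
Qed.

Lemma rep_tick m s : rep m s -> rep m (tick s).
Proof. by []. Qed.

Lemma frame_trans d d' m1 m2 m3 : d <= d' ->
  frame_from d m1 m2 -> frame_from d' m2 m3 -> frame_from d m1 m3.
Proof. by move=> Hd H1 H2 i Hi; rewrite H2 ?H1 //; lia. Qed.

Lemma straight_cexp e d : all straight (cexp e d).
Proof. by elim: e d => //= *; rewrite !all_cat /= ?andbT //; apply/andP; split. Qed.

Lemma foldl_double k d m i : foldl bstep m (nseq k (IAdd d d d)) i =
  if i == d then 2 ^ k * m d else m i.
Proof.
elim: k m => [|k IH] m /=; first by rewrite mul1n; case: eqP => [->|].
rewrite IH /upd /= eqxx expnS; case: eqP => // _; lia.
Qed.

Lemma ewf_le e d : ewf e d -> d <= rmax.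
Proof.
elim: e d => [x|c|e1 IH1 e2 _|e1 IH1 e2 _|a e IH] d //=.
- by case/andP.
- by case/andP=> /IH1.
- by case/andP=> /IH1.
- by case/and3P=> _ /IH.
Qed.

Lemma cexp_ok e d m s : rtmp <= d -> ewf e d -> rep m s ->
  foldl bstep m (cexp e d) d = eval s e /\
  frame_from d m (foldl bstep m (cexp e d)).
Proof.
elim: e d m => [x|c|e1 IH1 e2 IH2|e1 IH1 e2 IH2|a e IH] d m Hd.
- move=> /andP[Hx Hdm] [_ Hv _ _ _]; split=> /=.
    rewrite /upd /= eqxx Hv //; case: eqP => // E; lia.
  by move=> i Hi; rewrite /upd; case: eqP => // E; lia.
- move=> /= Hdm _; split; rewrite /= /upd ?eqxx // => i Hi.
  by case: eqP => // E; lia.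
- move=> /= /andP[W1 W2] R; rewrite !foldl_cat /=.
  have [V1 F1] := IH1 _ _ Hd W1 R.
  have R1 := rep_frame Hd R F1.
  have [V2 F2] := IH2 d.+1 _ (leqW Hd) W2 R1.
  have F := frame_trans (leqnSn d) F1 F2.
  split; first by rewrite /upd eqxx V2 F2 ?V1 //; lia.
  move=> i Hi; rewrite /upd; case: eqP => [E|_]; last exact: F.
  by have := ewf_le W1; lia.
- move=> /= /andP[W1 W2] R; rewrite !foldl_cat /=.
  have [V1 F1] := IH1 _ _ Hd W1 R.
  have R1 := rep_frame Hd R F1.
  have [V2 F2] := IH2 d.+1 _ (leqW Hd) W2 R1.
  have F := frame_trans (leqnSn d) F1 F2.
  split; first by rewrite /upd eqxx V2 F2 ?V1 //; lia.
  move=> i Hi; rewrite /upd; case: eqP => [E|_]; last exact: F.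
  by have := ewf_le W1; lia.
- move=> /and3P[Ha W Hdm] R; have [V F] := IH _ _ Hd W R.
  have [HB _ Rb _ Ra] := rep_frame Hd R F.
  rewrite [cexp _ _]/= !foldl_cat; set m1 := foldl bstep m _ in V F HB Rb Ra *.
  have N1 : (d == d.+1) = false by lia.
  have N2 : (rbase == d) = false by lia.
  have N3 : (d.+1 == d) = false by lia.
  split=> [|i Hi]; rewrite /= /upd /= ?eqxx ?N1 ?N2 ?N3 ?eqxx.
    have -> : (m1 d + m1 d + (m1 d + m1 d) + (m1 d + m1 d + (m1 d + m1 d)) +
      (m1 d + m1 d + (m1 d + m1 d) + (m1 d + m1 d + (m1 d + m1 d))) +
         m1 20 + a) = B + 16 * eval s e + a by lia.
    by rewrite !ifF ?Ra //; lia.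
  by rewrite !ifF ?F //; lia.
Qed.

(** The time bound is a potential inequality: adding it up along an execution needs no truncated
    subtraction. *)
Definition sim P c s s' o m W :=
  exists t m', [/\ t + W * clock s <= W * clock s',
    run P t (State o m) = State (o + csize c) m' & rep m' s'].

Lemma rep_setv m s x v m' : x < nvars -> rep m s ->
  m' x = v -> (forall i, i != x -> ~~ (rtmp <= i <= rmax) -> m' i = m i) ->
  rep m' (setv s x v).
Proof.
move=> Hx [HB Hv Hb Hr Ha] E F; split=> //=.
- move=> y Hy; have -> : Nat.eqb y x = (y == x) by lia.
  by case: eqVneq => [->//|N]; rewrite F ?Hv //; lia.
- by rewrite F ?Hb //; lia.
- by move=> i Hi; rewrite F ?Hr //; lia.
- by move=> a i Hi; rewrite F ?Ha //; lia.
Qed.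

Lemma sim_straight P c s s' o m W (cs : seq instr) :
  comp c o = cs -> all straight cs -> code_at P o (comp c o) ->
  weight c <= W -> weight c = size cs -> clock s' = (clock s).+1 ->
  rep (foldl bstep m cs) s' -> sim P c s s' o m W.
Proof.
move=> <- St Hc HW Ew Ec R; exists (size (comp c o)), (foldl bstep m (comp c o)).
split=> //; last by rewrite run_straight ?size_comp.
by rewrite Ec mulnS leq_add2r -Ew.
Qed.

(** Induction on the execution, not on the command: the further rounds of a loop are an execution of
    the same command at the same address, for which the hypothesis is available. *)
Lemma comp_ok c s s' : exec raw B c s s' -> forall P o m W,
  weight c <= W -> cwf c -> code_at P o (comp c o) -> rep m s ->
  sim P c s s' o m W.
Proof.
elim=> {c s s'}.
- move=> x e s P o m W HW /andP[Hx We] Hc R.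
  apply: (sim_straight (cs := casg x e)) => //.
    by rewrite all_cat straight_cexp.
  have [V F] := cexp_ok (leqnn _) We R.
  rewrite /casg foldl_cat; apply: (rep_setv Hx R) => [|i Ni Hi].
    by rewrite /= /upd /= !eqxx addn0 V.
  by rewrite /= /upd /= (negPf Ni) ifF ?F //; lia.
- move=> x e s Hin P o m W HW /andP[Hx We] Hc R.
  apply: (sim_straight (cs := crd x e)) => //.
    by rewrite all_cat straight_cexp.
  have [V F] := cexp_ok (leqnn _) We R.
  rewrite /crd foldl_cat; apply: (rep_setv Hx R) => [|i Ni Hi].
    rewrite /= /upd /= !eqxx V F; last by lia.
    by case: R => _ _ _ ->.
  by rewrite /= /upd /= (negPf Ni) F //; lia.
- move=> a e1 e2 s P o m W HW /and3P[Ha W1 W2] Hc R.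
  apply: (sim_straight (cs := cput a e1 e2)) => //.
    by rewrite !all_cat !straight_cexp.
  have [V1 F1] := cexp_ok (leqnn _) W1 R.
  have R1 := rep_frame (leqnn _) R F1.
  rewrite /cput !foldl_cat; set m1 := foldl bstep m _ in V1 F1 R1 *.
  set m2 := foldl bstep (foldl bstep m1 _) _.
  have V2 : m2 rtmp = B + 16 * eval s e1 + a.
    by case: R1 => _ _ Rb _ _; rewrite /m2 /= /upd /= V1 Rb; lia.
  have F2 : frame_from rtmp m m2.
    apply: (frame_trans (leqnn _) F1) => i Hi.
    by rewrite /m2 /= /upd /= !ifF //; lia.
  have R2 := rep_frame (leqnn _) R F2.
  have [V3 F3] := cexp_ok (leqnSn _) W2 R2.
  set m3 := foldl bstep m2 _ in V3 F3 *.
  have F : frame_from rtmp m m3 by apply: frame_trans F2 F3.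
  have [HB Hv Hb Hr Hm] := rep_frame (leqnn _) R F.
  have E : m3 rtmp = B + 16 * eval s e1 + a by rewrite F3.
  rewrite /= /upd /= E V3; split=> //=.
  + by move=> x Hx; rewrite ifF ?Hv //; lia.
  + by rewrite ifF ?Hb //; lia.
  + by move=> i Hi; rewrite ifF ?Hr //; lia.
  + move=> b i Hb2; have -> : Nat.eqb b a = (b == a) by lia.
    case: (eqVneq b a) => [->|N].
      case: (eqVneq i) => [->|N2]; first by rewrite eqxx.
      by rewrite ifF ?Hm //; lia.
    by rewrite ifF ?Hm //; lia.
- move=> c1 c2 s s1 s2 _ IH1 _ IH2 P o m W HW /andP[W1 W2].
  move=> /code_at_cat[]; rewrite size_comp => C1 C2 R.
  move: HW; rewrite /= geq_max => /andP[HW1 HW2].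
  have [t1 [m1 [T1 X1 R1]]] := IH1 _ _ _ _ HW1 W1 C1 R.
  have [t2 [m2 [T2 X2 R2]]] := IH2 _ _ _ _ HW2 W2 C2 R1.
  exists (t1 + t2), m2; split=> //; first by lia.
  by rewrite run_add X1 X2 /= addnA.
- move=> e c1 c2 s s1 Ne _ IH P o m W HW /and3P[We W1 W2].
  move=> /code_at_cat[Ce] /code_at_cat[Cj] /code_at_cat[]; rewrite size_comp.
  move=> C1 /code_at_cat[Ck C2] R.
  move: HW; rewrite /= !geq_max => /and3P[HWe HW1 HW2].
  have [V F] := cexp_ok (leqnn _) We R.
  have R1 := rep_frame (leqnn _) R F.
  have [t1 [m1 [T1 X1 RR1]]] := IH _ _ _ _ HW1 W1 C1 (rep_tick R1).
  exists (size (cexp e rtmp) + (1 + (t1 + 2))), (upd m1 rtmp 0); split.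
  + by move: T1; rewrite /= mulnS; lia.
  + rewrite run_add run_straight ?straight_cexp // run_add.
    set m2 := foldl _ _ _ in V F R1 X1 *.
    have -> : run P 1 (State (o + size (cexp e 21)) m2) =
       State (o + size (cexp e 21) + 1) m2.
      rewrite /run /= /step /fetch /=.
      by have := Cj 0 isT; rewrite addn0 /= => ->; rewrite V (negPf Ne) addn1.
    rewrite run_add X1 /run /= /step /fetch /=.
    have := Ck 0 isT; have := Ck 1 isT; rewrite addn0 addn1 /= => E1 E0.
    rewrite E0 /= E1 /=; congr State; lia.
  + apply: (rep_frame (leqnn _) RR1) => i Hi; rewrite /upd ifF //; lia.
- move=> e c1 c2 s s1 Ez _ IH P o m W HW /and3P[We W1 W2].
  move=> /code_at_cat[Ce] /code_at_cat[Cj] /code_at_cat[]; rewrite size_comp.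
  move=> C1 /code_at_cat[Ck C2] R.
  move: HW; rewrite /= !geq_max => /and3P[HWe HW1 HW2].
  have [V F] := cexp_ok (leqnn _) We R.
  have R1 := rep_frame (leqnn _) R F.
  have [t1 [m1 [T1 X1 RR1]]] := IH _ _ _ _ HW2 W2 C2 (rep_tick R1).
  exists (size (cexp e rtmp) + (1 + t1)), m1; split=> //.
  + by move: T1; rewrite /= mulnS; lia.
  + rewrite run_add run_straight ?straight_cexp // run_add.
    set m2 := foldl _ _ _ in V F R1 X1 *.
    have -> : run P 1 (State (o + size (cexp e 21)) m2) =
       State (o + size (cexp e 21) + 1 + csize c1 + 2) m2.
      rewrite /run /= /step /fetch /=.
      by have := Cj 0 isT; rewrite addn0 /= => ->; rewrite V Ez.
    by rewrite X1; congr State => /=; lia.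
- move=> e c s Ez P o m W HW /andP[We W1].
  move=> /code_at_cat[Ce] /code_at_cat[Cj] _ R.
  move: HW; rewrite /= !geq_max => /andP[HWe HW1].
  have [V F] := cexp_ok (leqnn _) We R.
  have R1 := rep_frame (leqnn _) R F.
  exists (size (cexp e rtmp) + 1); eexists; split; last exact: (rep_tick R1).
    by rewrite /= mulnS; lia.
  rewrite run_add run_straight ?straight_cexp //.
  rewrite /run /= /step /fetch /=.
  have := Cj 0 isT; rewrite addn0 /= => ->; rewrite V Ez /=.
  by congr State; lia.
- move=> e c s s1 s2 Ne _ IH1 _ IH2 P o m W HW /andP[We W1] Call R.
  have Call2 := Call; have Wall : cwf (While e c) by rewrite /= We.
  have HWall := HW.
  move: Call => /code_at_cat[Ce] /code_at_cat[Cj] /code_at_cat[]; rewrite size_comp.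
  move=> C1 Ck.
  move: HW; rewrite /= !geq_max => /andP[HWe HW1].
  have [V F] := cexp_ok (leqnn _) We R.
  have R1 := rep_frame (leqnn _) R F.
  have [t1 [m1 [T1 X1 RR1]]] := IH1 _ _ _ _ HW1 W1 C1 (rep_tick R1).
  have RR2 : rep (upd m1 rtmp 0) s1.
    apply: (rep_frame (leqnn _) RR1) => i Hi; rewrite /upd ifF //; lia.
  have [t2 [m2 [T2 X2 RR3]]] := IH2 _ _ _ _ HWall Wall Call2 RR2.
  exists (size (cexp e rtmp) + (1 + (t1 + (2 + t2)))), m2; split=> //.
  + by move: T1 T2; rewrite /= mulnS; lia.
  + rewrite run_add run_straight ?straight_cexp // run_add.
    set m3 := foldl _ _ _ in V F R1 X1 *.
    have -> : run P 1 (State (o + size (cexp e 21)) m3) =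
       State (o + size (cexp e 21) + 1) m3.
      rewrite /run /= /step /fetch /=.
      by have := Cj 0 isT; rewrite addn0 /= => ->; rewrite V (negPf Ne) addn1.
    rewrite run_add X1 run_add.
    set st := run P 2 _; have -> : st = State o (upd m1 rtmp 0).
      rewrite /st /run /= /step /fetch /=.
      have := Ck 0 isT; have := Ck 1 isT; rewrite addn0 addn1 /= => E1 E0.
      by rewrite E0 /= E1 /=.
    by rewrite X2.
Qed.

End Simulation.

(** * Freeing the registers and starting the compiled code *)

Definition save_regs a k : seq instr :=
  flatten [seq [:: IAdd 1 1 0; IStore 1 i] | i <- iota a k].

(* Initially only the registers 0 and 1 do not hold input words, so the other
   registers can be saved only through addresses computed by doubling. *)
Definition prelude : seq instr :=
  nseq 5 (IAdd 1 1 1) ++ [:: IStore 1 0; IConst 0 1] ++ save_regs 2 30 ++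
  [:: IAdd rbase 1 0; IConst 2 30; ISub 1 1 2; ILoad 2 1].

Lemma save_regs_ok a k X m : 2 <= a -> a + k <= X -> m 0 = 1 -> m 1 = X ->
  let m' := foldl bstep m (save_regs a k) in
  [/\ m' 1 = X + k, forall i, i < k -> m' (X + i.+1) = m (a + i) &
      forall i, i != 1 -> ~~ (X < i <= X + k) -> m' i = m i].
Proof.
elim: k a X m => [|k IH] a X m Ha HX M0 M1 m'.
  by rewrite /m' /= addn0; split.
set m1 := bstep (bstep m (IAdd 1 1 0)) (IStore 1 a).
have E : m' = foldl bstep m1 (save_regs a.+1 k) by [].
have m1E i : m1 i = if i == X.+1 then m a else if i == 1 then X.+1 else m i.
  rewrite /m1 /= /upd /= M1 M0 addn1; case: eqP => // _.
  by rewrite ifF //; lia.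
have A0 : m1 0 = 1 by rewrite m1E /=.
have A1 : m1 1 = X.+1 by rewrite m1E /= ifF //; lia.
have [||H1 H2 H3] := IH a.+1 X.+1 m1 _ _ A0 A1; try lia.
rewrite -E in H1 H2 H3; split.
- by rewrite H1; lia.
- case=> [_|i Hi].
    by rewrite H3 ?m1E ?addn1 ?eqxx ?addn0 //; lia.
  have -> : X + i.+2 = X.+1 + i.+1 by lia.
  by rewrite H2 ?m1E ?ifF ?addSnnS //; lia.
- move=> i Ni Hi; rewrite H3 ?m1E ?ifF //; lia.
Qed.

Section Prelude.
Variables (n : nat) (es : seq ('I_n * 'I_n)).
Hypothesis es_gt0 : 0 < size es.

(** For m > 0 the address 32 m lies beyond registers 0 to 31 and beyond the last input word 2 m + 1.
    So cell 32 m can take n, the next 30 cells take registers 2 to 31, and the arrays begin at 32 m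
    + 31. Register 1 is left with 32 m, there being no division. *)
Lemma prelude_ok :
  let m := size es in
  let m' := foldl bstep (init_mem es) prelude in
  [/\ m' 1 = 32 * m, m' 2 = n, m' rbase = 32 * m + 31,
      forall i, 32 * m + 31 <= i -> m' i = 0 &
      forall p, 2 <= p < 2 * m + 2 ->
        m' (if p <= rmax then 32 * m + p.-1 else p) = init_mem es p].
Proof.
move=> m m'.
rewrite /m' /prelude foldl_cat; set m1 := foldl bstep (init_mem es) _.
have m1E i : m1 i = if i == 1 then 32 * m else init_mem es i.
  by rewrite /m1 foldl_double.
rewrite foldl_cat; set m2 := foldl bstep m1 _.
have m2E i : m2 i = if i == 0 then 1 else if i == 32 * m then n else
   if i == 1 then 32 * m else init_mem es i.
  by rewrite /m2 /= /upd /= m1E /= m1E /= /init_mem /= m1E.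
rewrite foldl_cat.
have A0 : m2 0 = 1 by rewrite m2E.
have A1 : m2 1 = 32 * m by rewrite m2E /= ifF //; rewrite /m; lia.
have [||] := @save_regs_ok 2 30 (32 * m) m2 _ _ A0 A1; try (rewrite /m; lia).
set m3 := foldl bstep m2 _; move=> H1 H2 H3.
have M30 : m3 0 = 1 by rewrite H3 ?m2E.
have M3A : m3 (32 * m) = n.
  by rewrite H3 ?m2E ?eqxx ?ifF //; rewrite /m; lia.
have HA : 32 <= 32 * m by rewrite /m; lia.
set m4 := foldl bstep m3 _; clearbody m3; clear A0 A1; clearbody m2.
have m4E i : m4 i = if i == 2 then n else if i == 1 then 32 * m else
    if i == rbase then 32 * m + 31 else m3 i.
  pose a := bstep m3 (IAdd rbase 1 0).
  have aE j : a j = if j == rbase then 32 * m + 31 else m3 j.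
    by rewrite /a /bstep /upd H1 M30 -addnA.
  pose b := bstep a (IConst 2 30).
  have bE j : b j = if j == 2 then 30 else a j by [].
  pose c := bstep b (ISub 1 1 2).
  have cE j : c j = if j == 1 then 32 * m else b j.
    by rewrite /c /bstep /upd (bE 1) (bE 2) (aE 1) H1 addnK.
  have -> : m4 = bstep c (ILoad 2 1) by [].
  have c1 : c 1 = 32 * m by rewrite cE.
  have cA : c (32 * m) = n by rewrite cE bE aE !ifF ?M3A //; lia.
  by rewrite /bstep /upd c1 cA cE bE aE; case: (i == 2).
split; rewrite ?m4E //.
- move=> i Hi; rewrite m4E !ifF ?H3 ?m2E; try lia.
  rewrite !ifF /init_mem; try lia.
  by rewrite !ifF -/m //; lia.
- move=> p Hp; have Ip : m2 p = init_mem es p by rewrite m2E !ifF //; lia.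
  case: (leqP p rmax) => Hpm; rewrite m4E.
    rewrite !ifF; try lia.
    have -> : 32 * m + p.-1 = 32 * m + (p - 2).+1 by lia.
    by rewrite H2 -?Ip; [congr m2; lia | lia].
  case: (eqVneq p (32 * m)) => [E|N]; first by lia.
  by rewrite !ifF ?H3 -?Ip //; lia.
Qed.

End Prelude.

(** Without edges the doubling in the prelude stays at address 0, so the leading jump skips to the
    final [IConst 0 0]: a connected graph without edges is a single vertex, of diameter 0. *)
Definition assemble c : program :=
  let o := (size prelude).+1 in
  [:: IJz 1 (o + csize c + 1)] ++ prelude ++ comp c o ++
  [:: IHalt; IConst 0 0; IHalt].

(** The initial store is read off the memory after the prelude. The arrays start in untouched zero
    cells, but the variables may still hold input words, so only 1 and 2 are specified. *)
Lemma assemble_ok n (es : seq ('I_n * 'I_n)) c (Q : store -> Prop) :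
  0 < size es -> cwf c ->
  (forall raw s, vr s 1 = 32 * size es -> vr s 2 = n ->
     (forall a i, a < 16 -> ar s a i = 0) -> clock s = 0 ->
     (forall p, 2 <= p < 2 * size es + 2 ->
        raw (if p <= rmax then 32 * size es + p.-1 else p) = init_mem es p) ->
     wp raw (32 * size es + 31) c Q s) ->
  exists t s m, [/\ t <= 2 + size prelude + weight c * clock s,
    run (assemble c) t (init_state es) = State (size prelude + csize c).+1 m,
    halted (assemble c) (State (size prelude + csize c).+1 m),
    m 0 = vr s 0 & Q s].
Proof.
move=> Hm Hc Hw.
have [H1 H2 H3 H4 H5] := prelude_ok Hm.
set m0 := foldl bstep (init_mem es) prelude in H1 H2 H3 H4 H5.
have [s' Xc Qs'] : wp m0 (32 * size es + 31) c Q
    (Store m0 (fun a i => m0 (32 * size es + 31 + 16 * i + a)) 0).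
  by apply: Hw => //= a i Ha; rewrite H4 //; lia.
have Call : code_at (assemble c) 0 (assemble c) by [].
have [C0] := (code_at_cat (assemble c) _ _ _).1 Call.
move=> /code_at_cat[C1] /code_at_cat[C2 C3].
have R0 : rep m0 (32 * size es + 31) m0
    (Store m0 (fun a i => m0 (32 * size es + 31 + 16 * i + a)) 0).
  by split=> //=; lia.
have [t [m [Ht X R]]] := comp_ok Xc (leqnn _) Hc C2 R0.
exists (1 + (size prelude + t)), s', m; split=> //.
- by move: Ht; rewrite /= muln0 addn0; lia.
- rewrite run_add; have -> : run (assemble c) 1 (init_state es) =
     State (0 + size [:: IJz 1 ((size prelude).+1 + csize c + 1)]) (init_mem es).
    have E0 := C0 0 isT.
    rewrite /run [iter _ _ _]/= /step /fetch [pc _]/= E0 /= {1}/init_mem /= ifF //; lia.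
  rewrite run_add run_straight // X; congr State; rewrite /=; lia.
- have E := C3 0 isT; rewrite size_comp addn0 in E.
  by rewrite /halted /fetch [pc _]/= -addSn -[(size prelude).+1]/(0 + 1 + size prelude) E.
- by case: R => _ Hv _ _ _; apply: Hv.
Qed.

Lemma assemble_nil n (es : seq ('I_n * 'I_n)) c : size es = 0 ->
  let s := run (assemble c) 2 (init_state es) in
  halted (assemble c) s /\ regs s 0 = 0.
Proof.
move=> E.
have Call : code_at (assemble c) 0 (assemble c) by [].
have [C0] := (code_at_cat (assemble c) _ _ _).1 Call.
move=> /code_at_cat[C1] /code_at_cat[C2 C3].
have E0 := C0 0 isT; have E1 := C3 1 isT; have E2 := C3 2 isT.
rewrite size_comp in E1 E2.
set o := 0 + _ + _ + _ in E1 E2.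
have -> : run (assemble c) 2 (init_state es) = State (o + 2) (upd (init_mem es) 0 0).
  rewrite /run /=; set s1 := step _ (init_state es).
  have -> : s1 = State (o + 1) (init_mem es).
    rewrite /s1 /step /fetch [pc _]/= E0 /= {1}/init_mem /= E /=.
    by congr State; rewrite /o /=; lia.
  by rewrite /step /fetch [pc _]/= E1 /= addn2 addn1.
by split; rewrite // /halted /fetch [pc _]/= E2.
Qed.

(** * Distances in a connected graph *)

Definition updf (T : Type) (f : nat -> T) i v : nat -> T :=
  fun j => if j == i then v else f j.

Lemma updf_eq T (f : nat -> T) i v : updf f i v i = v.
Proof. by rewrite /updf eqxx. Qed.

Lemma updf_ne T (f : nat -> T) i v j : j != i -> updf f i v j = f j.
Proof. by move=> /negPf N; rewrite /updf N. Qed.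

Record graph_on (n : nat) (e : rel nat) : Prop := GraphOn {
  edge_bound : forall x y, e x y -> x < n /\ y < n;
  edge_sym : symmetric e }.

(** Distances are specified by walks alone, as attained lower bounds on their lengths; attainment
    for all pairs encodes connectedness. *)
Record metric (n : nat) (e : rel nat) (d : nat -> nat -> nat) : Prop := Metric {
  metric_graph : graph_on n e;
  metric_le : forall x p, x < n -> path e x p -> d x (last x p) <= size p;
  metric_path : forall x y, x < n -> y < n ->
    exists p, [/\ path e x p, last x p = y & size p = d x y] }.

Section Metric.
Variables (n : nat) (e : rel nat) (d : nat -> nat -> nat).
Hypothesis Md : metric n e d.
Let Ge := metric_graph Md.

Lemma path_bound x p : x < n -> path e x p -> last x p < n.
Proof.
elim: p x => //= y p IH x _ /andP[/(edge_bound Ge)[_ Hy]]; exact: IH.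
Qed.

Lemma path_rev x p : path e x p ->
  exists p', [/\ path e (last x p) p', last (last x p) p' = x & size p' = size p].
Proof.
move=> Hp; exists (rev (belast x p)); split.
- by rewrite rev_path (eq_path (e' := e)) // => u v; rewrite (edge_sym Ge).
- by case: p {Hp} => //= y p; rewrite rev_cons last_rcons.
- by rewrite size_rev size_belast.
Qed.

Lemma dist0 x : x < n -> d x x = 0.
Proof. by move=> Hx; apply/eqP; rewrite -leqn0; apply: (metric_le Md (p := [::])). Qed.

Lemma dist_tri x y z : x < n -> y < n -> z < n -> d x z <= d x y + d y z.
Proof.
move=> Hx Hy Hz; have [p [P1 L1 <-]] := metric_path Md Hx Hy.
have [q [P2 L2 <-]] := metric_path Md Hy Hz.
rewrite -size_cat -L2 -L1 -last_cat; apply: (metric_le Md) => //.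
by rewrite cat_path P1 L1.
Qed.

Lemma dist_sym x y : x < n -> y < n -> d x y = d y x.
Proof.
have H u v : u < n -> v < n -> d u v <= d v u.
  move=> Hu Hv; have [p [P1 L1 <-]] := metric_path Md Hv Hu.
  have [p' [P2 L2 <-]] := path_rev P1.
  by rewrite L1 in P2 L2; rewrite -L2; apply: (metric_le Md).
by move=> Hx Hy; apply/eqP; rewrite eqn_leq !H.
Qed.

Lemma dist_edge x u v : x < n -> e u v -> d x v <= (d x u).+1.
Proof.
move=> Hx E; have [Hu Hv] := edge_bound Ge E.
have := dist_tri Hx Hu Hv; have : d u v <= 1.
  by apply: (metric_le Md (p := [:: v])); rewrite //= E.
lia.
Qed.

Lemma dist_gt0 x y : x < n -> y < n -> (0 < d x y) = (x != y).
Proof.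
move=> Hx Hy; case: eqVneq => [->|N]; first by rewrite dist0.
have [p [P1 L1 E]] := metric_path Md Hx Hy.
by rewrite lt0n -E; case: p P1 L1 {E} => //= _ L; rewrite L eqxx in N.
Qed.

(** A walk with distinct vertices has at most n of them. The strict bound later keeps the bucket
    indices within 0 .. 2 n. *)
Lemma dist_ltn x y : x < n -> y < n -> d x y < n.
Proof.
move=> Hx Hy; have [p [P1 L1 _]] := metric_path Md Hx Hy.
case/shortenP: P1 L1 => p' P2 U _ L.
rewrite -L; apply: leq_ltn_trans (metric_le Md Hx P2) _.
rewrite -[n](size_iota 0) -[(size p').+1]/(size (x :: p')).
apply: uniq_leq_size => // z; rewrite inE mem_iota add0n /= => /orP[/eqP->//|].
elim: p' x {Hx U L} P2 => //= a p' IH x /andP[/(edge_bound Ge)[_ Ha] /IH {}IH].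
by rewrite inE => /orP[/eqP->|/IH].
Qed.

Lemma dist_pred x y : x < n -> y < n -> x != y ->
  exists2 z, e z y & d x y = (d x z).+1.
Proof.
move=> Hx Hy N; have [p [P1 L1 E]] := metric_path Md Hx Hy.
case/lastP: p P1 L1 E => [|p z] /=; first by move=> _ L; rewrite L eqxx in N.
rewrite rcons_path last_rcons size_rcons => /andP[P1 E1] Ez Es.
rewrite {z}Ez in E1 Es; exists (last x p) => //.
apply/eqP; rewrite eqn_leq dist_edge // -Es ltnS.
exact: (metric_le Md).
Qed.

Lemma dist_charact x f : x < n -> f x = 0 ->
  (forall u v, e u v -> f v <= (f u).+1) ->
  (forall v, v < n -> v != x -> exists2 u, e u v & f v = (f u).+1) ->
  forall v, v < n -> f v = d x v.
Proof.
move=> Hx F0 F1 F2.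
have le_fd k v : v < n -> d x v = k -> f v <= k.
  elim: k v => [|k IH] v Hv E.
    have := dist_gt0 Hx Hv; rewrite E; case: eqVneq => // <- _; rewrite F0 //.
  have [|z Ez Eq] := dist_pred Hx Hv; first by rewrite -dist_gt0 // E.
  have [Hz _] := edge_bound Ge Ez.
  apply: leq_trans (F1 _ _ Ez) _; rewrite ltnS; apply: IH => //; lia.
have le_df k v : v < n -> f v = k -> d x v <= k.
  elim: k v => [|k IH] v Hv E; case: (eqVneq v x) => [->|N]; rewrite ?dist0 //.
    by have [u _] := F2 _ Hv N; rewrite E.
  have [u Eu] := F2 _ Hv N; rewrite E => -[] Eq.
  have [Hu _] := edge_bound Ge Eu.
  by apply: leq_trans (dist_edge Hx Eu) _; rewrite ltnS IH.
by move=> v Hv; apply/eqP; rewrite eqn_leq (le_fd _ _ Hv erefl) (le_df _ _ Hv erefl).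
Qed.

End Metric.

Lemma metric_exists n e : graph_on n e ->
  (forall x y, x < n -> y < n -> exists2 p, path e x p & last x p = y) ->
  exists d, metric n e d.
Proof.
move=> Ge Hc.
pose reach := fix reach k x y := if k is k'.+1 then
  has (fun z => e x z && reach k' z y) (iota 0 n) else x == y.
have reachP k x y : reflect (exists p, [/\ path e x p, last x p = y & size p = k])
    (reach k x y).
  elim: k x y => [|k IH] x y /=.
    apply: (iffP eqP) => [->|[[|z p] [_ /= L E]]] //; first by exists [::].
  apply: (iffP hasP) => [[z _ /andP[Ez /IH[p [P1 L1 E1]]]]|[[|z p] [P1 L1 E1]]] //.
    by exists (z :: p); rewrite /= Ez E1.
  move: P1 => /= /andP[Ez P1]; exists z.
    by rewrite mem_iota; have [] := edge_bound Ge Ez.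
  by rewrite Ez; apply/IH; exists p; case: E1.
(* Vacuous outside the vertex range, so that [ex_minn] can be applied to all x and y. *)
pose R x y k := (x < n) && (y < n) ==> reach k x y.
have HR x y : exists k, R x y k.
  rewrite /R; case: ltnP => Hx /=; last by exists 0.
  case: ltnP => Hy /=; last by exists 0.
  have [p P1 L1] := Hc _ _ Hx Hy; exists (size p); apply/reachP; by exists p.
exists (fun x y => ex_minn (HR x y)); split=> // [x p Hx Hp|x y Hx Hy].
- case: ex_minnP => k _; apply; apply/implyP=> _; apply/reachP.
  by exists p.
- by case: ex_minnP => k; rewrite /R Hx Hy => /reachP.
Qed.

(** * Breadth-first search *)

(** [D] is only a level here; its identification with the distance plus one is left to the end. That
    levels increase along the queue and that its pending part spans at most two of them bounds the
    level of an already visited neighbour of the head. *)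
Record bfs_inv n (e : rel nat) src h tl (D P q : nat -> nat) : Prop := BfsInv {
  bfs_ht : h <= tl;
  bfs_tl : 0 < tl;
  bfs_uniq : uniq (map q (iota 0 tl));
  bfs_bound : forall i, i < tl -> q i < n;
  bfs_seen : forall v, v < n -> (D v != 0) = (v \in map q (iota 0 tl));
  bfs_src : [/\ D src = 1, q 0 = src & P src = src];
  bfs_par : forall v, v < n -> D v != 0 -> v != src ->
     [/\ e (P v) v, D v = (D (P v)).+1 & D (P v) != 0];
  bfs_mono : forall i j, i <= j < tl -> D (q i) <= D (q j);
  bfs_front : forall i j, h <= i < tl -> j < tl -> D (q j) <= (D (q i)).+1;
  bfs_closed : forall i y, i < h -> e (q i) y -> D y != 0 /\ D y <= (D (q i)).+1 }.

Section Bfs.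
Variables (n : nat) (e : rel nat) (d : nat -> nat -> nat) (src : nat).
Hypothesis (Md : metric n e d) (Hs : src < n).
Let Ge := metric_graph Md.

Lemma bfs_init D P q : (forall v, v < n -> D v = 0) ->
  bfs_inv n e src 0 1 (updf D src 1) (updf P src src) (updf q 0 src).
Proof.
move=> D0; rewrite /updf; split=> //=.
- by case.
- by move=> v Hv; rewrite inE; case: (v =P src) => // _; rewrite D0.
- by rewrite eqxx.
- by move=> v Hv; case: (v =P src) => // _; rewrite D0.
- by move=> i j Hij; have [-> ->] : i = 0 /\ j = 0 by lia.
- by move=> i j Hi Hj; have [-> ->] : i = 0 /\ j = 0 by lia.
Qed.

Lemma bfs_visit h tl D P q y : bfs_inv n e src h tl D P q -> h < tl ->
  D y = 0 -> e (q h) y ->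
  bfs_inv n e src h tl.+1 (updf D y (D (q h)).+1) (updf P y (q h)) (updf q tl y).
Proof.
move=> I Hh Dy Ey; have [_ Hy] := edge_bound Ge Ey.
have [ht tl0 U Hb S [Ds q0 Ps] Hp Hm Hf Hc] := I.
have qE i : i < tl -> updf q tl y i = q i by move=> Hi; rewrite /updf ifF //; lia.
have qy i : i < tl -> (q i == y) = false.
  move=> Hi; apply/negbTE/eqP => E.
  by have := S _ Hy; rewrite Dy eqxx => /esym/negP; apply; rewrite -E map_f // mem_iota.
have DE i : i < tl -> updf D y (D (q h)).+1 (q i) = D (q i).
  by move=> Hi; rewrite /updf qy.
have mapE : map (updf q tl y) (iota 0 tl.+1) = rcons (map q (iota 0 tl)) y.
  rewrite -addn1 iotaD map_cat add0n /= cats1; congr rcons; last by rewrite /updf eqxx.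
  by apply/eq_in_map=> i; rewrite mem_iota => Hi; rewrite qE.
have qtl : updf q tl y tl = y by rewrite /updf eqxx.
have Dyy : updf D y (D (q h)).+1 y = (D (q h)).+1 by rewrite /updf eqxx.
have ys : (src == y) = false by apply/negbTE/eqP=> E; rewrite -E Ds in Dy.
split=> //.
- exact: leqW.
- by rewrite mapE rcons_uniq U andbT -S // Dy.
- move=> i; rewrite ltnS leq_eqVlt => /orP[/eqP->|Hi]; first by rewrite qtl.
  by rewrite qE ?Hb.
- by move=> v Hv; rewrite mapE mem_rcons inE -S // /updf; case: (v =P y).
- by rewrite qE // q0 /updf ys.
- move=> v Hv; rewrite /updf; case: (eqVneq v y) => [->|N] Dv Nv.
    rewrite qy //; split=> //.
    by rewrite S ?Hb // map_f // mem_iota.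
  have [E1 E2 E3] := Hp _ Hv Dv Nv; case: eqP => [E|//].
  by rewrite E Dy in E3.
- move=> i j /andP[Hij]; rewrite ltnS leq_eqVlt => /orP[/eqP Ej|Hj].
    rewrite Ej qtl Dyy; move: Hij; rewrite Ej leq_eqVlt => /orP[/eqP->|Hi].
      by rewrite qtl Dyy.
    by rewrite qE // DE // Hf // Hh andbT.
  by rewrite !qE ?DE ?Hm //; lia.
- move=> i j /andP[Hij]; rewrite ltnS leq_eqVlt => /orP[/eqP Ei|Hi].
    rewrite Ei qtl Dyy ltnS leq_eqVlt => /orP[/eqP->|Hj].
      by rewrite qtl Dyy.
    by rewrite qE // DE // leqW // Hf // leqnn Hh.
  rewrite (qE i) // DE // ltnS leq_eqVlt => /orP[/eqP->|Hj].
    by rewrite qtl Dyy ltnS Hm // Hij.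
  by rewrite qE // DE // Hf // Hij.
- move=> i z Hi; rewrite qE; last by lia.
  move=> Ez; rewrite DE; last by lia.
  have [H1 H2] := Hc _ _ Hi Ez; rewrite /updf; case: (z =P y) => // E.
  by rewrite E Dy in H1.
Qed.

Lemma bfs_next h tl D P q : bfs_inv n e src h tl D P q -> h < tl ->
  (forall y, e (q h) y -> D y != 0 /\ D y <= (D (q h)).+1) ->
  bfs_inv n e src h.+1 tl D P q.
Proof.
move=> [? ? ? ? ? ? ? ? Hf Hc] Hh Hn; split=> //.
- by move=> i j Hi Hj; apply: Hf => //; lia.
- move=> i y; rewrite ltnS leq_eqVlt => /orP[/eqP->|Hi]; [exact: Hn|exact: Hc].
Qed.

Lemma bfs_size h tl D P q : bfs_inv n e src h tl D P q -> tl <= n.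
Proof.
move=> I; rewrite -[n](size_iota 0) -(size_iota 0 tl) -(size_map q).
apply: uniq_leq_size; first exact: bfs_uniq I.
by move=> v /mapP[i]; rewrite !mem_iota => Hi ->; rewrite (bfs_bound I); lia.
Qed.

(** With an empty queue the visited set is closed under edges, hence everything by connectedness,
    and [D] minus one satisfies [dist_charact]. *)
Lemma bfs_done tl D P q : bfs_inv n e src tl tl D P q ->
  [/\ tl = n, forall v, v < n -> D v = (d src v).+1,
      perm_eq (map q (iota 0 n)) (iota 0 n) /\ q 0 = src,
      P src = src /\
      (forall v, v < n -> v != src -> e (P v) v /\ d src v = (d src (P v)).+1) &
      forall i j, i <= j < n -> d src (q i) <= d src (q j)].
Proof.
move=> I; have [_ tl0 U Hb S [Ds q0 Ps] Hp Hm _ Hc] := I.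
have Dn x p : D x != 0 -> x < n -> path e x p -> D (last x p) != 0.
  elim: p x => //= y p IH x Dx Hx /andP[E]; have [_ Hy] := edge_bound Ge E.
  apply: IH => //; have := S _ Hx; rewrite Dx => /esym/mapP[i].
  by rewrite mem_iota => Hi Ex; rewrite Ex in E; case: (Hc _ _ Hi E).
have Dall v : v < n -> D v != 0.
  move=> Hv; have [p [P1 <- _]] := metric_path Md Hs Hv.
  by apply: Dn => //; rewrite Ds.
have Perm : perm_eq (map q (iota 0 tl)) (iota 0 n).
  apply: uniq_perm (iota_uniq _ _) _ => // v; rewrite mem_iota add0n /=.
  apply/idP/idP=> [/mapP[i]|Hv]; last by rewrite -S ?Dall.
  by rewrite mem_iota => Hi ->; apply: Hb.
have Et : tl = n by have := perm_size Perm; rewrite size_map !size_iota.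
have DE v : v < n -> D v = (d src v).+1.
  move=> Hv; rewrite -(dist_charact Md (f := fun v => (D v).-1) Hs) //.
  - by have := Dall _ Hv; case: (D v).
  - by rewrite Ds.
  - move=> u w E; have [Hu Hw] := edge_bound Ge E.
    have := S _ Hu; rewrite Dall // => /esym/mapP[i].
    rewrite mem_iota => Hi Ei; rewrite Ei in E.
    have [_] := Hc _ _ Hi E; rewrite -Ei; have := Dall _ Hw; have := Dall _ Hu.
    lia.
  - move=> w Hw N; have [H1 H2 H3] := Hp _ Hw (Dall _ Hw) N.
    exists (P w) => //; lia.
have Pb v : v < n -> v != src -> P v < n.
  by move=> Hv N; have [/(edge_bound Ge)[]] := Hp _ Hv (Dall _ Hv) N.
split=> //.
- by split=> //; move: Perm; rewrite Et.
- split=> // v Hv N; have [H1 H2 H3] := Hp _ Hv (Dall _ Hv) N.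
  by split=> //; move: H2; rewrite !DE ?Pb //; lia.
- move=> i j Hij; have Hi : q i < n by rewrite Hb // Et; lia.
  have Hj : q j < n by rewrite Hb // Et; lia.
  by have := Hm i j; rewrite Et !DE //; apply.
Qed.

End Bfs.

(** * Reading the graph *)

(** A linked list stored in arrays; 0 is the null pointer, so half-edges are numbered from 1. *)
Fixpoint chain (nx : nat -> nat) f l :=
  if l is a :: l' then [/\ f = a, a != 0 & chain nx (nx a) l'] else f = 0.

(** [b] bounds the half-edge numbers in use, so that [b.+1] is fresh, and the summed list lengths,
    which pay for all scans of a search. *)
Definition adj_lists n b (e : rel nat) (hd nx dst : nat -> nat) :=
  exists adj : nat -> seq nat,
  [/\ forall x, x < n -> chain nx (hd x) (adj x),
      forall x f, f \in adj x -> f <= b,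
      forall x y, x < n -> e x y <-> (exists2 f, f \in adj x & dst f = y) &
      \sum_(x < n) size (adj x) <= b].

Lemma chain_updf nx b v f l : (forall a, a \in l -> a <= b) ->
  chain nx f l -> chain (updf nx b.+1 v) f l.
Proof.
elim: l f => //= a l IH f Hl [E N C]; split=> //.
rewrite updf_ne; first by apply: IH C => c Hc; apply: Hl; rewrite inE Hc orbT.
by have := Hl a (mem_head _ _); lia.
Qed.

Lemma adj_lists_insert n b e hd nx dst x y : x < n ->
  adj_lists n b e hd nx dst ->
  adj_lists n b.+1 (fun u v => e u v || (u == x) && (v == y))
    (updf hd x b.+1) (updf nx b.+1 (hd x)) (updf dst b.+1 y).
Proof.
move=> Hx [adj [C L E S]]; exists (updf adj x (b.+1 :: adj x)); split.
- move=> u Hu; case: (eqVneq u x) => [->|N]; rewrite ?updf_eq ?updf_ne //=.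
    split=> //; rewrite updf_eq; apply: chain_updf (C _ Hx); exact: L.
  apply: chain_updf (C _ Hu); exact: L.
- move=> u f; rewrite /updf; case: eqP => [_|_]; last by move/L; lia.
  by rewrite inE => /orP[/eqP->|/L]; lia.
- have dE u f v : f \in adj u -> updf dst b.+1 v f = dst f.
    by move=> /L Hf; rewrite updf_ne //; lia.
  move=> u v Hu; rewrite {1}/updf; split.
  + case/orP=> [/E-/(_ Hu)[f Hf Ef]|/andP[/eqP-> /eqP->]]; last first.
      by exists b.+1; rewrite ?eqxx ?inE ?eqxx // /updf eqxx.
    exists f; last by rewrite (dE u).
    by case: eqP Hf => [->|//]; rewrite inE => ->; rewrite orbT.
  + case: (eqVneq u x) => [->|N] [f].
      rewrite inE => /orP[/eqP->|Hf].
        by rewrite /updf eqxx => ->; rewrite !eqxx orbT.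
      by rewrite (dE x) // => Ef; apply/orP; left; apply/E => //; exists f.
    by move=> Hf; rewrite (dE u) // => Ef; apply/orP; left; apply/E => //; exists f.
- rewrite (bigD1 (Ordinal Hx)) //= /updf eqxx /= addSn ltnS.
  apply: leq_trans S; rewrite [X in _ <= X](bigD1 (Ordinal Hx)) //= leq_add2l.
  apply: leq_sum => i Ni; rewrite ifF //; apply/negbTE.
  by apply: contra Ni => /eqP E1; apply/eqP/val_inj.
Qed.

Definition erel (el : seq (nat * nat)) : rel nat :=
  fun x y => ((x, y) \in el) || ((y, x) \in el).


Notation vCNT := 1 (only parsing).
Notation vN := 2 (only parsing).
Notation vM := 3 (only parsing).
Notation vSRC := 4 (only parsing).
Notation vHEAD := 5 (only parsing).
Notation vTAIL := 6 (only parsing).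
Notation vX := 7 (only parsing).
Notation vF := 8 (only parsing).
Notation vY := 9 (only parsing).
Notation vI := 10 (only parsing).
Notation vA := 11 (only parsing).
Notation vS := 12 (only parsing).
Notation vK := 13 (only parsing).
Notation aHD := 0 (only parsing).
Notation aNX := 1 (only parsing).
Notation aDST := 2 (only parsing).
Notation aD1 := 3 (only parsing).
Notation aD2 := 4 (only parsing).
Notation aPAR := 5 (only parsing).
Notation aQ := 6 (only parsing).
Notation aRP := 7 (only parsing).
Notation aRQ := 8 (only parsing).
Notation aMK := 9 (only parsing).
Notation aLB := 10 (only parsing).
Notation aCT := 11 (only parsing).
Notation aANC := 12 (only parsing).
Notation aH := 13 (only parsing).
Notation aBK := 14 (only parsing).

Coercion Var : nat >-> exp.
Declare Scope cmd_scope.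
Delimit Scope cmd_scope with cmd.
Bind Scope cmd_scope with cmd.
Notation "c1 ;; c2" := (Seq c1 c2) (at level 80, right associativity) : cmd_scope.
Notation "x ::= e" := (Asg x e) (at level 70, e at next level) : cmd_scope.
Notation "a @[ i ] ::= e" := (Put a i e)
  (at level 70, i at level 69, e at next level) : cmd_scope.
Notation "a ![ i ]" := (Arr a i) (at level 60, i at level 69).
Notation "e1 .+ e2" := (Add e1 e2) (at level 62, left associativity).
Notation "e1 .- e2" := (Sub e1 e2) (at level 62, left associativity).
Notation "# c" := (Cst c) (at level 8, format "# c").
Open Scope cmd_scope.

Notation skip := (Asg 19 (Cst 0)).
Definition eneq (e1 e2 : exp) := (e1 .- e2) .+ (e2 .- e1).

(** A word at an address p <= 31 was moved by the prelude to 32 m + p - 1, and [vA] holds 32 m. *)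
Definition read_word z :=
  If (#32 .- vI) (Rd z (vA .+ vI .- #1)) (Rd z vI).

Definition add_half (x y : nat) :=
  aDST @[vF] ::= y;; aNX @[vF] ::= aHD![x];; aHD @[x] ::= vF.

(** [vCNT] comes in as 32 m and is counted down by 32 per edge. *)
Definition build_adj :=
  vA ::= vCNT;; vM ::= #0;;
  While vCNT (
    vI ::= vM .+ vM .+ #2;; read_word vX;;
    vI ::= vI .+ #1;; read_word vY;;
    vF ::= vI .- #2;; add_half vX vY;;
    vF ::= vF .+ #1;; add_half vY vX;;
    vM ::= vM .+ #1;; vCNT ::= vCNT .- #32).

(* Evaluating the right-hand side at every step keeps the symbolic store of
   linear size. *)
Ltac weval := repeat match goal with
  | |- context [eval ?s ?e] => let v := eval simpl in (eval s e) in
      change (eval s e) with v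
  end.

Ltac wgo := repeat match goal with
  | |- wp _ _ (Seq _ _) _ _ => apply: wp_seq
  | |- wp _ _ (Asg _ _) _ _ => apply: wp_asg; weval
  | |- wp _ _ (Put _ _ _) _ _ => apply: wp_put; weval
  end.

Definition nat_edges n (es : seq ('I_n * 'I_n)) : seq (nat * nat) :=
  [seq (val p.1, val p.2) | p <- es].

Section Input.
Variables (n : nat) (es : seq ('I_n * 'I_n)) (raw : nat -> nat).
Let m := size es.
Let B := 32 * m + 31.
Let el := nat_edges es.
Hypothesis Hm : 0 < m.
Hypothesis Hraw : forall p, 2 <= p < 2 * m + 2 ->
  raw (if p <= rmax then 32 * m + p.-1 else p) = init_mem es p.

Lemma read_word_ok z p Q s : vr s vA = 32 * m -> vr s vI = p ->
  2 <= p < 2 * m + 2 ->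
  Q (setv (tick s) z (init_mem es p)) -> wp raw B (read_word z) Q s.
Proof.
move=> HA HI Hp HQ; have Hr := Hraw Hp.
apply: wp_if; rewrite /= HI => E.
  apply: wp_rd; rewrite /= HA HI; first by rewrite /B; lia.
  by move: Hr; rewrite ifT -?addnBA; [rewrite subn1 => -> | lia | lia].
apply: wp_rd; rewrite /= HI; first by rewrite /B; lia.
by move: Hr; rewrite ifF; [move=> -> | lia].
Qed.

Lemma init_mem_edge i : i < m ->
  init_mem es (2 * i + 2) = (nth (0, 0) el i).1 /\
  init_mem es (2 * i + 3) = (nth (0, 0) el i).2.
Proof.
move=> Hi; have E j : 2 <= j < 2 * m + 2 -> init_mem es j =
    if odd (j - 2) then (nth (0, 0) el (j - 2)./2).2 else (nth (0, 0) el (j - 2)./2).1.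
  move=> Hj; have [F0 F1] : (j == 0) = false /\ (j == 1) = false by lia.
  have F2 : (2 <= j) && (j - 2 < 2 * size es) by rewrite -/m; lia.
  by rewrite /init_mem F0 F1 F2.
rewrite !E; try lia.
have -> : 2 * i + 2 - 2 = i.*2 by lia.
have -> : 2 * i + 3 - 2 = i.*2.+1 by lia.
by rewrite /= odd_double /= doubleK uphalf_double.
Qed.

(** Half-edges 2 i + 1 and 2 i + 2 are the two directions of the i-th edge, so [aDST] doubles as the
    edge list that [mark_ends] reads. *)
Lemma build_adj_ok s : vr s vCNT = 32 * m -> (forall a i, a < 16 -> ar s a i = 0) ->
  wp raw B build_adj (fun s' => [/\ vr s' vM = m,
    adj_lists n (2 * m) (erel el) (ar s' aHD) (ar s' aNX) (ar s' aDST),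
    forall i, i < m -> ar s' aDST (2 * i + 1) = (nth (0, 0) el i).2 /\
                       ar s' aDST (2 * i + 2) = (nth (0, 0) el i).1 &
    clock s' <= clock s + 3 + 22 * m]) s.
Proof.
move=> Hc H0; rewrite /build_adj /add_half; wgo; rewrite /= Hc.
have size_el : size el = m by rewrite size_map.
have el_bound i : i < m -> (nth (0, 0) el i).1 < n /\ (nth (0, 0) el i).2 < n.
  move=> Hi; have : nth (0, 0) el i \in el by rewrite mem_nth ?size_el.
  by case/mapP=> p _ ->; split; apply: ltn_ord.
pose J k s' := exists i, [/\ k + i = m, [/\ vr s' vM = i, vr s' vCNT = 32 * k & vr s' vA = 32 * m],
    adj_lists n (2 * i) (erel (take i el)) (ar s' aHD) (ar s' aNX) (ar s' aDST),
    forall j, j < i -> ar s' aDST (2 * j + 1) = (nth (0, 0) el j).2 /\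
                       ar s' aDST (2 * j + 2) = (nth (0, 0) el j).1 &
    clock s' <= clock s + 2 + 22 * i].
apply: (wp_while (I := J) (k := m)).
- exists 0; rewrite addn0; split=> //=; last by lia.
  exists (fun=> [::]); split=> //=.
  + by move=> x Hx; rewrite H0.
  + by move=> x y Hx; rewrite take0; split=> [|[f]].
  + by rewrite sum_nat_const muln0.
- move=> k s' [Fv Fa] [i [Ek [VM VC VA] L D T]] /= /eqP E.
  have Hi : i < m by move: E; rewrite VC; lia.
  have [W1 W2] := init_mem_edge Hi.
  have [B1 B2] := el_bound _ Hi.
  wgo; apply: (read_word_ok (p := 2 * i + 2)) => //=; try (rewrite ?VM; lia).
  wgo; apply: (read_word_ok (p := 2 * i + 3)) => //=; try (rewrite ?VM; lia).
  wgo; exists k.-1; split; first by lia.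
  exists i.+1; rewrite /= VM VC W1 W2; split.
  + by lia.
  + by split=> //; lia.
  + have -> : i + i + 2 + 1 - 2 = (2 * i).+1 by lia.
    have L1 := adj_lists_insert (nth (0, 0) el i).2 B1 L.
    have := adj_lists_insert (nth (0, 0) el i).1 B2 L1.
    rewrite addn1; have -> : (2 * i).+2 = 2 * i.+1 by lia.
    case=> adj [A1 A2 A3 A4]; exists adj; split=> // x y Hx.
    rewrite -A3 // /erel (take_nth (0, 0)) ?size_el // !mem_rcons !inE.
    case: (nth (0, 0) el i) => u v /=; rewrite !xpair_eqE.
    by do !case: (_ \in _) => //; do !case: (_ == _).
  + move=> j; rewrite ltnS leq_eqVlt => /orP[/eqP->|Hj].
      by split; [rewrite ifF ?ifT //; lia | rewrite ifT //; lia].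
    by have [<- <-] := D _ Hj; rewrite !ifF //; lia.
  + by lia.
- move=> k s' [Fv Fa] [i [Ek [VM VC VA] L D T]] /= E.
  have Ei : i = m by move: E; rewrite VC; lia.
  rewrite Ei take_oversize ?size_el // in L; rewrite Ei in VM D T.
  by split=> //=; lia.
Qed.

End Input.

(** * The search as a command *)

Definition bfs_visit_cmd :=
  aD1 @[vY] ::= aD1![vX] .+ #1;; aPAR @[vY] ::= vX;;
  aQ @[vTAIL] ::= vY;; vTAIL ::= vTAIL .+ #1.

Definition bfs_scan :=
  While vF (
    vY ::= aDST![vF];;
    If (aD1![vY]) skip bfs_visit_cmd;;
    vF ::= aNX![vF]).

(* The distances of the previous search are kept in [aD2]; distances are
   stored increased by one, 0 meaning unvisited. *)
Definition bfs :=
  for_up vI vN (aD2 @[vI] ::= aD1![vI];; aD1 @[vI] ::= #0);;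
  aD1 @[vSRC] ::= #1;; aPAR @[vSRC] ::= vSRC;; aQ @[#0] ::= vSRC;;
  vHEAD ::= #0;; vTAIL ::= #1;;
  While (vTAIL .- vHEAD) (
    vX ::= aQ![vHEAD];; vF ::= aHD![vX];;
    bfs_scan;;
    vHEAD ::= vHEAD .+ #1).

Lemma chain0 nx f l : chain nx f l -> f = 0 -> l = [::].
Proof. by case: l => //= a l [-> /eqP]. Qed.

Lemma chain_cons nx f l : chain nx f l -> f <> 0 ->
  exists l', l = f :: l' /\ chain nx (nx f) l'.
Proof. by case: l => //= a l [-> _ C] _; exists l. Qed.

Section Bfs.
Variables (raw : nat -> nat) (B n M : nat) (e : rel nat) (d : nat -> nat -> nat).
Hypothesis Md : metric n e d.

Lemma sum_perm (q : nat -> nat) (F : nat -> nat) :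
  perm_eq (map q (iota 0 n)) (iota 0 n) ->
  \sum_(i < n) F (q i) = \sum_(i < n) F i.
Proof.
move=> Hq; rewrite -(big_mkord xpredT (fun i => F (q i))) -(big_mkord xpredT F).
by rewrite /index_iota subn0 -[RHS](perm_big _ Hq) /= big_map.
Qed.

Lemma bfs_scan_ok s src h tl adjx : src < n ->
  vr s vX = ar s aQ h -> vr s vHEAD = h -> vr s vTAIL = tl -> h < tl ->
  bfs_inv n e src h tl (ar s aD1) (ar s aPAR) (ar s aQ) ->
  chain (ar s aNX) (vr s vF) adjx ->
  (forall y, e (vr s vX) y <-> exists2 f, f \in adjx & ar s aDST f = y) ->
  wp raw B bfs_scan (fun s' => exists tl', [/\ vr s' vTAIL = tl', h < tl',
    bfs_inv n e src h.+1 tl' (ar s' aD1) (ar s' aPAR) (ar s' aQ),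
    forall i, i <= h -> ar s' aQ i = ar s aQ i &
    clock s' <= clock s + 1 + 8 * size adjx]) s.
Proof.
move=> Hsrc HX HH HT Hlt I C HA.
pose x := vr s vX.
pose K k s' := exists l dn tl', [/\ adjx = dn ++ l /\ size l = k, chain (ar s aNX) (vr s' vF) l,
  [/\ vr s' vTAIL = tl', h < tl' &
  bfs_inv n e src h tl' (ar s' aD1) (ar s' aPAR) (ar s' aQ)],
  forall f, f \in dn -> ar s' aD1 (ar s aDST f) != 0 /\
     ar s' aD1 (ar s aDST f) <= (ar s' aD1 x).+1 &
  (forall i, i <= h -> ar s' aQ i = ar s aQ i) /\
  clock s' <= clock s + 8 * size dn].
apply: (wp_while (I := K) (k := size adjx)).
- by exists adjx, [::], tl; split=> //; rewrite muln0 addn0.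
- move=> k s' [Fv Fa] [l [dn [tl' [[E1 E2] C1 [T1 T2 I1] Hd [Hq Hc]]]]] /= NF.
  have X' : vr s' vX = x by rewrite Fv.
  have D' : ar s' aDST = ar s aDST by rewrite Fa.
  have N' : ar s' aNX = ar s aNX by rewrite Fa.
  have [l' [El C2]] := chain_cons C1 NF.
  set f := vr s' vF in El C2 NF; set y := ar s aDST f.
  have qh : ar s' aQ h = x by rewrite Hq // /x HX.
  have Ey : e x y.
    by apply/HA; exists f; rewrite // E1 El mem_cat mem_head orbT.
  wgo; rewrite -/f D' -/y; apply: wp_if; rewrite [eval _ _]/= => Dy.
  + wgo; rewrite -/f N'; exists k.-1; split; first by rewrite -E2 El.
    exists l', (rcons dn f), tl'; split=> //=.
    * by split; [rewrite cat_rcons -El | rewrite -E2 El].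
    * move=> g; rewrite mem_rcons inE => /orP[/eqP->|/Hd//]; split; first exact/eqP.
      have Hy : y < n by have [] := edge_bound (metric_graph Md) Ey.
      (* A visited neighbour occurs in the queue, and no vertex there is more than one level deeper
         than the head. *)
      have := bfs_seen I1 Hy; move/eqP: Dy => -> /esym/mapP[j].
      rewrite mem_iota => Hj Ej; rewrite -/y Ej -qh.
      by apply: (bfs_front I1); lia.
    * by split=> //; rewrite size_rcons; lia.
  + rewrite /bfs_visit_cmd; wgo; rewrite X' T1 -/f N'; exists k.-1.
    split; first by rewrite -E2 El.
    have I2 := bfs_visit Md Hsrc I1 T2 Dy; rewrite qh in I2; have {}I2 := I2 Ey.
    have xy : x != y.
      apply/eqP=> Exy; move: Dy; rewrite -Exy => Dx.
      have Hx : x < n by have [] := edge_bound (metric_graph Md) Ey.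
      have := bfs_seen I1 Hx; rewrite Dx eqxx => /esym/negP; apply.
      by rewrite -qh map_f // mem_iota.
    exists l', (rcons dn f), tl'.+1; split=> //=.
    * by split; [rewrite cat_rcons -El | rewrite -E2 El].
    * by split; rewrite ?addn1 //; lia.
    * rewrite (negPf xy); move=> g; rewrite mem_rcons inE => /orP[/eqP->|Hg].
        by rewrite eqxx; split; lia.
      have [G1 G2] := Hd _ Hg; case: (ar s aDST g =P y) => [Eg|_]; last by [].
      by rewrite Eg Dy in G1.
    * split; last by rewrite size_rcons; lia.
      by move=> i Hi; rewrite ifF ?Hq //; lia.
- move=> k s' [Fv Fa] [l [dn [tl' [[E1 E2] C1 [T1 T2 I1] Hd [Hq Hc]]]]] /= F0.
  have El := chain0 C1 F0; rewrite El cats0 in E1.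
  have qh : ar s' aQ h = x by rewrite Hq // /x HX.
  exists tl'; split=> //=; last by rewrite E1; lia.
  apply: (bfs_next Hsrc I1 T2) => y; rewrite qh => /HA[f Hf <-].
  by apply: Hd; rewrite -E1.
Qed.

(** Scanning is charged to the list lengths of the dequeued vertices. In the end the queue is a
    permutation of all vertices, so [sum_perm] turns the charge into at most 8 M. The clause on
    [aD2] makes two consecutive searches comparable. *)
Lemma bfs_ok s src : src < n -> vr s vSRC = src -> vr s vN = n ->
  adj_lists n M e (ar s aHD) (ar s aNX) (ar s aDST) ->
  wp raw B bfs (fun s' => [/\
    forall v, v < n -> ar s' aD1 v = (d src v).+1 /\ ar s' aD2 v = ar s aD1 v,
    perm_eq (map (ar s' aQ) (iota 0 n)) (iota 0 n) /\ ar s' aQ 0 = src,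
    ar s' aPAR src = src /\ (forall v, v < n -> v != src ->
      e (ar s' aPAR v) v /\ d src v = (d src (ar s' aPAR v)).+1),
    forall i j, i <= j < n -> d src (ar s' aQ i) <= d src (ar s' aQ j) &
    clock s' <= clock s + 8 + 9 * n + 8 * M]) s.
Proof.
move=> Hsrc Hs Hn [adj [A1 A2 A3 A4]]; rewrite /bfs; wgo.
pose I0 i s' := [/\ forall v, v < i -> ar s' aD1 v = 0 /\ ar s' aD2 v = ar s aD1 v,
  forall v, i <= v -> ar s' aD1 v = ar s aD1 v & clock s' <= clock s + 1 + 4 * i].
apply: (wp_for_up (N := n) (I := I0)) => //.
- by move=> s' [Fv _] /=; rewrite Fv.
- by split=> //=; rewrite muln0 addn0 addn1.
- move=> i s' Hi [Fv Fa] Vi [H1 H2 H3]; wgo; rewrite Vi; split=> //=.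
  + move=> v; rewrite ltnS leq_eqVlt => /orP[/eqP->|Hv]; first by rewrite eqxx H2.
    by have [-> ->] := H1 _ Hv; rewrite !ifF //; lia.
  + by move=> v Hv; rewrite ifF ?H2 //; lia.
  + by lia.
move=> s0 [Fv0 Fa0] [H1 _ H3]; wgo.
have Vs : vr s0 vSRC = src by rewrite Fv0.
rewrite Vs; set s1 := setv _ vTAIL 1.
have T1 : clock s1 <= clock s + 7 + 4 * n by rewrite /s1 /=; lia.
have I1 : bfs_inv n e src 0 1 (ar s1 aD1) (ar s1 aPAR) (ar s1 aQ).
  by apply: (bfs_init _ Hsrc) => v /H1[].
pose J k s' := exists h tl, [/\ k + h = n, vr s' vHEAD = h, vr s' vTAIL = tl,
  bfs_inv n e src h tl (ar s' aD1) (ar s' aPAR) (ar s' aQ) &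
  clock s' <= clock s1 + 5 * h + 8 * \sum_(i < h) size (adj (ar s' aQ i))].
have V2 v : v < n -> ar s1 aD2 v = ar s aD1 v by move=> /H1[].
have E0 : ar s1 aHD = ar s aHD by rewrite /s1 /= Fa0.
have E1 : ar s1 aNX = ar s aNX by rewrite /s1 /= Fa0.
have E2 : ar s1 aDST = ar s aDST by rewrite /s1 /= Fa0.
have VH : vr s1 vHEAD = 0 by [].
have VT : vr s1 vTAIL = 1 by [].
clearbody s1; apply: (wp_while (I := J) (k := n)).
- by exists 0, 1; rewrite addn0 big_ord0 !addn0; split.
- move=> k s' [Fv Fa] [h [tl [Ek Vh Vt I T]]] /= NE.
  have Hlt : h < tl by move: NE; rewrite Vh Vt; lia.
  have Hn' := bfs_size Hsrc I.
  wgo; apply: wp_frame; rewrite Vh.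
  set s2 := setv _ vF _; set x := ar s' aQ h.
  have Hx : x < n by apply: (bfs_bound I).
  have C2 : chain (ar s2 aNX) (vr s2 vF) (adj x).
    by rewrite /s2 /= (Fa 0) // (Fa 1) // E0 E1; apply: A1.
  have N2 y : e (vr s2 vX) y <-> exists2 f, f \in adj x & ar s2 aDST f = y.
    by rewrite /s2 /= (Fa 2) // E2; apply: A3.
  have Q2 : vr s2 vX = ar s2 aQ h by [].
  have T2 : vr s2 vTAIL = tl by [].
  apply: wp_mono (bfs_scan_ok (s := s2) Hsrc Q2 Vh T2 Hlt I C2 N2).
  move=> s3 [tl' [Vt' Hlt' I3 Hq T3]] [Fv3 Fa3]; wgo.
  exists k.-1; split; first by lia.
  exists h.+1, tl'; split=> //=.
  + by lia.
  + by rewrite Fv3 //= Vh addn1.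
  + have -> : \sum_(i < h.+1) size (adj (ar s3 6 i)) =
       \sum_(i < h) size (adj (ar s' 6 i)) + size (adj x).
      rewrite big_ord_recr /= Hq //; congr (_ + _).
      by apply: eq_bigr => i _; rewrite Hq //; have := ltn_ord i; lia.
    by move: T3 T; rewrite /s2 /=; lia.
- move=> k s' [Fv Fa] [h [tl [Ek Vh Vt I T]]] /= EE.
  have Eh : h = tl by have := bfs_ht I; move: EE; rewrite Vh Vt; lia.
  rewrite Eh in I T; have [Et HD [Hp Hq0] [HP1 HP2] Hm] := bfs_done Md Hsrc I.
  split=> //=.
  + by move=> v Hv; rewrite HD // Fa // V2.
  + move: T; rewrite Et (sum_perm (fun x => size (adj x)) Hp); lia.
Qed.

End Bfs.

(** * Anchors and classes *)

Record bfs_tree n (e : rel nat) (d : nat -> nat -> nat) (par q pos : nat -> nat) : Prop :=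
  BfsTree {
  tr_n : 0 < n;
  tr_root : par 0 = 0;
  tr_q0 : q 0 = 0;
  tr_edge : forall v, v < n -> v != 0 -> e (par v) v;
  tr_dep : forall v, v < n -> v != 0 -> d 0 v = (d 0 (par v)).+1;
  tr_par : forall v, v < n -> par v < n;
  tr_q : forall i, i < n -> q i < n;
  tr_posq : forall i, i < n -> pos (q i) = i;
  tr_pos : forall v, v < n -> pos v < n;
  tr_qpos : forall v, v < n -> q (pos v) = v;
  tr_up : forall v, v < n -> v != 0 -> pos (par v) < pos v }.

(** [pos] inverts the queue order. A parent is less deep than its child, hence earlier in the queue,
    so scanning the queue backwards meets children before parents without recursion or sorting. *)
Lemma bfs_tree_exists n e d par q : metric n e d -> 0 < n -> par 0 = 0 -> q 0 = 0 ->
  (forall v, v < n -> v != 0 -> e (par v) v /\ d 0 v = (d 0 (par v)).+1) ->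
  perm_eq (map q (iota 0 n)) (iota 0 n) ->
  (forall i j, i <= j < n -> d 0 (q i) <= d 0 (q j)) ->
  exists pos, bfs_tree n e d par q pos.
Proof.
move=> Md n0 p0 q0 Hp Hq Hm; set l := map q (iota 0 n).
have sl : size l = n by rewrite size_map size_iota.
have nl i : i < n -> nth 0 l i = q i.
  by move=> Hi; rewrite (nth_map 0) ?size_iota // nth_iota.
have Ul : uniq l by rewrite (perm_uniq Hq) iota_uniq.
have ml v : (v \in l) = (v < n) by rewrite (perm_mem Hq) mem_iota.
have Hpar v : v < n -> par v < n.
  move=> Hv; case: (eqVneq v 0) => [->|N]; first by rewrite p0.
  by have [/(edge_bound (metric_graph Md))[]] := Hp _ Hv N.
have P1 v : v < n -> index v l < n by move=> Hv; rewrite -[X in _ < X]sl index_mem ml.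
have P2 v : v < n -> q (index v l) = v.
  by move=> Hv; rewrite -nl ?P1 // nth_index ?ml.
exists (fun v => index v l); split=> //.
- by move=> v Hv /(Hp _ Hv)[].
- by move=> v Hv /(Hp _ Hv)[].
- by move=> i Hi; rewrite -ml /l map_f // mem_iota.
- by move=> i Hi; rewrite -(nl _ Hi) index_uniq ?sl.
- move=> v Hv N; have [_ E] := Hp _ Hv N; rewrite ltnNge; apply/negP=> Hle.
  by have := Hm (index v l) (index (par v) l); rewrite Hle !P2 ?P1 ?Hpar // E ltnn => /(_ isT).
Qed.

Section Up.
Variables (n : nat) (e : rel nat) (d : nat -> nat -> nat) (par q pos : nat -> nat).
Variable (mk : pred nat).
Hypothesis (Tr : bfs_tree n e d par q pos).
Let dep := d 0.

(* [seen t v]: the reverse scan, which has reached index t, has treated v. *)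
Definition seen t v := (v < n) && (t <= pos v).

(* A seen core vertex is the end of its label class when its parent does not
   (yet) carry the same label. *)
Definition class_end t (L : nat -> nat) y :=
  [/\ seen t y, y != 0, L y != 0 & ~ (seen t (par y) /\ L (par y) = L y)].

(* L v = s + 1 when the anchor s is the nearest anchor below v, L v = 0 when
   there is none; C counts core children; A s is the parent of the topmost
   vertex labelled s. *)
Record up_inv t (L C A : nat -> nat) : Prop := UpInv {
  up_mk : forall v, seen t v -> mk v -> L v = v.+1;
  up_par : forall v, seen t v -> v != 0 -> L v != 0 -> L (par v) != 0;
  up_lab : forall v, v < n -> L v != 0 ->
    [/\ seen t (L v).-1, dep v <= dep (L v).-1 & L (L v).-1 = L v];
  up_cnt : forall x, pos x < t -> x < n -> (L x == 0) = (C x == 0);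
  up_child : forall x, pos x < t -> x < n -> C x != 0 ->
    exists y, [/\ seen t y, y != 0, L y != 0 & par y = x];
  up_cnt1 : forall y, seen t y -> y != 0 -> L y != 0 -> pos (par y) < t ->
    0 < C (par y) /\ (C (par y) = 1 -> L y = L (par y));
  up_cnt2 : forall y z, seen t y -> seen t z -> y != 0 -> z != 0 ->
    L y != 0 -> L z != 0 -> y != z -> par y = par z ->
    if pos (par y) < t then 1 < C (par y) else L (par y) == (par y).+1;
  up_top : forall y, seen t y -> y != 0 -> L y != 0 -> seen t (par y) ->
    L y != L (par y) -> L (par y) = (par y).+1;
  up_end_inj : forall y z, class_end t L y -> class_end t L z -> L y = L z -> y = z;
  up_end : forall y, class_end t L y -> A (L y).-1 = par y;
  up_anc : forall s, A s < n;
  up_count : \sum_(t <= j < n) (L (q j) == (q j).+1) + \sum_(0 <= j < t) C (q j)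
    <= 2 * \sum_(t <= j < n) mk (q j) }.

Lemma up_init L C A : (forall x, [/\ L x = 0, C x = 0 & A x = 0]) -> up_inv n L C A.
Proof.
have S v : seen n v = false.
  by rewrite /seen; case: ltnP => //= Hv; have := tr_pos Tr Hv; lia.
move=> H; have L0 x : L x = 0 by have [] := H x.
have C0 x : C x = 0 by have [] := H x.
split=> //; try by move=> y; rewrite S.
- by move=> y _; rewrite L0.
- by move=> x _ _; rewrite L0 C0.
- by move=> x _ _; rewrite C0.
- by move=> y z []; rewrite S.
- by move=> y []; rewrite S.
- by move=> s; have [_ _ ->] := H s; apply: tr_n Tr.
- by rewrite [X in X + _]big_geq // big1.
Qed.

Section Step.
Variables (t : nat) (L C A : nat -> nat).
Hypotheses (Ht : t < n) (I : up_inv t.+1 L C A).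
Let v := q t.
Let p := par v.

Lemma step_v : v < n /\ pos v = t.
Proof. by rewrite /v (tr_q Tr) // (tr_posq Tr). Qed.

Lemma seenS y : seen t y = (y == v) || seen t.+1 y.
Proof.
have [Hv Pv] := step_v; rewrite /seen; case: (eqVneq y v) => [->|N] /=.
  by rewrite Hv Pv leqnn.
case: ltnP => //= Hy; rewrite leq_eqVlt; case: eqP => //= E.
by move: N; rewrite -(tr_qpos Tr Hy) -E /v eqxx.
Qed.

(** By [up_cnt] a zero label means that there is no core child; as [v] is also unmarked, it stays
    outside the core. *)
Lemma up_skip : L v = 0 -> ~~ mk v -> up_inv t L C A.
Proof.
have [Hv Pv] := step_v; move=> Lv Mv.
have nc y : seen t y -> L y != 0 -> seen t.+1 y.
  by rewrite seenS => /orP[/eqP->|//]; rewrite Lv.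
have pS y : pos y < t -> pos y < t.+1 by apply: leqW.
have EE y : class_end t L y -> class_end t.+1 L y.
  move=> [H1 H2 H3 H4]; split=> //; first exact: nc.
  by case=> H5 H6; apply: H4; rewrite seenS H5 orbT.
split.
- move=> y; rewrite seenS => /orP[/eqP->|/(up_mk I)//]; by rewrite (negPf Mv).
- by move=> y Hy N Ly; apply: (up_par I) => //; apply: nc.
- move=> y Hy Ly; have [H1 H2 H3] := up_lab I Hy Ly.
  by split=> //; rewrite seenS H1 orbT.
- by move=> x /pS; apply: (up_cnt I).
- move=> x /pS H1 H2 H3; have [y [H4 H5 H6 H7]] := up_child I H1 H2 H3.
  by exists y; rewrite seenS H4 orbT.
- by move=> y Hy N Ly /pS; apply: (up_cnt1 I) => //; apply: nc.
- move=> y z Sy Sz y0 z0 Ly Lz N E; have := up_cnt2 I (nc _ Sy Ly) (nc _ Sz Lz) y0 z0 Ly Lz N E.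
  case: (ltnP (pos (par y)) t) => [/pS->//|H]; rewrite ltnS.
  case: (leqP (pos (par y)) t) => // H2 H3; have Ey : par y = v.
    rewrite /v; have -> : t = pos (par y) by lia.
    by rewrite (tr_qpos Tr) // (tr_par Tr) //; case/andP: Sy.
  have := up_cnt I (x := v); rewrite Pv Lv eqxx => /(_ (ltnSn _) Hv)/esym/eqP C0.
  by rewrite Ey C0 in H3.
- move=> y Sy N Ly; rewrite seenS => /orP[/eqP E|Sp]; last by apply: (up_top I) => //; apply: nc.
  have := up_par I (nc _ Sy Ly) N Ly; by rewrite E Lv.
- by move=> y z /EE H1 /EE H2; apply: (up_end_inj I).
- by move=> y /EE; apply: (up_end I).
- exact: up_anc I.
- have := up_count I; rewrite big_nat_recr //= -/v.
  rewrite (big_ltn Ht) [X in _ -> _ <= 2 * X](big_ltn Ht) -/v Lv (negPf Mv) /=.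
  lia.
Qed.

(** The root has no proper parent to receive its label; being marked, it closes the scan as an
    anchor of its own. *)
Lemma up_root L' : v = 0 -> (forall x, L' x = if x == 0 then 1 else L x) ->
  mk 0 -> up_inv t L' C A.
Proof.
have [Hv Pv] := step_v; move=> v0 L'E M0.
have t0 : t = 0 by rewrite -Pv v0 -[X in pos X](tr_q0 Tr) (tr_posq Tr) // (tr_n Tr).
have S0 y : seen t.+1 y = (y < n) && (y != 0).
  have := seenS y; rewrite v0 t0 {1}/seen leq0n andbT; case: eqP => [-> _|_ /= ->].
    by rewrite andbF /seen -v0 Pv t0 andbF.
  by rewrite andbT.
have Sp y : seen t y = (y < n) by rewrite /seen t0 andbT.
have LE y : y != 0 -> L' y = L y by rewrite L'E => /negPf->.
have lt0 : 0 < n := tr_n Tr.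
have lab y : y < n -> L y != 0 -> [/\ (L y).-1 < n, (L y).-1 != 0, dep y <= dep (L y).-1 & L' (L y).-1 = L y].
  move=> Hy Ly; have [] := up_lab I Hy Ly; rewrite S0 => /andP[H1 H2] H3 H4.
  by split=> //; rewrite LE.
have EE y : class_end t L' y -> class_end t.+1 L y.
  move=> [H1 H2 H3 H4]; split=> //; first by rewrite S0 H2 andbT -Sp.
    by rewrite -LE.
  case; rewrite S0 => /andP[H5 H6] H7; apply: H4.
  by rewrite Sp H5 !LE.
split.
- move=> y; rewrite Sp L'E; case: eqP => [->//|/eqP N Hy]; apply: (up_mk I).
  by rewrite S0 Hy.
- move=> y; rewrite Sp => Hy N; rewrite LE // => Ly; rewrite L'E; case: (par y =P 0) => // _.
  by apply: (up_par I) => //; rewrite S0 Hy.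
- move=> y Hy; rewrite L'E; case: (y =P 0) => [->|_] Ly.
    by rewrite Sp lt0 L'E eqxx.
  by have [H1 H2 H3 H4] := lab _ Hy Ly; rewrite Sp.
- by rewrite t0.
- by rewrite t0.
- by rewrite t0.
- move=> y z; rewrite !Sp t0 ltn0 => Hy Hz y0 z0; rewrite (LE y) // (LE z) // => Ly Lz N E.
  rewrite L'E; case: (par y =P 0) => [->//|/eqP px].
  have := up_cnt2 I _ _ y0 z0 Ly Lz N E; rewrite !S0 Hy Hz y0 z0 => /(_ isT isT).
  by rewrite ifF // t0; have := S0 (par y); rewrite /seen t0 (tr_par Tr) // px; lia.
- move=> y; rewrite !Sp => Hy N; rewrite LE // => Ly Hp; rewrite L'E.
  case: (par y =P 0) => [->//|/eqP px] Ne; apply: (up_top I) => //; by rewrite S0 ?Hy ?Hp.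
- move=> y z /[dup] [[_ Ny _ _]] /EE H1 /[dup] [[_ Nz _ _]] /EE H2; rewrite !LE //.
  exact: (up_end_inj I).
- by move=> y /[dup] [[_ Ny _ _]] /EE H1; rewrite LE //; apply: (up_end I).
- exact: up_anc I.
- have E1 : \sum_(t.+1 <= j < n) (L' (q j) == (q j).+1) =
      \sum_(t.+1 <= j < n) (L (q j) == (q j).+1).
    apply: eq_big_nat => j Hj; rewrite LE //; apply/eqP => E.
    by have := tr_posq Tr (i := j); rewrite E -v0 Pv t0; lia.
  have := up_count I; rewrite big_nat_recr //= -/v.
  rewrite (big_ltn Ht) [X in _ -> _ <= 2 * X](big_ltn Ht) -/v v0 M0 E1.
  by rewrite L'E eqxx /=; lia.
Qed.

(** The label k is fresh if v is marked or has two core children, and otherwise inherited from the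
    only core child. The parent receives it provisionally. The count is a potential: v gives up its
    [C v] pending children, adds one to its parent, and adds one more if it becomes an anchor. A
    marked v raises it by at most 2, a branching one by 1 + 1 - [C v] <= 0, an inheriting one by
    0. *)
Lemma up_step k L' : v != 0 -> k != 0 ->
  (k = v.+1 /\ (mk v \/ 1 < C v)) \/ [/\ k = L v, ~~ mk v & C v = 1] ->
  (forall x, L' x = if (x == p) || (x == v) then k else L x) ->
  up_inv t L' (updf C p (C p).+1) (updf A k.-1 p).
Proof.
have [Hv Pv] := step_v; move=> v0 k0 Hk L'E.
have Hp : p < n := tr_par Tr Hv.
have Pp : pos p < t by rewrite -Pv (tr_up Tr).
have Sv : seen t v by rewrite seenS eqxx.
have nSp : seen t p = false by rewrite /seen Hp leqNgt Pp.
have nSv : seen t.+1 v = false by rewrite /seen Pv ltnn andbF.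
have pv : p != v by apply/eqP=> E; move: nSp; rewrite E Sv.
have S1 y : seen t.+1 y -> seen t y by rewrite seenS => ->; rewrite orbT.
have Lv : L' v = k by rewrite L'E eqxx orbT.
have Lp : L' p = k by rewrite L'E eqxx.
have Ls y : seen t.+1 y -> L' y = L y.
  move=> Sy; rewrite L'E ifF //; apply/norP; split; apply/eqP=> E; subst y.
    by move: (S1 _ Sy); rewrite nSp.
  by rewrite nSv in Sy.
have Lo x : x != p -> x != v -> L' x = L x by rewrite L'E => /negPf-> /negPf->.
have Vp y : pos (par y) < t -> par y != v by move=> H; apply/eqP=> E; rewrite E Pv ltnn in H.
have seenP y : seen t y -> y = v \/ seen t.+1 y /\ y != v.
  rewrite seenS; case: (eqVneq y v) => [->|N] /=; [by left | by right].
have kid y : seen t y -> y != 0 -> par y = v -> seen t.+1 y.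
  move=> /seenP[-> _ E|[]//]; by rewrite /p E eqxx in pv.
have kst : [/\ seen t k.-1, dep v <= dep k.-1 & L' k.-1 = k].
  case: Hk => [[Ek _]|[-> _ C1]]; first by rewrite Ek /= Lv.
  have Lv0 : L v != 0 by rewrite (up_cnt I) ?Pv // C1.
  by have [H1 H2 H3] := up_lab I Hv Lv0; rewrite Ls //; split=> //; apply: S1.
have EE y : class_end t L' y -> y = v \/ class_end t.+1 L y /\ y != v.
  move=> [H1 H2 H3 H4]; case: (seenP _ H1) => [|[H5 N]]; first by left.
  right; split=> //; split=> //; first by rewrite -Ls.
  by case=> H6 H7; apply: H4; rewrite S1 // !Ls.
have Ev : class_end t L' v by split=> //; [rewrite Lv | rewrite -/p nSp => -[]].
(* A class keeps a single end. A fresh label cannot occur at an older end, as v would have been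
   seen; for an inherited one the old end was the only core child w of v, and w stops being an end
   once v carries its label. *)
have EI z : class_end t L' z -> L' z = k -> z = v.
  move=> Ez; case: (EE _ Ez) => [//|[E1 N]].
  have [Sz z0 Lz _] := E1; rewrite Ls // => Ezk.
  have [Hz1 _ _] := up_lab I (proj1 (andP Sz)) Lz.
  case: Hk => [[Ek _]|[Ek _ C1]].
    by rewrite Ezk Ek /= nSv in Hz1.
  have Cv0 : C v != 0 by rewrite C1.
  have [|w [Sw w0 Lw Ew]] := up_child I _ Hv Cv0; first by rewrite Pv.
  have [|_ Hw] := up_cnt1 I Sw w0 Lw; first by rewrite Ew Pv.
  have {}Hw : L w = L v by rewrite -Ew Hw // Ew.
  have Ew1 : class_end t.+1 L w by split=> //; rewrite Ew nSv => -[].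
  have Ezw : z = w by apply: (up_end_inj I) => //; rewrite Hw -Ek.
  case: Ez => _ _ _ []; rewrite Ezw Ew Sv Lv Ls // Hw -Ek; by split.
split.
- move=> y /seenP[-> Mv|[Sy N]]; last by rewrite Ls //; apply: (up_mk I).
  by rewrite Lv; case: Hk => [[]//|[_ /negP]].
- move=> y /seenP[-> _ _|[Sy N] y0]; first by rewrite -/p Lp.
  rewrite Ls // => Ly; rewrite L'E; case: orP => // _.
  exact: (up_par I).
- move=> y Hy; have [K1 K2 K3] := kst.
  case: (eqVneq y p) => [->|Np].
    by rewrite Lp; split=> //; apply: leq_trans K2; rewrite /dep (tr_dep Tr Hv).
  case: (eqVneq y v) => [->|Nv]; first by rewrite Lv.
  rewrite Lo // => Ly; have [H1 H2 H3] := up_lab I Hy Ly.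
  by rewrite Ls //; split=> //; apply: S1.
- move=> x Hx Hxn; have Nx : x != v by apply/eqP=> E; rewrite E Pv ltnn in Hx.
  case: (eqVneq x p) => [->|Np]; first by rewrite Lp updf_eq (negPf k0).
  by rewrite Lo // updf_ne // (up_cnt I) // ltnW.
- move=> x Hx Hxn; case: (eqVneq x p) => [->|Np].
    by move=> _; exists v; rewrite Lv.
  rewrite updf_ne // => Cx; have [|y [Sy y0 Ly Ey]] := up_child I _ Hxn Cx.
    exact: ltnW.
  by exists y; rewrite Ls //; split=> //; apply: S1.
- move=> y /seenP[->|[Sy N]] y0 Ly Hpy.
    rewrite -/p updf_eq Lp Lv; by split.
  rewrite Ls // in Ly *; have [|H1 H2] := up_cnt1 I Sy y0 Ly; first exact: ltnW.
  case: (eqVneq (par y) p) => [E|Np].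
    rewrite E updf_eq; split=> // -[C0]; by rewrite E C0 in H1.
  by rewrite updf_ne // Lo // Vp.
- move=> y z Sy Sz y0 z0 Ly Lz N E.
  have old : seen t.+1 y -> seen t.+1 z ->
      if pos (par y) < t.+1 then 1 < C (par y) else L (par y) == (par y).+1.
    by move=> Hy Hz; rewrite Ls // in Ly; rewrite Ls // in Lz; apply: (up_cnt2 I) E.
  case: (ltnP (pos (par y)) t) => Hpy.
    rewrite ltnS (ltnW Hpy) in old.
    case: (eqVneq (par y) p) => [Ep|Np].
      rewrite Ep updf_eq.
      case: (seenP _ Sy) => [Ey|[Sy1 _]].
        case: (seenP _ Sz) => [Ez|[Sz1 _]]; first by rewrite Ey Ez eqxx in N.
        rewrite Ls // in Lz; have [|H _] := up_cnt1 I Sz1 z0 Lz.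
          by rewrite -E ltnW.
        by rewrite -E Ep in H; rewrite ltnS.
      rewrite Ls // in Ly; have [|H _] := up_cnt1 I Sy1 y0 Ly; first exact: ltnW.
      by rewrite Ep in H; rewrite ltnS.
    rewrite updf_ne //; apply: old.
      by case: (seenP _ Sy) => [Ey|[]//]; rewrite Ey eqxx in Np.
    by case: (seenP _ Sz) => [Ez|[]//]; rewrite E Ez eqxx in Np.
  have Sy1 : seen t.+1 y.
    by case: (seenP _ Sy) => [Ey|[]//]; rewrite Ey leqNgt Pp in Hpy.
  have Sz1 : seen t.+1 z.
    by case: (seenP _ Sz) => [Ez|[]//]; rewrite E Ez leqNgt Pp in Hpy.
  have := old Sy1 Sz1; case: (eqVneq (par y) v) => [Epv|Nv].
    rewrite Epv Pv ltnSn Lv; case: Hk => [[-> _]//|[_ _ ->]//].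
  have Npp : par y != p by apply/eqP=> Ep; rewrite Ep leqNgt Pp in Hpy.
  rewrite Lo // ltnS leqNgt ltn_neqAle Hpy andbT; case: eqP => //= Et.
  have Hy : y < n by case/andP: Sy.
  by move/eqP: Nv; rewrite /v Et (tr_qpos Tr) // (tr_par Tr).
- move=> y Sy y0; case: (seenP _ Sy) => [->|[Sy1 Ny]]; first by rewrite -/p nSp.
  rewrite (Ls y) // => Ly Spy; case: (seenP _ Spy) => [E|[Spy1 _]].
    rewrite E Lv; case: Hk => [[-> //]|[-> _ C1]].
    have [|_ H] := up_cnt1 I Sy1 y0 Ly; first by rewrite E Pv.
    by rewrite -E H ?eqxx // E.
  by rewrite Ls //; apply: (up_top I).
- move=> y z Ey Ez; case: (EE _ Ey) => [->|[Ey1 Ny]].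
    by rewrite Lv => /esym/(EI _ Ez).
  case: (EE _ Ez) => [->|[Ez1 Nz]]; first by rewrite Lv => /(EI _ Ey).
  have [Sy _ _ _] := Ey1; have [Sz _ _ _] := Ez1.
  by rewrite !Ls //; apply: (up_end_inj I).
- move=> y Ey; case: (EE _ Ey) => [->|[Ey1 Ny]]; first by rewrite Lv updf_eq.
  have [Sy _ Ly _] := Ey1.
  rewrite updf_ne; first by rewrite Ls //; apply: (up_end I).
  apply/eqP => E; move: Ny; rewrite (EI _ Ey) ?eqxx //.
  by move: E k0; rewrite Ls //; lia.
- by move=> s; rewrite /updf; case: eqP => // _; apply: (up_anc I).
- have E1 : \sum_(t.+1 <= j < n) (L' (q j) == (q j).+1) =
      \sum_(t.+1 <= j < n) (L (q j) == (q j).+1).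
    apply: eq_big_nat => j Hj; rewrite Ls // /seen (tr_q Tr) ?(tr_posq Tr) //; lia.
  have E2 : \sum_(0 <= j < t) updf C p (C p).+1 (q j) = (\sum_(0 <= j < t) C (q j)).+1.
    rewrite (@big_cat_nat _ _ _ (pos p)) //=; last exact: ltnW.
    rewrite [in RHS](@big_cat_nat _ _ _ (pos p)) //=; last exact: ltnW.
    rewrite [in LHS](big_ltn Pp) [in RHS](big_ltn Pp) (tr_qpos Tr) // updf_eq.
    rewrite (eq_big_nat _ _ (F2 := fun j => C (q j))); last first.
      move=> j Hj; rewrite updf_ne //; apply/eqP=> E.
      by have := tr_posq Tr (i := j); rewrite E; lia.
    rewrite [X in _ + (_ + X)](eq_big_nat _ _ (F2 := fun j => C (q j))); first by lia.
    move=> j Hj; rewrite updf_ne //; apply/eqP=> E.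
    by have := tr_posq Tr (i := j); rewrite E; lia.
  have := up_count I; rewrite big_nat_recr //= -/v.
  rewrite (big_ltn Ht) [X in _ -> _ <= 2 * X](big_ltn Ht) -/v E1 E2 Lv.
  case: Hk => [[-> Hm]|[Ek Mv C1]].
    by rewrite eqxx; case: Hm => [->|]; [|case: (mk v)]; lia.
  have -> : (k == v.+1) = false.
    apply/negP=> /eqP E; have Lv0 : L v != 0 by rewrite -Ek.
    by have [] := up_lab I Hv Lv0; rewrite -Ek E /= nSv.
  by rewrite (negPf Mv) C1; lia.
Qed.

End Step.
Lemma seen0 v : v < n -> seen 0 v.
Proof. by rewrite /seen => ->. Qed.

(* Deleting the anchors leaves pieces, grouped into classes by the anchor
   lab v below (or equal to) the place where v hangs; an edge leaving the
   class of s starts at s or ends at anc s. *)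
Record labelling (core : pred nat) (lab anc : nat -> nat) : Prop := Labelling {
  lab_edge : forall x y, e x y -> [\/ x != 0 /\ par x = y, y != 0 /\ par y = x |
     [/\ core x, core y, lab x = x & lab y = y]];
  lab_up : forall y, y < n -> y != 0 -> core y -> core (par y);
  lab_out : forall y, y < n -> ~~ core y -> y != 0 /\ lab y = lab (par y);
  lab_dep : forall y, y < n -> core y -> dep y <= dep (lab y);
  lab_branch : forall y z, y < n -> z < n -> y != 0 -> z != 0 -> y != z ->
    core y -> core z -> par y = par z -> lab (par y) = par y;
  lab_top : forall y, y < n -> y != 0 -> core y -> lab y != lab (par y) ->
    lab (par y) = par y /\ anc (lab y) = par y;
  lab_idem : forall y, y < n -> [/\ lab y < n, lab (lab y) = lab y & core (lab y)];
  lab_root : core 0 /\ lab 0 = 0;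
  lab_top_inj : forall y z, y < n -> z < n -> y != 0 -> z != 0 ->
    core y -> core z -> lab y != lab (par y) -> lab z != lab (par z) ->
    lab y = lab z -> y = z;
  anc_bound : forall s, anc s < n }.

(** After the scan no child count is pending, so the potential bounds the anchors alone by twice the
    marks. Non-core vertices take the label of the nearest core ancestor, which exists as the root
    is core, and this creates no anchor. *)
Lemma labelling_of_up L C A L' : up_inv 0 L C A ->
  (forall x y, e x y -> [\/ par x = y, par y = x | mk x && mk y]) ->
  (forall x y, e x y -> x != y) -> mk 0 -> (forall x, mk x -> x < n) ->
  (forall v, v < n -> L' v = if L v != 0 then L v else L' (par v)) ->
  [/\ labelling (fun v => L v != 0) (fun v => (L' v).-1) A,
      forall v, v < n -> L' v != 0 &
      \sum_(v < n) (L' v == v.+1) <= 2 * \sum_(v < n) mk v].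
Proof.
move=> I He Hloop M0 Mb HL.
have n0 := tr_n Tr.
have core0 : L 0 = 1 by rewrite (up_mk I) // seen0.
have LC v : v < n -> L v != 0 -> L' v = L v by move=> Hv Lv; rewrite HL // Lv.
have rep v : v < n -> exists x, [/\ x < n, L x != 0 & L' v = L x].
  have [k] := ubnP (pos v); elim: k v => // k IH v; rewrite ltnS => Hk Hv.
  rewrite HL //; case: (eqVneq (L v) 0) => [Lv|Lv]; last by exists v.
  have v0 : v != 0 by apply/eqP=> E; rewrite E core0 in Lv.
  apply: IH; last exact: (tr_par Tr).
  exact: leq_trans (tr_up Tr Hv v0) Hk.
have idem v : v < n -> [/\ (L' v).-1 < n, L' (L' v).-1 = L' v & L (L' v).-1 != 0].
  move=> Hv; have [x [Hx Lx ->]] := rep _ Hv; have [H1 _ H3] := up_lab I Hx Lx.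
  have Hs : (L x).-1 < n by case/andP: H1.
  by rewrite LC ?H3.
have mkL x : mk x -> L x = x.+1 by move=> Mx; rewrite (up_mk I) // seen0 // Mb.
split.
- split.
  + move=> x y Exy; case: (He _ _ Exy) => [E|E|/andP[Mx My]].
    * constructor 1; split=> //; apply/eqP=> x0; move: (Hloop _ _ Exy).
      by rewrite -E x0 (tr_root Tr).
    * constructor 2; split=> //; apply/eqP=> y0; move: (Hloop _ _ Exy).
      by rewrite -E y0 (tr_root Tr).
    * by constructor 3; rewrite !LC ?Mb // !mkL.
  + by move=> y Hy y0 Ly; apply: (up_par I) => //; apply: seen0.
  + move=> y Hy; rewrite negbK => /eqP Ly; split; last by rewrite HL // Ly.
    by apply/eqP=> E; rewrite E core0 in Ly.
  + by move=> y Hy Ly; rewrite LC //; have [] := up_lab I Hy Ly.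
  + move=> y z Hy Hz y0 z0 N Ly Lz E.
    have := up_cnt2 I (seen0 Hy) (seen0 Hz) y0 z0 Ly Lz N E; rewrite ltn0 => /eqP Lp.
    by rewrite LC ?Lp // (tr_par Tr).
  + move=> y Hy y0 Ly; have Lp := up_par I (seen0 Hy) y0 Ly; have Hp := tr_par Tr Hy.
    rewrite !LC // => N; have Np : L y != L (par y) by apply: contra N => /eqP->.
    rewrite (up_top I) ?seen0 //; split=> //; apply: (up_end I); split=> //.
      exact: seen0.
    by case=> _ E; rewrite E eqxx in Np.
  + by move=> y /idem[H1 H2 H3]; rewrite H2.
  + by rewrite LC // core0.
  + have top x : x < n -> x != 0 -> L x != 0 -> (L' x).-1 != (L' (par x)).-1 ->
        class_end 0 L x.
      move=> Hx x0 Lx; have Lp := up_par I (seen0 Hx) x0 Lx.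
      rewrite !LC ?(tr_par Tr) // => N; split=> //; first exact: seen0.
      by case=> _ E; rewrite E eqxx in N.
    move=> y z Hy Hz y0 z0 Ly Lz Ny Nz E; apply: (up_end_inj I); try exact: top.
    move: E; rewrite !LC //; lia.
  + exact: up_anc I.
- by move=> v Hv; have [x [_ Lx ->]] := rep _ Hv.
- have sumq (F : nat -> nat) : \sum_(0 <= j < n) F (q j) = \sum_(v < n) F v.
    rewrite big_mkord (reindex_onto (fun v : 'I_n => Ordinal (tr_pos Tr (ltn_ord v)))
       (fun j : 'I_n => Ordinal (tr_q Tr (ltn_ord j)))) /=; last first.
      by move=> j _; apply/val_inj => /=; rewrite (tr_posq Tr).
    apply: eq_big => [v|v _]; last by rewrite (tr_qpos Tr).
    by apply/eqP/val_inj => /=; rewrite (tr_qpos Tr).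
  have := up_count I; rewrite [X in _ + X]big_geq // addn0.
  rewrite (sumq (fun v => (L v == v.+1) : nat)) (sumq (fun v => mk v : nat)).
  apply: leq_trans; apply: leq_sum => v _.
  case: (eqVneq (L v) 0) => [Lv|Lv]; last by rewrite LC.
  case: eqP => // E; have [_ _] := idem _ (ltn_ord v); by rewrite E /= Lv.
Qed.

End Up.

(** * Separation by anchors and the recursion on heights *)

Section Classes.
Variables (n : nat) (e : rel nat) (d : nat -> nat -> nat) (par q pos : nat -> nat).
Variables (core : pred nat) (lab anc : nat -> nat).
Hypotheses (Md : metric n e d) (Tr : bfs_tree n e d par q pos).
Hypothesis (Lb : labelling n e d par core lab anc).
Let dep := d 0.

Lemma path_through x p y z : x < n -> path e x p -> y \in x :: p -> last x p = z ->
  d x y + d y z <= size p.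
Proof.
move=> Hx; rewrite inE => Hp /orP[/eqP->|Hy] Lz.
  by rewrite (dist0 Md) // add0n -Lz (metric_le Md).
case/splitPr: Hy Hp Lz => p1 p2; rewrite cat_path last_cat /= => /and3P[P1 E1 P2] Lz.
have P1y : path e x (rcons p1 y) by rewrite rcons_path P1.
have Hy : y < n by have := path_bound Md Hx P1y; rewrite last_rcons.
have := metric_le Md Hx P1y; have := metric_le Md Hy P2.
by rewrite last_rcons size_rcons size_cat Lz /=; lia.
Qed.

(** An edge off the tree joins two anchors, and a tree edge to a non-core child stays in its class.
    What remains is a tree edge in the core with two labels: its upper end is an anchor and is [anc]
    of the lower class. *)
Lemma class_exit x y : e x y -> lab x != lab y -> x = lab x \/ y = anc (lab x).
Proof.
move=> Exy; have [Hx Hy] := edge_bound (metric_graph Md) Exy.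
case: (lab_edge Lb Exy) => [[x0 Px]|[y0 Py]|[_ _ ->]] N; last by left.
- right; case: (boolP (core x)) => Cx; last first.
    by have [_ E] := lab_out Lb Hx Cx; rewrite E Px eqxx in N.
  by rewrite -Px in N *; have [_ ->] := lab_top Lb Hx x0 Cx N.
- left; case: (boolP (core y)) => Cy; last first.
    by have [_ E] := lab_out Lb Hy Cy; rewrite E Py eqxx in N.
  by rewrite -Py in N *; rewrite eq_sym in N; have [->] := lab_top Lb Hy y0 Cy N.
Qed.

(** Follow a shortest path up to the first edge that leaves the class of [u]. *)
Lemma class_separation u w : u < n -> w < n -> lab u != lab w ->
  d u (lab u) + d (lab u) w <= d u w \/
  d u (anc (lab u)) + d (anc (lab u)) w <= d u w.
Proof.
move=> Hu Hw N; have [p [P1 Lp <-]] := metric_path Md Hu Hw.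
have [H|H] : lab u \in u :: p \/ anc (lab u) \in u :: p.
  rewrite -Lp in N; elim: p u {Hu Lp} P1 N => [|y p IH] u /=; first by rewrite eqxx.
  move=> /andP[E Pp] N; case: (eqVneq (lab u) (lab y)) => [El|Nl].
    rewrite El in N *; case: (IH _ Pp N) => H; [left|right];
    by rewrite inE H orbT.
  by case: (class_exit E Nl) => <-; [left|right]; rewrite !inE eqxx ?orbT.
- by left; apply: path_through.
- by right; apply: path_through.
Qed.

Lemma dep_iter k z : z < n -> iter k par z < n /\ dep (iter k par z) = dep z - k.
Proof.
move=> Hz; elim: k => [|k [H1 H2]]; first by rewrite subn0.
split; first by rewrite iterS (tr_par Tr).
rewrite iterS subnS -H2; case: (eqVneq (iter k par z) 0) => [->|N].
  by rewrite (tr_root Tr) /dep (dist0 Md) ?(tr_n Tr).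
by rewrite /dep (tr_dep Tr H1).
Qed.

Lemma core_iter k z : z < n -> core z -> core (iter k par z).
Proof.
move=> Hz Cz; elim: k => //= k IH; case: (eqVneq (iter k par z) 0) => [->|N].
  by rewrite (tr_root Tr); case: (lab_root Lb).
by apply: (lab_up Lb) => //; case: (dep_iter k Hz).
Qed.

(** The subtree of a non-core vertex is non-core, as the core is closed under parents. So it meets
    tree edges only, and its only way out leads to [par y]. *)
Lemma hanging_separation y i z z' : y < n -> ~~ core y ->
  z < n -> z' < n -> iter i par z = y -> (forall k, iter k par z' != y) ->
  d z (par y) + d (par y) z' <= d z z'.
Proof.
move=> Hy Cy Hz Hz' Ei Nk; have [p [P1 Lp <-]] := metric_path Md Hz Hz'.
apply: path_through => //.
have [y0 _] := lab_out Lb Hy Cy.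
elim: p z i Hz {Hz'} P1 Lp Ei => [|x p IH] z i Hz /=.
  by move=> _ E Ei; have := Nk i; rewrite -E Ei eqxx.
move=> /andP[E Pp] Lp Ei; have [_ Hx] := edge_bound (metric_graph Md) E.
have Cz : ~~ core z by apply: contra Cy => Cz; rewrite -Ei core_iter.
case: (lab_edge Lb E) => [[z0 Pz]|[x0 Px]|[Cz' _ _ _]]; last by rewrite Cz' in Cz.
- case: i Ei => [|i] Ei; first by rewrite -Ei /= Pz !inE eqxx orbT.
  rewrite iterSr Pz in Ei; rewrite inE orbC; apply/orP; left.
  exact: (IH _ _ Hx Pp Lp Ei).
- have Ex : iter i.+1 par x = y by rewrite iterSr Px.
  by rewrite inE orbC; apply/orP; left; apply: (IH _ _ Hx Pp Lp Ex).
Qed.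

Lemma dist_dep x y : x < n -> y < n -> dep y - dep x <= d x y.
Proof. by move=> Hx Hy; rewrite leq_subLR; apply: (dist_tri Md); rewrite ?(tr_n Tr). Qed.

(** If both children were in the core, their parent would be an anchor and, by equality of labels,
    the label of [y]; but a label is never less deep than a core vertex carrying it. So one child
    roots a hanging tree, paths pass the common parent, and depth differences bound both parts from
    below. *)
Lemma tree_distance u i y w j v : u < n -> w < n ->
  iter i par u = y -> iter j par w = v -> y != 0 -> v != 0 -> y != v ->
  par y = par v -> lab y = lab (par y) -> lab v = lab (par v) ->
  i.+1 + j.+1 <= d u w.
Proof.
move=> Hu Hw Ei Ej y0 v0 N E Ly Lv; rewrite -E in Lv.
have [Hy Dy] := dep_iter i Hu; have [Hv Dv] := dep_iter j Hw.
rewrite Ei in Hy Dy; rewrite Ej in Hv Dv.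
have Dpy := tr_dep Tr Hy y0; have Dpv := tr_dep Tr Hv v0; rewrite -E in Dpv.
have Hp := tr_par Tr Hy; rewrite -/dep in Dpy Dpv.
have H1 := dist_dep Hp Hu; have H2 := dist_dep Hp Hw.
have not_under z z' k k' : z < n -> z' < n -> iter k par z = y -> iter k' par z' = v ->
   (forall k2, iter k2 par z' != y) /\ (forall k2, iter k2 par z != v).
  move=> Hz Hz' Ek Ek'; have [_ A1] := dep_iter k Hz; have [_ A2] := dep_iter k' Hz'.
  rewrite Ek in A1; rewrite Ek' in A2.
  split=> k2; apply/negP=> /eqP E2.
    have [_ A3] := dep_iter k2 Hz'; rewrite E2 in A3.
    have Ekk : k2 = k' by lia.
    by move: N; rewrite -E2 -Ek' Ekk eqxx.
  have [_ A3] := dep_iter k2 Hz; rewrite E2 in A3.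
  have Ekk : k2 = k by lia.
  by move: N; rewrite -E2 -Ek Ekk eqxx.
have [U1 U2] := not_under _ _ _ _ Hu Hw Ei Ej.
have [Cy|Cv] : ~~ core y \/ ~~ core v.
  case: (boolP (core y)) => Cy; last by left.
  case: (boolP (core v)) => Cv; last by right.
  have B := lab_branch Lb Hy Hv y0 v0 N Cy Cv E.
  have := lab_dep Lb Hy Cy; rewrite Ly B -/dep; lia.
- have := hanging_separation Hy Cy Hu Hw Ei U1.
  by rewrite (dist_sym Md Hu Hp); lia.
- have := hanging_separation Hv Cv Hw Hu Ej U2.
  by rewrite -E (dist_sym Md Hw Hp) (dist_sym Md Hw Hu); lia.
Qed.

(** [u] lies i tree edges below [x] in one class, and the reverse scan, which has reached index t,
    has treated all these edges. *)
Definition climbs t u i x := [/\ u < n, iter i par u = x &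
  forall j, j < i -> [/\ seen n pos t (iter j par u), iter j par u != 0 &
    lab (iter j.+1 par u) = lab (iter j par u)]].

Variable dmax : nat.
Hypothesis Hdmax : forall u w, u < n -> w < n -> d u w <= dmax.

(** Since heights are attained, a sum of two heights can be compared with the distance of two actual
    vertices, which keeps [best] at most [dmax]; the first two clauses give the opposite bound. *)
Record dp_inv t (H : nat -> nat) best : Prop := DpInv {
  dp_height : forall u i x, climbs t u i x -> i <= H x;
  dp_pair : forall u i w j x, climbs t u i x -> climbs t w j x -> d u w <= best;
  dp_attained : forall x, x < n -> exists u, climbs t u (H x) x;
  dp_best : best <= dmax }.

Lemma dp_init H : (forall x, H x = 0) -> dp_inv n H 0.
Proof.
move=> H0; have C u i x : climbs n u i x -> i = 0 /\ u = x.
  case: i => [[]//|i [Hu _ Hj]]; have [] := Hj 0 isT.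
  by rewrite /seen /= Hu /=; have := tr_pos Tr Hu; lia.
split=> //.
- by move=> u i x /C[-> _].
- move=> u i w j x C1 /C[_ ->]; have [_ E1] := C _ _ _ C1.
  by have [Hu _ _] := C1; rewrite -E1 (dist0 Md).
- by move=> x Hx; exists x; rewrite H0.
Qed.

Section Step.
Variables (t : nat) (H : nat -> nat) (best : nat).
Hypotheses (Ht : t < n) (I : dp_inv t.+1 H best).
Let v := q t.
Let p := par v.

Lemma climbs_weaken u i x : climbs t.+1 u i x -> climbs t u i x.
Proof.
move=> [Hu E Hj]; split=> // j /Hj[H1 H2 H3]; split=> //.
by move: H1; rewrite /seen; lia.
Qed.

(** Treating v can only add the edge to its parent at the top of a climb: the parent is earlier in
    the queue and still untreated. *)
Lemma climbs_step u i x : climbs t u i x -> climbs t.+1 u i x \/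
  [/\ v != 0, lab p = lab v, x = p & exists2 j, i = j.+1 & climbs t.+1 u j v].
Proof.
move=> [Hu E Hj]; have [Hv Pv] := step_v Tr Ht; rewrite -/v in Hv Pv.
case: (boolP [exists j : 'I_i, iter j par u == v]) => [/existsP[j /eqP Ej]|N]; last first.
  left; split=> // j Hji; have [H1 H2 H3] := Hj _ Hji; split=> //.
  move: H1; rewrite (seenS Tr Ht) => /orP[/eqP Ev|//].
  by case/existsP: N; exists (Ordinal Hji); rewrite Ev.
right; have [H1 H2 H3] := Hj _ (ltn_ord j); rewrite iterS Ej in H1 H2 H3.
have Eij : i = j.+1.
  apply/eqP; rewrite eq_sym eqn_leq ltn_ord /= leqNgt; apply/negP=> Hji.
  have [] := Hj _ Hji; rewrite iterS Ej /seen => /andP[_ H4].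
  by have := tr_up Tr Hv H2; lia.
split=> //; first by rewrite -E Eij iterS Ej.
exists j => //; split=> // k Hk; have [|G1 G2 G3] := Hj k; first by lia.
split=> //; move: G1; rewrite (seenS Tr Ht) => /orP[/eqP Ek|//].
have := dep_iter k Hu; have := dep_iter j Hu; rewrite Ek Ej -/v => -[_ D1] [_ D2].
have : 0 < dep v by rewrite /dep (dist_gt0 Md) ?(tr_n Tr) // eq_sym.
lia.
Qed.

Lemma dp_skip : v = 0 \/ lab v != lab p -> dp_inv t H best.
Proof.
move=> Hv; have C u i x : climbs t u i x -> climbs t.+1 u i x.
  case/climbs_step=> // -[v0 E _ _].
  by case: Hv => [Hv|]; [rewrite Hv in v0 | rewrite E eqxx].
split.
- by move=> u i x /C; apply: (dp_height I).
- by move=> u i w j x /C H1 /C; apply: (dp_pair I) H1.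
- by move=> x /(dp_attained I)[u Hu]; exists u; apply: climbs_weaken.
- exact: dp_best I.
Qed.

Lemma dp_step H' best' : v != 0 -> lab v = lab p ->
  (forall x, H' x = if x == p then maxn (H p) (H v).+1 else H x) ->
  best' = maxn best (H p + (H v).+1) -> dp_inv t H' best'.
Proof.
move=> v0 E H'E ->; have [Hv Pv] := step_v Tr Ht; rewrite -/v in Hv Pv.
have Hp : p < n := tr_par Tr Hv.
have HH x : H x <= H' x by rewrite H'E; case: eqP => // ->; apply: leq_maxl.
have ext u j : climbs t.+1 u j v -> climbs t u j.+1 p.
  move=> [Hu Ej Hj]; split=> //; first by rewrite iterS Ej.
  move=> k; rewrite ltnS leq_eqVlt => /orP[/eqP->|/Hj[H1 H2 H3]].
    by rewrite iterS Ej; split=> //; rewrite (seenS Tr Ht) eqxx.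
  by split=> //; rewrite (seenS Tr Ht) H1 orbT.
have dle u i w j : climbs t.+1 u i p -> climbs t.+1 w j v -> d u w <= H p + (H v).+1.
  move=> C1 C2; have H1 := dp_height I C1; have H2 := dp_height I C2.
  have up z k : z < n -> d z (iter k par z) <= k.
    move=> Hz; elim: k => [|k IH]; first by rewrite (dist0 Md).
    have [Hk _] := dep_iter k Hz.
    case: (eqVneq (iter k par z) 0) => [E0|N0].
      by rewrite iterS E0 (tr_root Tr) -E0; lia.
    have Ek := tr_edge Tr Hk N0; rewrite (edge_sym (metric_graph Md)) in Ek.
    by apply: leq_trans (dist_edge Md Hz Ek) _.
  have [Hu Eu _] := C1; have [Hw Ew _] := ext _ _ C2.
  have := up _ i Hu; have := up _ j.+1 Hw; rewrite Eu Ew => D1 D2.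
  have := dist_tri Md Hu Hp Hw; rewrite (dist_sym Md Hp Hw); lia.
split.
- move=> u i x /climbs_step[/(dp_height I)|[_ _ -> [j -> /(dp_height I)]]] Hi.
    exact: leq_trans Hi (HH x).
  by rewrite H'E eqxx leq_max ltnS Hi orbT.
- move=> u i w j x /climbs_step[C1|[_ _ Ex [i' Ei C1]]]
    /climbs_step[C2|[_ _ Ex' [j' Ej C2]]]; rewrite leq_max.
  + by rewrite (dp_pair I C1 C2).
  + by rewrite Ex' in C1; rewrite (dle _ _ _ _ C1 C2) orbT.
  + rewrite Ex in C2; have [Hu _ _] := C1; have [Hw _ _] := C2.
    by rewrite (dist_sym Md Hu Hw) (dle _ _ _ _ C2 C1) orbT.
  + by rewrite (dp_pair I C1 C2).
- move=> x Hx; rewrite H'E; case: eqP => [->|_]; last first.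
    by have [u Hu] := dp_attained I Hx; exists u; apply: climbs_weaken.
  case: (leqP (H p) (H v).+1) => Hle.
    by have [u Hu] := dp_attained I Hv; exists u; apply: ext.
  by have [u Hu] := dp_attained I Hp; exists u; apply: climbs_weaken.
- rewrite geq_max (dp_best I) /=.
  have [u Cu] := dp_attained I Hp; have [w Cw] := dp_attained I Hv.
  have [Hu Eu Ju] := Cu; have [Hw Ew _] := Cw.
  apply: leq_trans (Hdmax Hu Hw).
  have [_ Dp] := dep_iter (H v) Hw; rewrite Ew in Dp.
  have Dv := tr_dep Tr Hv v0; rewrite -/dep -/p in Dv.
  (* If [H p] is 0, the candidate is the depth difference between p and a deepest vertex below v.
     Otherwise the climb realising [H p] enters p from another child, and [tree_distance]
     applies. *)
  case Ei: (H p) => [|i].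
    have Eup : u = p by rewrite -Eu Ei.
    by have := dist_dep Hp Hw; rewrite Eup; lia.
  have Hi : i < H p by rewrite Ei.
  have [J1 J2 J3] := Ju _ Hi.
  rewrite Ei iterS in Eu.
  apply: (tree_distance Hu Hw erefl Ew J2 v0) => //.
  by apply/eqP => Eyv; rewrite Eyv /seen Pv ltnn andbF in J1.
Qed.

End Step.

(** Every vertex climbs to the top of its class, which is unique, so two vertices of a class form a
    pair at that top. *)
Lemma dp_final H best : dp_inv 0 H best ->
  best <= dmax /\ forall u w, u < n -> w < n -> lab u = lab w -> d u w <= best.
Proof.
move=> I; split=> [|u w Hu Hw E]; first exact: dp_best I.
have top z : z < n -> exists i x, [/\ climbs 0 z i x, lab x = lab z, core x &
    x = 0 \/ lab x != lab (par x)].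
  have [k] := ubnP (dep z); elim: k z => // k IH z; rewrite ltnS => Hk Hz.
  case: (eqVneq z 0) => [z0|z0].
    by exists 0, z; split=> //; [rewrite z0; case: (lab_root Lb) | left].
  case: (eqVneq (lab z) (lab (par z))) => [Ez|Nz]; last first.
    exists 0, z; split=> //; last by right.
    by case: (boolP (core z)) => // /(lab_out Lb Hz)[_ Ez]; rewrite Ez eqxx in Nz.
  have [||i [x [[_ Ex Hj] Lx Cx Tx]]] := IH (par z); last first.
  + exists i.+1, x; split=> //; last by rewrite Lx.
    split=> //; first by rewrite iterSr.
    by case=> [_|j /Hj]; rewrite ?iterSr //; split=> //; apply: seen0.
  + exact: (tr_par Tr).
  + by have := tr_dep Tr Hz z0; rewrite -/dep => D; lia.
have [i [x [Cx Lx Kx Tx]]] := top _ Hu; have [j [y [Cy Ly Ky Ty]]] := top _ Hw.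
have Hx : x < n by have [Hz <- _] := Cx; case: (dep_iter i Hz).
have Hy : y < n by have [Hz <- _] := Cy; case: (dep_iter j Hz).
have root_top z : z < n -> core z -> lab z = 0 -> z = 0.
  move=> Hz Cz Lz; have := lab_dep Lb Hz Cz; rewrite Lz (dist0 Md) ?(tr_n Tr) //.
  by rewrite leqn0 => /eqP D0; have := dist_gt0 Md (tr_n Tr) Hz; rewrite D0; case: eqP.
suff Exy : x = y by rewrite Exy in Cx; apply: (dp_pair I) Cx Cy.
have Lxy : lab x = lab y by rewrite Lx Ly.
have [_ L0] := lab_root Lb.
case: (eqVneq x 0) => [x0|x0]; first by rewrite x0; rewrite x0 L0 in Lxy; rewrite (root_top y).
case: (eqVneq y 0) => [y0|y0]; first by rewrite y0; rewrite y0 L0 in Lxy; rewrite (root_top x).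
case: Tx => [Tx|Tx]; first by rewrite Tx in x0.
case: Ty => [Ty|Ty]; first by rewrite Ty in y0.
exact: (lab_top_inj Lb).
Qed.

End Classes.

(** * Labelling and pairs in the same class *)

Definition copy_tree :=
  for_up vI vN (aRP @[vI] ::= aPAR![vI];; aRQ @[vI] ::= aQ![vI]).

Definition mark_ends :=
  aMK @[#0] ::= #1;;
  for_up vI vM (
    vX ::= aDST![vI .+ vI .+ #2];; vY ::= aDST![vI .+ vI .+ #1];;
    If (eneq (aRP![vX]) vY)
      (If (eneq (aRP![vY]) vX) (aMK @[vX] ::= #1;; aMK @[vY] ::= #1) skip)
      skip).

(** [aCT![vX] .- #1] is nonzero for at least two core children. With exactly one, [aLB] at [vX]
    already holds the label written by that child. *)
Definition label_up :=
  for_down vI vN (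
    vX ::= aRQ![vI];; vY ::= aRP![vX];;
    If (aMK![vX]) (aLB @[vX] ::= vX .+ #1)
      (If (aCT![vX] .- #1) (aLB @[vX] ::= vX .+ #1) skip);;
    vK ::= aLB![vX];;
    If vX
      (If vK
         (aANC @[vK .- #1] ::= vY;; aCT @[vY] ::= aCT![vY] .+ #1;;
          aLB @[vY] ::= vK)
         skip)
      skip).

Definition label_down :=
  for_up vI vN (
    vX ::= aRQ![vI];;
    If (aLB![vX]) skip (aLB @[vX] ::= aLB![aRP![vX]])).

Notation vBEST := 0 (only parsing).

Definition maximize (x : nat) (ex : exp) := If (ex .- x) (x ::= ex) skip.

(** The candidate at [vY] pairs the new branch with the height before its update, that is, with the
    branches treated earlier. *)
Definition heights :=
  for_down vI vN (
    vX ::= aRQ![vI];; vY ::= aRP![vX];;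
    If vX
      (If (eneq (aLB![vX]) (aLB![vY])) skip
         (vK ::= aH![vX] .+ #1;;
          maximize vBEST (aH![vY] .+ vK);;
          If (vK .- aH![vY]) (aH @[vY] ::= vK) skip))
      skip).

Section Phases.
Variables (raw : nat -> nat) (B n : nat).

Lemma copy_tree_ok s : vr s vN = n ->
  wp raw B copy_tree (fun s' => (forall i, i < n ->
     ar s' aRP i = ar s aPAR i /\ ar s' aRQ i = ar s aQ i) /\
     clock s' <= clock s + 2 + 4 * n) s.
Proof.
move=> Hn.
pose I i s' := (forall j, j < i ->
     ar s' aRP j = ar s aPAR j /\ ar s' aRQ j = ar s aQ j) /\
     clock s' <= clock s + 1 + 4 * i.
apply: (wp_for_up (N := n) (I := I)) => //.
- by move=> s' [Fv _] /=; rewrite Fv.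
- by split=> //=; lia.
- move=> i s' Hi [Fv Fa] Vi [H1 H2]; wgo; rewrite Vi; split=> /=; last by lia.
  move=> j; rewrite ltnS leq_eqVlt => /orP[/eqP->|Hj].
    by rewrite eqxx !Fa.
  by have [<- <-] := H1 _ Hj; rewrite !ifF //; lia.
- by move=> s' _ [H1 H2]; split=> //=; lia.
Qed.

Definition nontree (par : nat -> nat) (p : nat * nat) :=
  (par p.1 != p.2) && (par p.2 != p.1).

Lemma sum_mark (f : nat -> nat) a :
  \sum_(v < n) (updf f a 1 v != 0) <= (\sum_(v < n) (f v != 0)).+1.
Proof.
have H k : \sum_(v < k) (updf f a 1 v != 0) <= \sum_(v < k) (f v != 0) + (a < k).
  elim: k => [|k IH]; first by rewrite !big_ord0.
  rewrite !big_ord_recr /=; case: (eqVneq k a) => [E|N].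
    rewrite -E updf_eq ltnSn in IH *; rewrite ltnn addn0 in IH.
    rewrite -addnA; apply: leq_add IH _; by rewrite addn1.
  rewrite updf_ne //; have -> : (a < k.+1) = (a < k) by lia.
  by rewrite addnAC leq_add2r.
have := H n; case: (a < n); lia.
Qed.

(** The bound counts the root and both ends of every non-tree edge. *)
Lemma mark_ends_ok s el : vr s vM = size el -> 0 < n ->
  (forall p, p \in el -> [/\ p.1 < n, p.2 < n & p.1 != p.2]) ->
  (forall i, ar s aMK i = 0) ->
  (forall i, i < size el -> ar s aDST (2 * i + 1) = (nth (0, 0) el i).2 /\
                            ar s aDST (2 * i + 2) = (nth (0, 0) el i).1) ->
  let par := ar s aRP in
  wp raw B mark_ends (fun s' => let mk v := ar s' aMK v != 0 in
    [/\ mk 0, forall v, mk v -> v < n,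
      forall x y, erel el x y -> [\/ par x = y, par y = x | mk x && mk y],
      \sum_(v < n) mk v <= 1 + 2 * count (nontree par) el &
      clock s' <= clock s + 3 + 8 * size el]) s.
Proof.
move=> Hm n0 Hel H0 Hd par; rewrite /mark_ends; wgo.
set s0 := seta _ _ _ _.
pose I i s' := [/\ ar s' aMK 0 != 0, forall v, ar s' aMK v != 0 -> v < n,
  forall p, p \in take i el -> [\/ par p.1 = p.2, par p.2 = p.1 |
     (ar s' aMK p.1 != 0) && (ar s' aMK p.2 != 0)],
  \sum_(v < n) (ar s' aMK v != 0) <= 1 + 2 * count (nontree par) (take i el) &
  clock s' <= clock s + 2 + 8 * i].
apply: (wp_for_up (N := size el) (I := I)) => //.
- by move=> s' [Fv _] /=; rewrite Fv.
- rewrite /I take0 /=; split=> //.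
  + by move=> v; case: (v =P 0) => [->|_]; rewrite ?H0.
  + apply: leq_trans (sum_mark (ar s aMK) 0) _.
    by rewrite big1 // => i _; rewrite H0.
  + by lia.
- move=> i s' Hi [Fv Fa] Vi [I1 I2 I3 I4 I5].
  have [D1 D2] := Hd _ Hi; set p := nth (0, 0) el i in D1 D2.
  have Fd : ar s' aDST = ar s aDST by rewrite Fa.
  have Fp : ar s' aRP = par by rewrite Fa.
  have pel : p \in el by rewrite mem_nth.
  have [p1 p2 p3] := Hel _ pel.
  have tk : take i.+1 el = rcons (take i el) p by rewrite (take_nth (0, 0)).
  wgo; rewrite Vi Fd.
  have -> : i + i + 2 = 2 * i + 2 by lia.
  have -> : i + i + 1 = 2 * i + 1 by lia.
  rewrite D1 D2.
  have step1 : par p.1 = p.2 \/ par p.2 = p.1 -> forall s1, ar s1 aMK = ar s' aMK ->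
      clock s1 <= clock s' + 7 -> I i.+1 (setv s1 vI i.+1).
    move=> Hp s1 E1 E2; rewrite /I /= E1 tk -cats1 count_cat; split=> //.
    + move=> x; rewrite mem_cat inE => /orP[/I3//|/eqP->].
      by case: Hp; [constructor 1 | constructor 2].
    + by apply: leq_trans I4 _; lia.
    + by lia.
  apply: wp_if => /= C1; last first.
    by apply: wp_asg; apply: step1 => //=; [left; rewrite -Fp; lia | lia].
  apply: wp_if => /= C2; last first.
    by apply: wp_asg; apply: step1 => //=; [right; rewrite -Fp; lia | lia].
  wgo; rewrite /I /= tk -cats1 count_cat; split=> //.
  + by case: (0 =P p.2) => // _; case: (0 =P p.1).
  + by move=> v; case: (v =P p.2) => [-> //|_]; case: (v =P p.1) => [-> //|_]; apply: I2.
  + move=> x; rewrite mem_cat inE => /orP[/I3[]|/eqP->].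
    * by constructor 1.
    * by constructor 2.
    * move=> /andP[X1 X2]; constructor 3.
      apply/andP; split.
        by case: (x.1 =P p.2) => // _; case: (x.1 =P p.1).
      by case: (x.2 =P p.2) => // _; case: (x.2 =P p.1).
    * by constructor 3; rewrite !eqxx; case: (p.1 =P p.2).
  + apply: leq_trans (sum_mark (updf (ar s' aMK) p.1 1) p.2) _.
    have := sum_mark (ar s' aMK) p.1.
    have -> : count (nontree par) [:: p] = 1.
      rewrite /= /nontree; move: C1 C2; rewrite Fp => C1 C2.
      by case: eqP => [E|_]; [|case: eqP => [E|_//]]; rewrite E in C1 C2; lia.
    by lia.
  + by lia.
- move=> s' _ [I1 I2 I3 I4 I5]; rewrite take_size in I3 I4.
  split=> //; last by apply: leq_ltn_trans I5 _; rewrite ltn_add2r ltn_add2l.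
  move=> x y /orP[/I3//|/I3[H|H|H]]; [by constructor 2|by constructor 1|].
  by constructor 3; rewrite andbC.
Qed.

Section Tree.
Variables (e : rel nat) (d : nat -> nat -> nat) (par q pos : nat -> nat).
Hypotheses (Md : metric n e d) (Tr : bfs_tree n e d par q pos).

Lemma label_up_ok s : vr s vN = n -> ar s aRP = par -> ar s aRQ = q ->
  (forall i, [/\ ar s aLB i = 0, ar s aCT i = 0 & ar s aANC i = 0]) ->
  let mk v := ar s aMK v != 0 in mk 0 ->
  wp raw B label_up (fun s' =>
    up_inv n d par q pos mk 0 (ar s' aLB) (ar s' aCT) (ar s' aANC) /\
    clock s' <= clock s + 2 + 14 * n) s.
Proof.
move=> Hn Hp Hq H0 mk M0.
pose I i s' := up_inv n d par q pos mk i (ar s' aLB) (ar s' aCT) (ar s' aANC) /\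
    clock s' <= clock s + 1 + 14 * (n - i).
apply: (wp_for_down (N := n) (I := I)) => //.
- split=> /=; last by lia.
  exact: (up_init mk Tr H0).
- move=> i s' Hi [Fv Fa] Vi [U T].
  have Fp : ar s' aRP = par by rewrite Fa.
  have Fq : ar s' aRQ = q by rewrite Fa.
  have Fm : ar s' aMK = ar s aMK by rewrite Fa.
  wgo; rewrite Fq Fp; set v := q i; set p := par v.
  have [Hv Pv] := step_v Tr Hi; rewrite -/v in Hv Pv.
  have Cv0 := up_cnt U (x := v); rewrite Pv ltnSn Hv in Cv0; have {}Cv0 := Cv0 isT isT.
  (* Common tail of all cases in which v belongs to the core; k is the label it has been given. *)
  have main k s1 : clock s1 <= clock s' + 7 -> vr s1 vX = v -> vr s1 vY = p ->
      ar s1 aCT = ar s' aCT -> ar s1 aANC = ar s' aANC ->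
      (forall x, ar s1 aLB x = if x == v then k else ar s' aLB x) ->
      (k = v.+1 /\ (mk v \/ 1 < ar s' aCT v)) \/
        [/\ k = ar s' aLB v, ~~ mk v & ar s' aCT v = 1] ->
      k != 0 ->
      wp raw B (vK ::= aLB![vX];;
        If vX (If vK (aANC @[vK .- #1] ::= vY;; aCT @[vY] ::= aCT![vY] .+ #1;;
          aLB @[vY] ::= vK) skip) skip) (I i) s1.
    move=> T1 X1 Y1 C1 A1 L1 Hk k0; wgo; rewrite X1 L1 eqxx; apply: wp_if => /= Hv0.
      apply: wp_if => /= Hk0; last by rewrite Hk0 in k0.
      wgo; rewrite Y1; split=> /=; last by lia.
      rewrite C1 A1 addn1 subn1; apply: (up_step Tr Hi U _ k0 Hk).
        by rewrite -/v; move: Hv0; rewrite X1; case: (v).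
      by move=> x; rewrite L1; case: (x == p).
    have v0 : v = 0 by rewrite -X1.
    wgo; split=> /=; last by lia.
    rewrite C1 A1; apply: (up_root Tr Hi U v0) => // x; rewrite L1 v0.
    case: Hk => [[-> _]|[_]]; first by rewrite v0.
    by rewrite v0 M0.
  apply: wp_if => /= Mv.
    apply: wp_put => /=; apply: (main v.+1) => //=.
    + by lia.
    + by move=> x; rewrite addn1.
    + by left; split=> //; left; rewrite /mk -Fm; apply/eqP.
  have nMv : ~~ mk v by rewrite /mk -Fm Mv.
  apply: wp_if => /= Cv.
    apply: wp_put => /=; apply: (main v.+1) => //=.
    + by lia.
    + by move=> x; rewrite addn1.
    + by left; split=> //; right; lia.
  apply: wp_asg; case: (eqVneq (ar s' aCT v) 0) => [C0|C0].
    have L0 : ar s' aLB v = 0 by apply/eqP; rewrite Cv0 C0.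
    have fin s1 : ar s1 aLB = ar s' aLB -> ar s1 aCT = ar s' aCT ->
      ar s1 aANC = ar s' aANC -> clock s1 <= clock s' + 12 -> I i s1.
      move=> E1 E2 E3 Hc; split; last by lia.
      rewrite E1 E2 E3; exact: (up_skip Tr Hi U).
    wgo; apply: wp_if => /= _; last by apply: wp_asg; apply: fin => //=; lia.
    apply: wp_if => /=; first by rewrite L0.
    by move=> _; apply: wp_asg; apply: fin => //=; lia.
  apply: (main (ar s' aLB v)) => //=.
  + by lia.
  + by move=> x; case: eqP => [->|].
  + by right; split=> //; lia.
  + by rewrite Cv0.
- by move=> s' _ [U T]; split=> //=; lia.
Qed.

(** Parents precede children in the queue, so the label read from a parent is already final. *)
Lemma label_down_ok s : vr s vN = n -> ar s aRP = par -> ar s aRQ = q ->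
  ar s aLB 0 <> 0 ->
  wp raw B label_down (fun s' =>
    (forall v, v < n -> ar s' aLB v =
       if ar s aLB v != 0 then ar s aLB v else ar s' aLB (par v)) /\
    clock s' <= clock s + 2 + 5 * n) s.
Proof.
move=> Hn Hp Hq L0.
pose I i s' := [/\ forall v, v < n -> pos v < i -> ar s' aLB v =
       if ar s aLB v != 0 then ar s aLB v else ar s' aLB (par v),
    forall v, v < n -> i <= pos v -> ar s' aLB v = ar s aLB v &
    clock s' <= clock s + 1 + 5 * i].
apply: (wp_for_up (N := n) (I := I)) => //.
- by move=> s' [Fv _] /=; rewrite Fv.
- by split=> //=; lia.
- move=> i s' Hi [Fv Fa] Vi [I1 I2 T].
  have Fp : ar s' aRP = par by rewrite Fa.
  have Fq : ar s' aRQ = q by rewrite Fa.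
  have [Hv Pv] := step_v Tr Hi; set v := q i in Hv Pv.
  have Lv : ar s' aLB v = ar s aLB v by rewrite I2 // Pv.
  have only x : x < n -> pos x < i.+1 -> x = v \/ pos x < i.
    move=> Hx; rewrite ltnS leq_eqVlt => /orP[/eqP E|]; last by right.
    by left; rewrite /v -E (tr_qpos Tr).
  wgo; rewrite Vi Fq -/v; apply: wp_if => /= Hl.
    wgo; split=> /=; last by lia.
      move=> x Hx /(only _ Hx)[->|]; last exact: I1.
      by rewrite Lv ifT //; apply/eqP; rewrite -Lv.
    by move=> x Hx Hix; apply: I2 => //; lia.
  have v0 : v != 0.
    by apply/eqP=> E; move: Lv; rewrite Hl E => /esym/L0.
  have Nv x : x < n -> pos x != i -> (x == v) = false.
    by move=> Hx; apply: contraNF => /eqP->; rewrite Pv.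
  wgo; rewrite Fp; split=> /=; last by lia.
    move=> x Hx /(only _ Hx)[->|Hxi].
      rewrite eqxx -Lv Hl /= ifF //; apply: Nv; first exact: (tr_par Tr).
      by have := tr_up Tr Hv v0; lia.
    rewrite Nv //; last by lia.
    rewrite I1 //; case: eqP => //= Lx; rewrite ifF //.
    apply: Nv; first exact: (tr_par Tr).
    case: (eqVneq x 0) => [E|x0]; first by rewrite E in Lx.
    by have := tr_up Tr Hx x0; lia.
  by move=> x Hx Hix; rewrite Nv ?I2 //; lia.
- move=> s' _ [I1 I2 T]; split=> /=; last by lia.
  by move=> v Hv; apply: I1 => //; apply: (tr_pos Tr).
Qed.

Lemma heights_ok s core lab anc dmax : vr s vN = n -> ar s aRP = par -> ar s aRQ = q ->
  labelling n e d par core lab anc ->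
  (forall v, v < n -> ar s aLB v = (lab v).+1) ->
  (forall i, ar s aH i = 0) -> vr s vBEST = 0 ->
  (forall u w, u < n -> w < n -> d u w <= dmax) ->
  wp raw B heights (fun s' =>
    [/\ vr s' vBEST <= dmax,
        forall u w, u < n -> w < n -> lab u = lab w -> d u w <= vr s' vBEST &
        clock s' <= clock s + 2 + 12 * n]) s.
Proof.
move=> Hn Hp Hq Lb HL H0 B0 Hd.
pose I i s' := dp_inv n d par pos lab dmax i (ar s' aH) (vr s' vBEST) /\
  clock s' <= clock s + 1 + 12 * (n - i).
apply: (wp_for_down (N := n) (I := I)) => //.
- by split=> /=; [rewrite B0; apply: (dp_init lab Md Tr dmax H0) | lia].
- move=> i s' Hi [Fv Fa] Vi [D T].
  have Fp : ar s' aRP = par by rewrite Fa.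
  have Fq : ar s' aRQ = q by rewrite Fa.
  have Fl : ar s' aLB = ar s aLB by rewrite Fa.
  have [Hv Pv] := step_v Tr Hi.
  have Hpv := tr_par Tr Hv.
  wgo; rewrite Fq Fp; set v := q i in Hv Pv Hpv *; set p := par v in Hpv *.
  apply: wp_if => /= Hv0; last first.
    apply: wp_asg; split=> /=; last by lia.
    by apply: (dp_skip Md Tr Hi D); left.
  apply: wp_if => /=; rewrite Fl !HL // => El.
    apply: wp_asg; split=> /=; last by lia.
    by apply: (dp_skip Md Tr Hi D); right; apply/eqP=> E; have {}E : lab v = lab p := E; apply: El; lia.
  have {}El : lab v = lab p by lia.
  have v0 : v != 0 by apply/eqP.
  wgo; rewrite /maximize.
  have fin s1 : clock s1 <= clock s' + 12 ->
     (forall x, ar s1 aH x = if x == p then maxn (ar s' aH p) (ar s' aH v).+1 else ar s' aH x) ->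
     vr s1 vBEST = maxn (vr s' vBEST) (ar s' aH p + (ar s' aH v).+1) -> I i s1.
    move=> T1 H1 B1; split; last by lia.
    by apply: (dp_step Md Tr Lb Hd Hi D v0 El) => //.
  apply: wp_if => /= Hb.
  + wgo; apply: wp_if => /= Hh; [wgo|wgo]; apply: fin => /=; try lia.
    * by move=> x; case: eqP => // _; lia.
    * by move=> x; case: eqP => // ->; lia.
  + wgo; apply: wp_if => /= Hh; [wgo|wgo]; apply: fin => /=; try lia.
    * by move=> x; case: eqP => // _; lia.
    * by move=> x; case: eqP => // ->; lia.
- move=> s' _ [D T]; have [H1 H2] := dp_final Md Tr Lb D.
  by split=> //=; lia.
Qed.

End Tree.
End Phases.

(** * Pairs in different classes *)

(* With D_x and D_y the distances from the two attachment vertices x, y of a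
   class, a shortest path from u inside to w outside may be taken through x
   iff D_x w - D_y w <= D_y u - D_x u. The array [aBK] holds, for each value
   of the left-hand side (shifted by n), the largest D_x w over the outside
   vertices w with at most this value. *)
Definition clear_buckets := for_up vI (vN .+ vN .+ #1) (aBK @[vI] ::= #0).

Definition fill_buckets (X Y : nat) :=
  for_up vI vN (
    If (eneq (aLB![vI]) (vS .+ #1))
      (vK ::= vN .+ X![vI] .- Y![vI];;
       If (X![vI] .- aBK![vK]) (aBK @[vK] ::= X![vI]) skip)
      skip).

Definition prefix_max :=
  for_up vI (vN .+ vN) (
    If (aBK![vI] .- aBK![vI .+ #1]) (aBK @[vI .+ #1] ::= aBK![vI]) skip).

(** Stored distances lie in 1 .. n, so the shifted index is never truncated, and [.- #2] removes the
    increments of both summands. *)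
Definition query_buckets (X Y : nat) :=
  for_up vI vN (
    If (eneq (aLB![vI]) (vS .+ #1)) skip
      (maximize vBEST (X![vI] .+ aBK![vN .+ Y![vI] .- X![vI]] .- #2))).

Definition through X Y :=
  clear_buckets;; fill_buckets X Y;; prefix_max;; query_buckets X Y.

(** The second search moves the result of the first to [aD2]. The two calls of [through] treat the
    detours by the anchor and by its [anc], a tie being tried in both. *)
Definition main_loop :=
  for_up vS vN (
    If (eneq (aLB![vS]) (vS .+ #1)) skip
      (vSRC ::= vS;; bfs;; vSRC ::= aANC![vS];; bfs;;
       through aD2 aD1;; through aD1 aD2)).

Section Through.
Variables (raw : nat -> nat) (B n s0 dmax : nat) (lab : nat -> nat).

(** An entry found at index [qk u] comes from some w with [key w <= qk u], which is the comparison
    of the two detours; so soundness of the detour is required only for pairs passing it. *)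
Lemma through_ok X Y s : Nat.eqb X aBK = false -> Nat.eqb Y aBK = false ->
  vr s vN = n -> vr s vS = s0 ->
  (forall v, v < n -> ar s aLB v = (lab v).+1) ->
  (forall v, v < n -> 0 < ar s X v <= n /\ 0 < ar s Y v <= n) ->
  (forall v, v < n -> (ar s X v).-1 <= dmax) ->
  (forall u w, u < n -> w < n -> lab u = s0 -> lab w != s0 ->
     ar s X w + ar s X u <= ar s Y u + ar s Y w -> ar s X u + ar s X w - 2 <= dmax) ->
  vr s vBEST <= dmax ->
  wp raw B (through X Y) (fun s' =>
    [/\ vr s vBEST <= vr s' vBEST <= dmax,
     forall u w, u < n -> w < n -> lab u = s0 -> lab w != s0 ->
       ar s X w + ar s X u <= ar s Y u + ar s Y w -> ar s X u + ar s X w - 2 <= vr s' vBEST &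
     clock s' <= clock s + 11 + 25 * n]) s.
Proof.
move=> HX HY Hn Hs HL Hb Hd Hc Hbest; rewrite /through.
pose F := ar s X; pose G := ar s Y.
pose key w := n + F w - G w.
have key_le w : w < n -> key w <= 2 * n by move=> /Hb; rewrite /key -/F -/G; lia.
apply: wp_seq; apply: wp_frame.
pose I1 i s' := (forall t, t < i -> ar s' aBK t = 0) /\ clock s' <= clock s + 1 + 3 * i.
apply: (wp_for_up (N := 2 * n + 1) (I := I1)) => //.
- by move=> s' [Fv _] /=; rewrite Fv // Hn; lia.
- by split=> //=; lia.
- move=> i s' Hi _ Vi [H1 H2]; wgo; rewrite Vi; split=> /=; last by lia.
  by move=> t; rewrite ltnS leq_eqVlt; case: eqP => //= _ /H1.
move=> s1 _ [Z1 T1] [Fv1 Fa1]; apply: wp_seq; apply: wp_frame.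
have N1 : vr (tick s1) vN = n by rewrite Fv1.
have X1 : ar (tick s1) X = F by rewrite Fa1 //= HX.
have Y1 : ar (tick s1) Y = G by rewrite Fa1 //= HY.
have L1 : ar (tick s1) aLB = ar s aLB by rewrite Fa1.
have S1 : vr (tick s1) vS = s0 by rewrite Fv1.
have B1 : vr (tick s1) vBEST = vr s vBEST by rewrite Fv1.
have {}T1 : clock (tick s1) <= clock s + 5 + 6 * n by rewrite /=; lia.
have {}Z1 t : t <= 2 * n -> ar (tick s1) aBK t = 0 by move=> Ht; apply: Z1; lia.
move: (tick s1) N1 X1 Y1 L1 S1 B1 T1 Z1 {Fv1 Fa1} => {}s1 N1 X1 Y1 L1 S1 B1 T1 Z1.
pose I2 i s' := [/\ forall w, w < i -> lab w != s0 -> F w <= ar s' aBK (key w),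
  forall t, t <= 2 * n -> ar s' aBK t = 0 \/
    exists w, [/\ w < n, lab w != s0, key w = t & ar s' aBK t = F w] &
  clock s' <= clock s1 + 1 + 6 * i].
apply: (wp_for_up (N := n) (I := I2)) => //.
- by move=> s' [Fv _] /=; rewrite Fv.
- split=> //=; last by lia.
  by move=> t Ht; left; rewrite Z1.
- move=> i s' Hi [Fv Fa] Vi [H1 H2 H3].
  have X2 : ar s' X = F by rewrite Fa //= HX.
  have Y2 : ar s' Y = G by rewrite Fa //= HY.
  have L2 : ar s' aLB = ar s aLB by rewrite Fa.
  have N2 : vr s' vN = n by rewrite Fv.
  have S2 : vr s' vS = s0 by rewrite Fv.
  apply: wp_if; rewrite /= Vi L2 S2 HL // => El; last first.
    wgo; split=> //=; last by lia.
    by move=> w; rewrite ltnS leq_eqVlt => /orP[/eqP->|]; [lia | apply: H1].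
  have {}El : lab i != s0 by apply/eqP=> E; apply: El; rewrite E; lia.
  wgo; rewrite N2 Vi X2 Y2; apply: wp_if; rewrite /= Vi X2 => Hb2.
    wgo; rewrite Vi X2; split=> /=; last by lia.
      move=> w; rewrite ltnS leq_eqVlt => /orP[/eqP->|Hw] Nw; first by rewrite eqxx.
      by have := H1 _ Hw Nw; case: eqP => // E; rewrite E; lia.
    move=> t Ht; case: eqP => [->|_]; last exact: H2.
    by right; exists i.
  wgo; split=> //=; last by lia.
  move=> w; rewrite ltnS leq_eqVlt => /orP[/eqP-> _|Hw]; last exact: H1.
  by rewrite /key; lia.
move=> s2 _ [A2 C2 T2] [Fv2 Fa2]; apply: wp_seq; apply: wp_frame.
have X2 : ar (tick s2) X = F by rewrite Fa2 //= HX.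
have Y2 : ar (tick s2) Y = G by rewrite Fa2 //= HY.
have L2 : ar (tick s2) aLB = ar s aLB by rewrite Fa2.
have N2 : vr (tick s2) vN = n by rewrite Fv2.
have S2 : vr (tick s2) vS = s0 by rewrite Fv2.
have B2 : vr (tick s2) vBEST = vr s vBEST by rewrite Fv2.
have {}T2 : clock (tick s2) <= clock s + 7 + 12 * n by rewrite /=; lia.
change (ar s2) with (ar (tick s2)) in A2, C2.
move: (tick s2) N2 X2 Y2 L2 S2 B2 T2 A2 C2 {Fv2 Fa2} => {}s2 N2 X2 Y2 L2 S2 B2 T2 A2 C2.
(* Up to index i the prefix maxima are complete; beyond it a bucket is only known to cover its own
   keys. *)
pose I3 i s' := [/\ forall w t, w < n -> lab w != s0 -> t <= 2 * n -> key w <= t ->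
    (t <= i) || (key w == t) -> F w <= ar s' aBK t,
  forall t, t <= 2 * n -> ar s' aBK t = 0 \/
    exists w, [/\ w < n, lab w != s0, key w <= t & ar s' aBK t = F w] &
  clock s' <= clock s2 + 1 + 4 * i].
apply: (wp_for_up (N := 2 * n) (I := I3)) => //.
- by move=> s' [Fv _] /=; rewrite Fv // N2; lia.
- split=> //=; last by lia.
    move=> w t Hw Nw Ht Hk Hor; have Ek : key w = t by move: Hor; lia.
    by rewrite -Ek; apply: A2.
  by move=> t /C2[|[w [? ? Ek ?]]]; [left | right; exists w; split=> //; rewrite Ek].
- move=> i s' Hi [Fv Fa] Vi [H1 H2 H3]; apply: wp_if; rewrite /= Vi => Hb2.
    wgo; rewrite Vi addn1; split=> /=; last by lia.
      move=> w t Hw Nw Ht Hk Hor; case: eqP => Et; last by apply: H1 => //; lia.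
      case: (eqVneq (key w) t) => Ek.
        have := H1 w t Hw Nw Ht Hk; rewrite Ek eqxx orbT => /(_ isT).
        by move: Hb2; rewrite addn1 -Et; lia.
      by apply: H1 => //; lia.
    move=> t Ht; case: eqP => [->|_]; last exact: H2.
    have [|E|[w [? ? ? ?]]] := H2 i; [lia | by left | right].
    by exists w; split=> //; lia.
  wgo; split=> //=; last by lia.
  move=> w t Hw Nw Ht Hk Hor; case: (eqVneq t i.+1) => Et; last by apply: H1 => //; lia.
  case: (eqVneq (key w) t) => Ek; first by apply: H1 => //; rewrite Ek eqxx orbT.
  have := H1 w i Hw Nw; rewrite leqnn /= => H4.
  move: Hb2; rewrite addn1 -Et => Hb2; apply: leq_trans (H4 _ _ isT) _; lia.
move=> s3 _ [A3 C3 T3] [Fv3 Fa3]; apply: wp_frame.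
have X3 : ar (tick s3) X = F by rewrite Fa3 //= HX.
have Y3 : ar (tick s3) Y = G by rewrite Fa3 //= HY.
have L3 : ar (tick s3) aLB = ar s aLB by rewrite Fa3.
have N3 : vr (tick s3) vN = n by rewrite Fv3.
have S3 : vr (tick s3) vS = s0 by rewrite Fv3.
have B3 : vr (tick s3) vBEST = vr s vBEST by rewrite Fv3.
have {}T3 : clock (tick s3) <= clock s + 9 + 20 * n by rewrite /=; lia.
change (ar s3) with (ar (tick s3)) in A3, C3.
move: (tick s3) N3 X3 Y3 L3 S3 B3 T3 A3 C3 {Fv3 Fa3} => {}s3 N3 X3 Y3 L3 S3 B3 T3 A3 C3.
pose BK := ar s3 aBK; pose qk u := n + G u - F u.
have qk_le u : u < n -> qk u <= 2 * n by move=> /Hb; rewrite /qk -/F -/G; lia.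
pose I4 i s' := [/\ vr s vBEST <= vr s' vBEST <= dmax,
  forall u, u < i -> lab u = s0 -> F u + BK (qk u) - 2 <= vr s' vBEST &
  clock s' <= clock s3 + 1 + 5 * i].
apply: (wp_for_up (N := n) (I := I4)) => //.
- by move=> s' [Fv _] /=; rewrite Fv.
- by split=> //=; [rewrite B3 leqnn | lia].
- move=> i s' Hi [Fv Fa] Vi [H1 H2 H3].
  have X4 : ar s' X = F by rewrite Fa //= HX.
  have Y4 : ar s' Y = G by rewrite Fa //= HY.
  have L4 : ar s' aLB = ar s aLB by rewrite Fa.
  have N4 : vr s' vN = n by rewrite Fv.
  have S4 : vr s' vS = s0 by rewrite Fv.
  have BK4 : ar s' aBK = BK by rewrite Fa.
  apply: wp_if; rewrite /= Vi L4 S4 HL // => El.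
    wgo; split=> //=; last by lia.
    move=> u; rewrite ltnS leq_eqVlt => /orP[/eqP->|]; last exact: H2.
    by move=> E; case: El; rewrite E; lia.
  have {}El : lab i = s0 by lia.
  rewrite /maximize; apply: wp_if; rewrite /= Vi N4 X4 Y4 BK4 -/(qk i) => Hgt.
    wgo; rewrite Vi N4 X4 Y4 BK4 -/(qk i); split=> /=; last by lia.
      apply/andP; split; first by lia.
      (* An empty prefix yields 0; the candidate is then at most [(F i).-1], which [dmax] bounds. *)
      case: (C3 (qk i) (qk_le _ Hi)) => [E|[w [Hw Nw Kw E]]]; rewrite /BK E.
        by have := Hd _ Hi; rewrite -/F; lia.
      apply: Hc => //; rewrite -/F -/G; move: Kw; rewrite /key /qk.
      by have := Hb _ Hi; have := Hb _ Hw; rewrite -/F -/G; lia.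
    move=> u; rewrite ltnS leq_eqVlt => /orP[/eqP-> //|Hu Lu].
    by have := H2 _ Hu Lu; lia.
  wgo; split=> //=; last by lia.
  move=> u; rewrite ltnS leq_eqVlt => /orP[/eqP-> _|]; last exact: H2.
  by lia.
move=> s4 _ [H1 H2 H3] _; split=> //=; last by lia.
move=> u w Hu Hw Lu Nw Hk; apply: leq_trans (H2 _ Hu Lu).
have : F w <= BK (qk u).
  apply: A3 => //; first exact: qk_le.
    by rewrite /key /qk; move: Hk; have := Hb _ Hu; have := Hb _ Hw; rewrite -/F -/G; lia.
  by rewrite qk_le.
rewrite -/F; lia.
Qed.

End Through.

Section Main.
Variables (raw : nat -> nat) (B n M : nat).
Variables (e : rel nat) (d : nat -> nat -> nat) (par q pos : nat -> nat).
Variables (core : pred nat) (lab anc : nat -> nat) (dmax : nat).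
Hypotheses (Md : metric n e d) (Tr : bfs_tree n e d par q pos).
Hypothesis (Lb : labelling n e d par core lab anc).
Hypothesis Hdmax : forall u w, u < n -> w < n -> d u w <= dmax.

(** Two searches and two bucket passes, at the bounds of [bfs_ok] and [through_ok], and 10 for the
    commands around them. *)
Definition class_cost := 2 * (8 + 9 * n + 8 * M) + 2 * (11 + 25 * n) + 10.

Lemma main_loop_ok s : vr s vN = n ->
  adj_lists n M e (ar s aHD) (ar s aNX) (ar s aDST) ->
  (forall v, v < n -> ar s aLB v = (lab v).+1) -> ar s aANC = anc ->
  vr s vBEST <= dmax ->
  (forall u w, u < n -> w < n -> lab u = lab w -> d u w <= vr s vBEST) ->
  wp raw B main_loop (fun s' =>
    [/\ vr s' vBEST <= dmax,
        forall u w, u < n -> w < n -> d u w <= vr s' vBEST &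
        clock s' <= clock s + 2 + 4 * n + class_cost * \sum_(v < n) (lab v == v)]) s.
Proof.
move=> Hn Ha HL HA Hb Hin.
pose I i s' := [/\ vr s' vBEST <= dmax,
  forall u w, u < n -> w < n -> lab u = lab w \/ lab u < i -> d u w <= vr s' vBEST &
  clock s' <= clock s + 1 + 4 * i + class_cost * \sum_(v < i) (lab v == v)].
apply: (wp_for_up (N := n) (I := I)) => //.
- by move=> s' [Fv _] /=; rewrite Fv.
- split=> //=; last by rewrite big_ord0; lia.
  by move=> u w Hu Hw []//; apply: Hin.
- move=> i s' Hi [Fv Fa] Vi [H1 H2 H3].
  have Ln : ar s' aLB = ar s aLB by rewrite Fa.
  have E0 : ar s' aHD = ar s aHD by rewrite Fa.
  have E1 : ar s' aNX = ar s aNX by rewrite Fa.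
  have E2 : ar s' aDST = ar s aDST by rewrite Fa.
  have An : ar s' aANC = anc by rewrite Fa.
  have Nn : vr s' vN = n by rewrite Fv.
  apply: wp_if; rewrite /= Vi Ln HL // => El.
    have {}El : lab i != i by apply/eqP=> E; apply: El; lia.
    wgo; split=> //=; last first.
      by rewrite big_ord_recr /= (negPf El) addn0; move: H3; set S := \sum_(_ < _) _; lia.
    move=> u w Hu Hw [E|]; first by apply: H2 => //; left.
    rewrite ltnS leq_eqVlt => /orP[/eqP Eu|Hlt]; last by apply: H2 => //; right.
    by have [_ Eu2 _] := lab_idem Lb Hu; rewrite Eu in Eu2; rewrite Eu2 eqxx in El.
  have {}El : lab i = i by lia.
  have Ha' : anc i < n := anc_bound Lb i.
  wgo; rewrite Vi; apply: wp_frame.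
  set s1 := setv _ vSRC i.
  have A1 : adj_lists n M e (ar s1 aHD) (ar s1 aNX) (ar s1 aDST).
    by rewrite /s1 /= E0 E1 E2.
  apply: wp_mono (bfs_ok raw B Md (s := s1) Hi erefl Nn A1).
  move=> s2 [D2 _ _ _ T2] [Fv2 Fa2]; wgo.
  have -> : vr s2 vS = i by rewrite Fv2.
  have -> : ar s2 aANC = anc by rewrite Fa2.
  apply: wp_frame; set s3 := setv _ vSRC (anc i).
  have A3 : adj_lists n M e (ar s3 aHD) (ar s3 aNX) (ar s3 aDST).
    by rewrite /s3 /= (Fa2 0) // (Fa2 1) // (Fa2 2).
  have N3 : vr s3 vN = n by rewrite /s3 /= Fv2.
  apply: wp_mono (bfs_ok raw B Md (s := s3) Ha' erefl N3 A3).
  move=> s4 [D4 _ _ _ T4] [Fv4 Fa4].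
  have DS v : v < n -> ar s4 aD2 v = (d i v).+1.
    by move=> Hv; have [_ ->] := D4 _ Hv; have [] := D2 _ Hv.
  have DA v : v < n -> ar s4 aD1 v = (d (anc i) v).+1 by move=> /D4[].
  have N4 : vr s4 vN = n by rewrite Fv4.
  have S4 : vr s4 vS = i by rewrite Fv4 //= Fv2.
  have L4 v : v < n -> ar s4 aLB v = (lab v).+1.
    by move=> Hv; rewrite Fa4 //= Fa2 //= Ln HL.
  have B4 : vr s4 vBEST = vr s' vBEST by rewrite Fv4 //= Fv2.
  have T : clock s4 <= clock s' + 4 + 2 * (8 + 9 * n + 8 * M).
    by move: T2 T4; rewrite /s3 /s1 /=; lia.
  have sep u w : u < n -> w < n -> lab u = i -> lab w != i ->
      d i u + d i w <= d u w \/ d (anc i) u + d (anc i) w <= d u w.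
    move=> Hu Hw Lu Nw; rewrite (dist_sym Md Hi Hu) (dist_sym Md Ha' Hu) -Lu.
    by apply: (class_separation Md Lb) => //; rewrite Lu eq_sym.
  have bnd x v : x < n -> v < n -> 0 < (d x v).+1 <= n.
    by move=> Hx Hv; rewrite /= (dist_ltn Md).
  apply: wp_seq; apply: wp_frame.
  have P1 := @through_ok raw B n i dmax lab aD2 aD1 s4 erefl erefl N4 S4 L4.
  apply: wp_mono (P1 _ _ _ _).
  + move=> s5 [B5 Q5 T5] [Fv5 Fa5].
    have D52 : ar s5 aD2 = ar s4 aD2 by rewrite Fa5.
    have D51 : ar s5 aD1 = ar s4 aD1 by rewrite Fa5.
    have L5 v : v < n -> ar s5 aLB v = (lab v).+1 by move=> Hv; rewrite Fa5 // L4.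
    have N5 : vr s5 vN = n by rewrite Fv5.
    have S5 : vr s5 vS = i by rewrite Fv5.
    have P2 := @through_ok raw B n i dmax lab aD1 aD2 s5 erefl erefl N5 S5 L5.
    rewrite D51 D52 in P2; apply: wp_mono (P2 _ _ _ _).
    * move=> s6 [B6 Q6 T6]; split=> /=.
      - by case/andP: B6.
      - have Hle : vr s' vBEST <= vr s6 vBEST by lia.
        move=> u w Hu Hw Hor; case: (eqVneq (lab u) (lab w)) => Elab.
          by apply: leq_trans Hle; apply: H2 => //; left.
        case: Hor => [E|]; first by rewrite E eqxx in Elab.
        rewrite ltnS leq_eqVlt => /orP[/eqP Lu|Hlt]; last first.
          by apply: leq_trans Hle; apply: H2 => //; right.
        have Nw : lab w != i by rewrite eq_sym -Lu.
        (* At least one comparison of the detours holds, and by the triangle inequality the sum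
           recorded for it is at least [d u w]. *)
        have q5 := Q5 _ _ Hu Hw Lu Nw; have q6 := Q6 _ _ Hu Hw Lu Nw.
        rewrite !DS ?DA // in q5; rewrite !DS ?DA // in q6.
        have t1 := dist_tri Md Hu Hi Hw; rewrite (dist_sym Md Hu Hi) in t1.
        have t2 := dist_tri Md Hu Ha' Hw; rewrite (dist_sym Md Hu Ha') in t2.
        by lia.
      - rewrite big_ord_recr /= El eqxx; move: H3; set S := \sum_(_ < _) _ => H3.
        by rewrite mulnDr muln1 {2}/class_cost; lia.
    * by move=> v Hv; rewrite DS ?DA // !bnd.
    * by move=> v Hv; rewrite DA //; apply: Hdmax.
    (* By separation one of the two detours is at most [d u w], hence so is the smaller one, which
       is the one tested. *)
    * move=> u w Hu Hw Lu Nw; rewrite !DS ?DA // => Hk.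
      by have := Hdmax Hu Hw; case: (sep _ _ Hu Hw Lu Nw); lia.
    * by case/andP: B5.
  + by move=> v Hv; rewrite DS ?DA // !bnd.
  + by move=> v Hv; rewrite DS //; apply: Hdmax.
  + move=> u w Hu Hw Lu Nw; rewrite !DS ?DA // => Hk.
    by have := Hdmax Hu Hw; case: (sep _ _ Hu Hw Lu Nw); lia.
  + by rewrite B4.
- move=> s' _ [H1 H2 H3]; split=> //=; last by move: H3; set S := \sum_(_ < _) _; lia.
  by move=> u w Hu Hw; apply: H2 => //; right; have [] := lab_idem Lb Hu.
Qed.

End Main.

(** * Counting non-tree edges *)

Section Forest.
Variable (n : nat).
Implicit Types (S F : {set {set 'I_n}}) (A f : {set 'I_n}) (e : rel 'I_n).

(** Prolong a simple path at its front [x] by a neighbour other than the preceding vertex. Within n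
    steps a vertex recurs, and the cycle closed has length at least 3 because that neighbour was not
    the preceding one. *)
Lemma cycle_of_degree2 e A x0 : symmetric e -> irreflexive e -> x0 \in A ->
  (forall x, x \in A -> exists y z, [/\ y != z, y \in A, z \in A, e x y & e x z]) ->
  exists c, is_cycle e c.
Proof.
move=> Se Ie A0 HA.
suff H k x p : n - size p < k -> x \in A -> uniq (x :: p) -> path e x p ->
    exists c, is_cycle e c by apply: (H n.+1 x0 [::]); rewrite //= subn0.
elim: k x p => // k IH x p Hk Ax Ux Px.
have [y [Ny Ay Exy]] : exists y, [/\ y != head x p, y \in A & e x y].
  have [y [z [N Ay Az Ey Ez]]] := HA _ Ax.
  case: (eqVneq y (head x p)) => [E|]; last by exists y.
  by exists z; split=> //; rewrite -E eq_sym.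
have Nyx : y != x by apply/eqP=> E; rewrite E Ie in Exy.
case: (boolP (y \in p)) => [yp|Nyp]; last first.
  have Uy : uniq (y :: x :: p) by rewrite cons_uniq inE negb_or Nyx Nyp.
  have Sy : size (y :: x :: p) <= n.
    by rewrite -(card_uniqP Uy) -[X in _ <= X]card_ord max_card.
  have Hk' : n - size (x :: p) < k by move: Hk Sy; rewrite /=; clear; lia.
  by apply: (IH _ _ Hk' Ay Uy); rewrite /= Se Exy.
case/splitPr: yp Ux Px Ny {Hk} => p1 p2 Ux Px Ny; exists (x :: rcons p1 y); split.
- move: Ux; rewrite -cat_rcons -cat_cons cat_uniq; by case/andP.
- by case: p1 Ny {Ux Px} => [|a p1]; rewrite /= ?eqxx // size_rcons.
- move: Px; rewrite -cat_rcons cat_path => /andP[P1 _].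
  by rewrite /= rcons_path P1 last_rcons Se.
Qed.

Lemma adjE_sym S : symmetric (adjE S).
Proof. by move=> x y; rewrite /adjE eq_sym setUC. Qed.

(** Induction on the vertex set [A]: some vertex has at most one edge inside [A], since otherwise
    [cycle_of_degree2] yields a cycle; removing it loses at most one edge. *)
Lemma acyclic_card S : 0 < n ->
  (forall f, f \in S -> exists x y, x != y /\ f = [set x; y]) ->
  acyclic (adjE S) -> #|S| < n.
Proof.
move=> n0 HS HA.
pose T A := [set f in S | f \subset A].
suff H k A : #|A| = k.+1 -> #|T A| < #|A|.
  have -> : S = T setT by apply/setP=> f; rewrite inE subsetT andbT.
  by rewrite -[X in _ < X]card_ord -cardsT; apply: (H n.-1); rewrite cardsT card_ord prednK.
elim: k A => [|k IH] A cA.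
  rewrite cA ltnS leqn0 cards_eq0; apply/eqP/setP=> f; rewrite !inE.
  apply/negP=> /andP[/HS[x [y [N ->]]] /subset_leq_card].
  by rewrite cards2 N cA.
have [v [vA Dv]] : exists v, v \in A /\ #|[set f in T A | v \in f]| <= 1.
  case: (boolP [exists v in A, #|[set f in T A | v \in f]| <= 1]).
    by case/exists_inP=> v Hv Dv; exists v.
  move=> /exists_inPn HN; exfalso.
  have [x0 A0] : exists x0, x0 \in A by apply/card_gt0P; rewrite cA.
  suff [c [U1 U2 U3]] : exists c, is_cycle (adjE (T A)) c.
    apply: (HA c); split=> //; apply: sub_cycle U3 => x y /andP[N].
    by rewrite inE => /andP[H _]; rewrite /adjE N.
  apply: (cycle_of_degree2 (adjE_sym _) _ A0) => [x|x Ax]; first by rewrite /adjE eqxx.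
  have := HN _ Ax; rewrite -ltnNge => /card_gt1P[f [g [Hf Hg Nfg]]].
  have nb f' : f' \in [set f in T A | x \in f] ->
      exists y, [/\ y \in A, adjE (T A) x y & f' = [set x; y]].
    rewrite inE => /andP[Tf xf]; have := Tf; rewrite inE => /andP[Sf fA].
    have [a [b [Nab Ef]]] := HS _ Sf; move: xf; rewrite Ef !inE => /orP[]/eqP Ex.
      exists b; rewrite /adjE Ex Nab -Ef; split=> //.
      by apply: (subsetP fA); rewrite Ef set22.
    exists a; rewrite /adjE Ex eq_sym Nab [[set b; a]]setUC -Ef; split=> //.
    by apply: (subsetP fA); rewrite Ef set21.
  have [y [Ay Ey Ef]] := nb _ Hf; have [z [Az Ez Eg]] := nb _ Hg.
  by exists y, z; split=> //; apply: contra Nfg => /eqP E; rewrite Ef Eg E.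
have cAv : #|A :\ v| = k.+1 by have := cardsD1 v A; rewrite vA cA => -[].
have := IH _ cAv; rewrite cAv cA !ltnS => Hk.
have sub : T A \subset [set f in T A | v \in f] :|: T (A :\ v).
  apply/subsetP=> f; rewrite !inE => /andP[Sf fA]; rewrite Sf fA /=.
  by rewrite subsetD1 fA /=; case: (v \in f).
have := subset_leq_card sub; rewrite cardsU => H.
by apply: leq_trans H _; apply: leq_trans (leq_subr _ _) _; rewrite -add1n leq_add.
Qed.

End Forest.

(** Every vertex but the root is the lower end of a tree edge in the list, so at least n - 1 entries
    are tree edges. *)
Lemma nontree_count n e d par q pos el : bfs_tree n e d par q pos ->
  (forall x y, e x y = erel el x y) -> count (nontree par) el + n <= (size el).+1.
Proof.
move=> Tr He; have n0 := tr_n Tr.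
pose child p := if par p.1 == p.2 then p.1 else p.2 : nat.
have : size (iota 1 n.-1) <= size (map child (filter (predC (nontree par)) el)).
  apply: uniq_leq_size; first exact: iota_uniq.
  move=> v; rewrite mem_iota => Hv.
  have [Hvn v0] : v < n /\ v != 0 by lia.
  (* [child] tests the first component only, so two vertices must not be parents of each other;
     depths exclude it. *)
  have Npp : par (par v) != v.
    apply/eqP=> E; have D1 := tr_dep Tr Hvn v0.
    case: (eqVneq (par v) 0) => [P0|P0].
      by move: v0; rewrite -E P0 (tr_root Tr).
    have := tr_dep Tr (tr_par Tr Hvn) P0; rewrite E; lia.
  have := tr_edge Tr Hvn v0; rewrite He => /orP[Hin|Hin]; apply/mapP.
    exists (par v, v); rewrite /child /= ?(negPf Npp) //.
    by rewrite mem_filter Hin /= /nontree /= eqxx andbF.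
  exists (v, par v); rewrite /child /= ?eqxx //.
  by rewrite mem_filter Hin /= /nontree /= eqxx.
rewrite size_iota size_map size_filter -(count_predC (nontree par) el).
move: (count (predC _) _); move: (count _ _) => a b; clear -n0; lia.
Qed.

Lemma edges_card n (es : seq ('I_n * 'I_n)) :
  uniq [seq [set p.1; p.2] | p <- es] -> #|edges_of es| = size es.
Proof.
move=> U; rewrite -(size_map (fun p : 'I_n * 'I_n => [set p.1; p.2])).
rewrite -(card_uniqP U); apply: eq_card => f.
by apply/imsetP/mapP=> -[p Hp ->]; exists p.
Qed.

(** Deleting the feedback edges leaves a forest, with fewer than n edges. *)
Lemma feedback_size n (es : seq ('I_n * 'I_n)) k : 0 < n ->
  all (fun p : 'I_n * 'I_n => p.1 != p.2) es ->
  uniq [seq [set p.1; p.2] | p <- es] ->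
  feedback_edge_number (edges_of es) k -> size es < k + n.
Proof.
move=> n0 Hl U [[F [FE cF aF]] _].
have : #|edges_of es :\: F| < n.
  apply: acyclic_card => // f /setDP[/imsetP[p Hp ->] _].
  by exists p.1, p.2; split=> //; apply: (allP Hl).
rewrite cardsD (setIidPr FE) edges_card // cF; lia.
Qed.

(** * The complete algorithm *)

Definition diameter_cmd :=
  build_adj;; vSRC ::= #0;; bfs;; copy_tree;; mark_ends;; label_up;;
  label_down;; vBEST ::= #0;; heights;; main_loop.

Section Graph.
Variables (n : nat) (es : seq ('I_n * 'I_n)).
Hypothesis Hloop : all (fun p : 'I_n * 'I_n => p.1 != p.2) es.
Let el := nat_edges es.
Let e := erel el.

Lemma nat_edges_mem p : p \in el -> [/\ p.1 < n, p.2 < n & p.1 != p.2].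
Proof.
case/mapP=> -[a b] Hp ->; split; rewrite ?ltn_ord //=.
by have := allP Hloop _ Hp.
Qed.

Lemma erel_loop x y : e x y -> x != y.
Proof.
by move=> /orP[]/nat_edges_mem[_ _] /=; rewrite // eq_sym.
Qed.

Lemma erel_graph : graph_on n e.
Proof.
split=> [x y|x y]; first by move=> /orP[]/nat_edges_mem[].
by rewrite /e /erel orbC.
Qed.

Lemma adjE_erel (x y : 'I_n) : adjE (edges_of es) x y = e x y.
Proof.
have inel u v : ((val u, val v) \in el) = ((u, v) \in es).
  apply/mapP/idP=> [[[a b] Hp [/val_inj-> /val_inj->]]//|H].
  by exists (u, v).
rewrite /e /erel !inel; apply/idP/idP=> [/andP[N /imsetP[[a b] Hp /setP E]]|Hor].
  have Ex := E x; have Ey := E y.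
  rewrite !inE !eqxx ?orbT /= in Ex Ey; move: N Ex Ey.
  move=> N /esym/orP[/eqP Ex|/eqP Ex] /esym/orP[/eqP Ey|/eqP Ey];
    rewrite Ex Ey ?eqxx // in N *; by rewrite Hp ?orbT.
have Nxy : x != y.
  by case/orP: Hor => /(allP Hloop) //=; rewrite eq_sym.
rewrite /adjE Nxy /=; apply/imsetP; case/orP: Hor => H; first by exists (x, y).
by exists (y, x); rewrite //= setUC.
Qed.

Lemma path_erel (u : 'I_n) p : path (adjE (edges_of es)) u p ->
  path e u (map val p) /\ last (val u) (map val p) = last u p.
Proof.
move=> Hp; rewrite last_map; split=> //; rewrite path_map.
by rewrite (eq_path (e' := adjE (edges_of es))) // => x y; rewrite adjE_erel.
Qed.

Lemma path_adjE (u : 'I_n) p : path e u p ->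
  exists p', path (adjE (edges_of es)) u p' /\ map val p' = p.
Proof.
elim: p u => [|y p IH] u /=; first by exists [::].
move=> /andP[E Pp]; have [_ Hy] := edge_bound erel_graph E.
have [p' [P1 P2]] := IH (Ordinal Hy) Pp.
by exists (Ordinal Hy :: p'); rewrite /= adjE_erel E P2.
Qed.

Lemma erel_connected : (forall u v : 'I_n, connect (adjE (edges_of es)) u v) ->
  forall x y, x < n -> y < n -> exists2 p, path e x p & last x p = y.
Proof.
move=> Hc x y Hx Hy; have /connectP[p P1 E] := Hc (Ordinal Hx) (Ordinal Hy).
have [P2 L2] := path_erel P1; exists (map val p) => //.
by rewrite [LHS]L2 -E.
Qed.

Lemma is_diameter_erel d b : metric n e d -> 0 < n ->
  (forall u w, u < n -> w < n -> d u w <= b) ->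
  (exists u w, [/\ u < n, w < n & b <= d u w]) ->
  is_diameter (adjE (edges_of es)) b.
Proof.
move=> Md n0 H1 [u [w [Hu Hw H2]]]; split=> [x y|].
  have [p [P1 L1 S1]] := metric_path Md (ltn_ord x) (ltn_ord y).
  have [p' [P2 E2]] := path_adjE P1; exists p'; rewrite /walk P2 /=; split.
    have [_ L2] := path_erel P2; rewrite E2 in L2.
    by apply/eqP/val_inj; rewrite /= -L2.
  by rewrite -(size_map val) E2 S1 H1.
exists (Ordinal Hu), (Ordinal Hw) => p /andP[P1 /eqP L1].
have [P2 L2] := path_erel P1; apply: leq_trans H2 _.
have := metric_le Md Hu P2; rewrite size_map; apply: leq_trans.
by rewrite [last _ _]L2 L1.
Qed.

End Graph.

(** Both bounds on the anchors are exported. The second is anchors <= 2 (1 + 2 c), with c the number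
    of non-tree edges, combined with c + n <= m + 1. *)
Lemma diameter_cmd_ok raw n (es : seq ('I_n * 'I_n)) d s :
  let el := nat_edges es in let m := size es in
  0 < n -> 0 < m ->
  all (fun p : 'I_n * 'I_n => p.1 != p.2) es ->
  metric n (erel el) d ->
  vr s 1 = 32 * m -> vr s 2 = n -> (forall a i, a < 16 -> ar s a i = 0) ->
  clock s = 0 ->
  (forall p, 2 <= p < 2 * m + 2 ->
     raw (if p <= rmax then 32 * m + p.-1 else p) = init_mem es p) ->
  wp raw (32 * m + 31) diameter_cmd (fun s' => exists anchors,
    [/\ forall u w, u < n -> w < n -> d u w <= vr s' vBEST,
      exists u w, [/\ u < n, w < n & vr s' vBEST <= d u w],
      anchors <= n, anchors + 4 * n <= 4 * m + 6 &
      clock s' <= 29 + 48 * n + 46 * m + class_cost n (2 * m) * anchors]) s.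
Proof.
move=> el m n0 m0 Hloop Md V1 V2 A0 C0 Hraw.
have Ge := metric_graph Md.
have size_el : size el = m by rewrite size_map.
pose dmax := \max_(u < n) \max_(w < n) d u w.
have Hdmax u w : u < n -> w < n -> d u w <= dmax.
  move=> Hu Hw; rewrite /dmax.
  apply: leq_trans (leq_bigmax (Ordinal Hu)).
  exact: (leq_bigmax (F := fun w : 'I_n => d u w) (Ordinal Hw)).
have cn : 0 < #|'I_n| by rewrite card_ord.
have Hatt : exists u w, [/\ u < n, w < n & dmax <= d u w].
  have [u Eu] := eq_bigmax (fun u : 'I_n => \max_(w < n) d u w) cn.
  have [w Ew] := eq_bigmax (fun w : 'I_n => d u w) cn.
  by exists u, w; rewrite /dmax Eu Ew !ltn_ord.
apply: wp_seq; apply: wp_frame; apply: wp_mono (build_adj_ok m0 Hraw V1 A0).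
move=> s1 [M1 Adj1 Dst1 T1] [Fv1 Fa1]; wgo.
apply: wp_frame; set s1' := setv _ _ _.
have N1 : vr s1' vN = n by rewrite /s1' /= Fv1.
apply: wp_mono (bfs_ok raw _ Md (s := s1') n0 erefl N1 Adj1).
move=> s2 [_ [Q2 q0] [P20 P2] Mono2 T2] [Fv2 Fa2].
have N2 : vr s2 vN = n by rewrite Fv2.
apply: wp_seq; apply: wp_frame; apply: wp_mono (copy_tree_ok raw _ N2).
move=> s3 [R3 T3] [Fv3 Fa3].
have N3 : vr s3 vN = n by rewrite Fv3.
have RQ i : i < n -> ar s3 aRQ i = ar s2 aQ i by move=> /R3[].
have RP i : i < n -> ar s3 aRP i = ar s2 aPAR i by move=> /R3[].
have [pos Tr] : exists pos, bfs_tree n (erel el) d (ar s3 aRP) (ar s3 aRQ) pos.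
  apply: (bfs_tree_exists Md) => //.
  - by rewrite RP.
  - by rewrite RQ.
  - by move=> v Hv v0; rewrite RP //; apply: P2.
  - have -> : map (ar s3 aRQ) (iota 0 n) = map (ar s2 aQ) (iota 0 n) => //.
    by apply/eq_in_map=> i; rewrite mem_iota; apply: RQ.
  - by move=> i j Hij; rewrite !RQ ?Mono2 //; lia.
have F3 a : a \in [:: 9; 10; 11; 12; 13] -> forall i, ar s3 a i = 0.
  rewrite !inE; do !case/orP; move/eqP=> -> i;
  by rewrite Fa3 // Fa2 // /s1' /= Fa1 // A0.
have HM3 : vr s3 vM = size el by rewrite size_el Fv3 // Fv2.
have HD3 i : i < size el -> ar s3 aDST (2 * i + 1) = (nth (0, 0) el i).2 /\
                            ar s3 aDST (2 * i + 2) = (nth (0, 0) el i).1.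
  by rewrite size_el Fa3 // Fa2 //; apply: Dst1.
apply: wp_seq; apply: wp_frame.
apply: wp_mono (mark_ends_ok raw _ HM3 n0 (@nat_edges_mem _ _ Hloop) _ HD3); last exact: F3.
move=> s4 [K40 K4n K4e K4c T4] [Fv4 Fa4]; rewrite size_el in T4.
have N4 : vr s4 vN = n by rewrite Fv4.
have P4 : ar s4 aRP = ar s3 aRP by rewrite Fa4.
have Q4 : ar s4 aRQ = ar s3 aRQ by rewrite Fa4.
have Z4 i : [/\ ar s4 aLB i = 0, ar s4 aCT i = 0 & ar s4 aANC i = 0].
  by rewrite !Fa4 // !F3.
apply: wp_seq; apply: wp_frame.
apply: wp_mono (label_up_ok raw _ Tr N4 P4 Q4 Z4 K40).
move=> s5 [U5 T5] [Fv5 Fa5].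
have N5 : vr s5 vN = n by rewrite Fv5.
have P5 : ar s5 aRP = ar s3 aRP by rewrite Fa5.
have Q5 : ar s5 aRQ = ar s3 aRQ by rewrite Fa5.
have L50 : ar s5 aLB 0 <> 0 by rewrite (up_mk U5) ?(seen0 _ n0).
apply: wp_seq; apply: wp_frame.
apply: wp_mono (label_down_ok raw _ Tr N5 P5 Q5 L50).
move=> s6 [L6 T6] [Fv6 Fa6].
have [Lb6 L6nz L6c] := labelling_of_up Tr U5 K4e (@erel_loop _ _ Hloop) K40 K4n L6.
set lab := fun v => (ar s6 aLB v).-1 in Lb6.
wgo; apply: wp_frame; set s6' := setv s6 _ _.
have N6 : vr s6' vN = n by rewrite /s6' /= Fv6.
have P6 : ar s6' aRP = ar s3 aRP by rewrite /s6' /= Fa6.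
have Q6 : ar s6' aRQ = ar s3 aRQ by rewrite /s6' /= Fa6.
have LB6 v : v < n -> ar s6' aLB v = (lab v).+1.
  by move=> Hv; rewrite /lab prednK // lt0n L6nz.
have H6 i : ar s6' aH i = 0 by rewrite /s6' /= Fa6 // Fa5 // Fa4 // F3.
apply: wp_mono (heights_ok raw _ Md Tr N6 P6 Q6 Lb6 LB6 H6 erefl Hdmax).
move=> s7 [B7 In7 T7] [Fv7 Fa7].
have N7 : vr s7 vN = n by rewrite Fv7.
have Adj7 : adj_lists n (2 * m) (erel el) (ar s7 aHD) (ar s7 aNX) (ar s7 aDST).
  have E a : a \in [:: 0; 1; 2] -> ar s7 a = ar s1 a.
    rewrite !inE; do !case/orP; move/eqP=> ->;
    by rewrite Fa7 // /s6' /= Fa6 // Fa5 // Fa4 // Fa3 // Fa2.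
  by rewrite !E.
have L7 v : v < n -> ar s7 aLB v = (lab v).+1 by move=> Hv; rewrite Fa7 // LB6.
have A7 : ar s7 aANC = ar s5 aANC by rewrite Fa7 // /s6' /= Fa6.
apply: wp_mono (main_loop_ok raw _ Md Lb6 Hdmax N7 Adj7 L7 A7 B7 In7).
move=> s8 [B8 All8 T8].
have anchorsE : \sum_(v < n) (lab v == v) = \sum_(v < n) (ar s6 aLB v == v.+1).
  apply: eq_bigr => v _; congr nat_of_bool; rewrite /lab.
  by have := L6nz _ (ltn_ord v); case: (ar s6 aLB v).
exists (\sum_(v < n) (lab v == v)); split=> //.
- have [u [w [Hu Hw Hd]]] := Hatt; exists u, w; split=> //; exact: leq_trans B8 Hd.
- rewrite -[X in _ <= X]card_ord -sum1_card; apply: leq_sum => v _; exact: leq_b1.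
- have := nontree_count Tr (fun x y => erefl); rewrite size_el anchorsE.
  have := leq_trans L6c (leq_mul (leqnn 2) K4c).
  move: (count _ _) (\sum_(v < n) _) => c S; lia.
- move: T8; set S := \sum_(v < n) (lab v == v) => T8.
  have T : clock s7 <= 27 + 44 * n + 46 * m.
    by move: T1 T2 T3 T4 T5 T6 T7; rewrite /s1' /s6' C0 /=; lia.
  by move: T8 T; lia.
Qed.

Theorem theorem3 :
  exists (P : program) (c : nat),
  forall (n : nat) (es : seq ('I_n * 'I_n)) (k : nat),
    0 < n ->
    (* simple graph: no loops, no repeated edges *)
    all (fun p : 'I_n * 'I_n => p.1 != p.2) es ->
    uniq [seq [set p.1; p.2] | p <- es] ->
    (* connected *)
    (forall u v : 'I_n, connect (adjE (edges_of es)) u v) ->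
    feedback_edge_number (edges_of es) k ->
    exists t : nat,
      t <= c * (k + 1) * n /\
      halted P (run P t (init_state es)) /\
      is_diameter (adjE (edges_of es)) (regs (run P t (init_state es)) 0).
Proof.
(* [weight] converts ticks into machine steps; 512 exceeds the coefficients of k n (478) and of n
   (371) to which the tick count can be estimated. *)
exists (assemble diameter_cmd), (2 + size prelude + weight diameter_cmd * 512).
move=> n es k n0 Hloop Huniq Hconn Hk.
have [d Md] := metric_exists (erel_graph Hloop) (erel_connected Hloop Hconn).
have Hm := feedback_size n0 Hloop Huniq Hk.
have kn : 0 < (k + 1) * n by rewrite muln_gt0 addn1.
case: (posnP (size es)) => [m0|m0].
  have [H1 H2] := assemble_nil diameter_cmd m0.
  exists 2; split; [|split] => //.
    by rewrite -mulnA -[X in X <= _]muln1; apply: leq_mul => //; rewrite -addnA leq_addr.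
  rewrite H2; apply: (is_diameter_erel Hloop Md) => //; last by exists 0, 0.
  (* Without edges, connectedness leaves a single vertex. *)
  have one x y : x < n -> y < n -> x = y.
    move=> Hx Hy; have [p P1 <-] := erel_connected Hloop Hconn Hx Hy.
    case: p P1 => //= z p /andP[]; by rewrite /erel /nat_edges (size0nil m0).
  by move=> u w Hu Hw; rewrite (one u w) // (dist0 Md).
have wf : cwf diameter_cmd by [].
have [t [s [m [Ht Hrun Hhalt H0 [S [Q1 Q2 Q3 Q4 Q5]]]]]] :=
  assemble_ok m0 wf (fun raw s V1 V2 A0 C0 Hraw =>
    diameter_cmd_ok n0 m0 Hloop Md V1 V2 A0 C0 Hraw).
exists t; rewrite Hrun; split; [|split] => //; last first.
  by rewrite /= H0; apply: (is_diameter_erel Hloop Md).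
apply: leq_trans Ht _.
have Hc : clock s <= 512 * ((k + 1) * n).
  apply: leq_trans Q5 _.
  have S1 : S <= 4 * k + 2 by move: Q4 Hm; clear; lia.
  have mn : size es <= k + n by move: Hm; clear; lia.
  (* The products for [nia]: n S <= n (4 k + 2), k S <= k n and m S <= (k + n) S. *)
  have := leq_mul (leqnn n) S1; have := leq_mul (leqnn k) Q3.
  have := leq_mul mn (leqnn S); move: mn n0; rewrite /class_cost; clear; nia.
rewrite -mulnA mulnDl; apply: leq_add; first by rewrite -{1}[2 + _]muln1 leq_mul.
by rewrite -mulnA leq_mul.
Qed.
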